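(* For integers $k,l\ge 0$ let $Q_{k,l}$ be the quiver with vertices $t_1,\dots,t_{k+l},b_1,\dots,b_k$ and arrows $t_i\to t_{i+1}$ ($1\le i<k+l$), $b_i\to b_{i+1}$ ($1\le i<k$), $b_i\to t_i$ ($1\le i\le k$), and $t_{i+1}\to b_i$ ($1\le i<k$). Let $A$ be a skew-symmetric cluster algebra over $\mathbb{C}$ (with an arbitrary choice of frozen variables, all of them invertible) such that the principal (mutable) part of its quiver is mutation equivalent to $Q_{k,l}$ for some $k,l\ge 0$, and let $\mathcal{A}=\operatorname{Spec}A$. Then $\mathcal{A}$ has no mysterious points, i.e. $\mathcal{D}(\mathcal{A})=\mathcal{S}(\mathcal{A})$. This includes: (1) all cluster algebras of simply laced finite cluster type (with arbitrary frozen variables); and (2) the cluster algebras of the top positroid strata $\mathcal{A}(2,n)$ and $\mathcal{A}(3,n)$.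
   Context: Cluster algebras. An ice quiver has $n$ mutable vertices $1,\dots,n$ and $m$ frozen vertices $n+1,\dots,n+m$, no loops or oriented 2-cycles, and no arrows between frozen vertices. Its (extended) exchange matrix is the $(n+m)\times n$ integer matrix $\tilde B=(b_{ij})$, with $b_{ij}$ the signed number of arrows between $i$ and $j$; its top $n\times n$ block $B$ is the (skew-symmetric) principal part. A seed is a pair $(\tilde{\mathbf x},\tilde B)$ where $\tilde{\mathbf x}=(x_1,\dots,x_{n+m})$ freely generates the field $\mathcal F=\mathbb{C}(x_1,\dots,x_{n+m})$. Mutation at a mutable $k$ performs quiver mutation and replaces $x_k$ by $x_k'=x_k^{-1}\big(\prod_{b_{ik}>0}x_i^{b_{ik}}+\prod_{b_{ik}<0}x_i^{-b_{ik}}\big)$. The cluster algebra $A\subset\mathcal F$ is the $\mathbb{C}[x_{n+1}^{\pm1},\dots,x_{n+m}^{\pm1}]$-subalgebra generated by all cluster variables of all seeds obtained by iterated mutation; $\Sigma(A)$ is the set of these seeds, and $\mathcal A=\operatorname{Spec}A$ is the cluster variety. For $t\in\Sigma(A)$ the cluster torus $T(t)\subseteq\mathcal A$ is the open locus where all variables of $t$ are nonzero; it is an $(n+m)$-dimensional algebraic torus. The deep locus is $\mathcal D(\mathcal A)=\mathcal A\setminus\bigcup_{t\in\Sigma(A)}T(t)$. $\operatorname{Aut}(A)$ is the group of cluster automorphisms: algebra automorphisms of $A$ sending every (mutable or frozen) cluster variable to a nonzero scalar multiple of itself. The stabilizer locus is $\mathcal S(\mathcal A)=\{x\in\mathcal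 A: \operatorname{Stab}_{\operatorname{Aut}(A)}(x)\ne\{1\}\}$; one always has $\mathcal S(\mathcal A)\subseteq\mathcal D(\mathcal A)$. A mysterious point is a point of $\mathcal D(\mathcal A)\setminus\mathcal S(\mathcal A)$. Simply laced finite cluster type means that the mutable part of the quiver is mutation equivalent to an orientation of a simply laced ($ADE$) Dynkin diagram. $\mathcal A(k,n)$ is the top (maximal open) positroid stratum of $\operatorname{Gr}(k,n)$, i.e. the locus where all Plücker coordinates indexed by cyclic intervals of length $k$ are nonzero, with Scott's cluster structure. *)

(* Defs.v *)
From HB Require Import structures.
From mathcomp Require Import all_boot all_order all_algebra.
From mathcomp Require Import fraction complex mpoly.
From mathcomp Require Import boolp classical_sets reals.

Set Implicit Arguments.
Unset Strict Implicit.
Unset Printing Implicit Defensive.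

Import GRing.Theory Num.Theory.
Local Open Scope ring_scope.

Definition zpos (a : int) : int := Num.max a 0.

(* Entry (i, j) of an exchange matrix is #(arrows i -> j) - #(arrows j -> i).
   Rows may include frozen vertices, columns are the mutable ones;
   [emb] sends a mutable vertex to its row. *)
Definition mutmx (r n : nat) (emb : 'I_n -> 'I_r) (k : 'I_n)
    (B : 'M[int]_(r, n)) : 'M[int]_(r, n) :=
  \matrix_(i, j)
    if (i == emb k) || (j == k) then - B i j
    else B i j + zpos (B i k) * zpos (B (emb k) j)
               - zpos (- B i k) * zpos (- B (emb k) j).

Definition quiver_mut_seq (n : nat) (B : 'M[int]_n) (ks : seq 'I_n) : 'M[int]_n :=
  foldl (fun B' k => mutmx id k B') B ks.

(* A quiver without multiple arrows on a finite vertex set V is given by its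
   arrow relation. *)
Definition mutation_equivalent_to (n : nat) (B : 'M[int]_n) (V : finType)
    (arrow : rel V) : Prop :=
  exists (ks : seq 'I_n) (f : 'I_n -> V), bijective f /\
    forall i j, quiver_mut_seq B ks i j
                = (arrow (f i) (f j) : nat)%:Z - (arrow (f j) (f i) : nat)%:Z.

(* [inl i] is t_(i+1) and [inr i] is b_(i+1). *)
Definition Qkl (k l : nat) : rel ('I_(k + l) + 'I_k)%type := fun u v =>
  match u, v with
  | inl i, inl j => j == i.+1 :> nat
  | inr i, inr j => j == i.+1 :> nat
  | inr i, inl j => j == i :> nat
  | inl i, inr j => (i == j.+1 :> nat) && (j.+1 < k)%N
  end.

Inductive dynkin := DynkinA of nat | DynkinD of nat | DynkinE of nat.

Definition dynkin_valid (d : dynkin) : bool :=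
  match d with
  | DynkinA n => (0 < n)%N
  | DynkinD n => (3 < n)%N
  | DynkinE n => (5 < n < 9)%N
  end.

Definition dynkin_rank (d : dynkin) : nat :=
  match d with DynkinA n | DynkinD n | DynkinE n => n end.

(* The path 0 - 1 - ... - (n-2), with the last vertex n-1 attached to a. *)
Definition branched_edge (n a : nat) (i j : nat) : bool :=
  (j == i.+1) && (j < n.-1)%N || (i == a) && (j == n.-1).

Definition dynkin_half_edge (d : dynkin) (i j : nat) : bool :=
  match d with
  | DynkinA n => j == i.+1
  | DynkinD n => branched_edge n (n - 3) i j
  | DynkinE n => branched_edge n 2 i j
  end.

Definition dynkin_edge (d : dynkin) : rel 'I_(dynkin_rank d) :=
  fun i j => dynkin_half_edge d i j || dynkin_half_edge d j i.

Definition orientation_of (V : finType) (edge arrow : rel V) : Prop :=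
  forall u v, edge u v = arrow u v (+) arrow v u
              /\ ~~ (arrow u v && arrow v u).

(* [lshift m k] is a mutable vertex, [rshift n j] a frozen one. *)
Record seed (K : fieldType) (n m : nat) := Seed {
  variables : {ffun 'I_(n + m) -> K};
  exchange_matrix : 'M[int]_(n + m, n)
}.

Definition principal_part (n m : nat) (B : 'M[int]_(n + m, n)) : 'M[int]_n :=
  usubmx B.

Definition skew_symmetric (n : nat) (B : 'M[int]_n) : Prop := B^T = - B.

(* The x_i are algebraically independent over C (embedded by iota) and K is
   generated by them as a field over C. *)
Definition freely_generates (C K : fieldType) (iota : {rmorphism C -> K})
    (N : nat) (x : 'I_N -> K) : Prop :=
  (forall p : {mpoly C[N]}, mmap iota x p = 0 -> p = 0) /\
  (forall y : K, exists p q : {mpoly C[N]},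
     mmap iota x q != 0 /\ y = mmap iota x p / mmap iota x q).

Definition is_seed (C K : fieldType) (iota : {rmorphism C -> K}) (n m : nat)
    (s : seed K n m) : Prop :=
  freely_generates iota (variables s) /\
  skew_symmetric (principal_part (exchange_matrix s)).

Definition mutate (K : fieldType) (n m : nat) (k : 'I_n) (s : seed K n m) :
    seed K n m :=
  let x := variables s in
  let B := exchange_matrix s in
  Seed [ffun i => if i == lshift m k then
          (x i)^-1 * (\prod_(j | 0 < B j k) x j ^+ `|B j k|%N
                      + \prod_(j | B j k < 0) x j ^+ `|B j k|%N)
        else x i]
       (mutmx (@lshift n m) k B).

(* The seeds of the cluster algebra with initial seed s are the
   [mutate_seq s ks]. *)
Definition mutate_seq (K : fieldType) (n m : nat) (s : seed K n m)
    (ks : seq 'I_n) : seed K n m :=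
  foldl (fun s' k => mutate k s') s ks.

Section ClusterAlgebra.
Variables (C K : fieldType) (iota : {rmorphism C -> K}).
Variables (n m : nat) (s : seed K n m).

Inductive in_cluster_algebra : K -> Prop :=
| in_ca_const c : in_cluster_algebra (iota c)
| in_ca_var ks i : in_cluster_algebra (variables (mutate_seq s ks) i)
| in_ca_frozenV j : in_cluster_algebra (variables s (rshift n j))^-1
| in_ca_add a b : in_cluster_algebra a -> in_cluster_algebra b ->
    in_cluster_algebra (a + b)
| in_ca_mul a b : in_cluster_algebra a -> in_cluster_algebra b ->
    in_cluster_algebra (a * b).

Definition ca_pred : {pred K} := fun a => `[< in_cluster_algebra a >].

Fact ca_pred_subring : subring_closed ca_pred.
Proof.
split=> [|a b /asboolP ha /asboolP hb|a b /asboolP ha /asboolP hb].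
- by apply/asboolP; rewrite -(rmorph1 iota); exact: in_ca_const.
- apply/asboolP/in_ca_add => //; rewrite -mulN1r -(rmorphN1 iota).
  by apply: in_ca_mul => //; exact: in_ca_const.
- by apply/asboolP/in_ca_mul.
Qed.

HB.instance Definition _ := GRing.isSubringClosed.Build K ca_pred ca_pred_subring.

Record cluster_algebra := ClusterElt { ca_val : K; _ : ca_val \in ca_pred }.

HB.instance Definition _ := [isSub for ca_val].
HB.instance Definition _ := [Choice of cluster_algebra by <:].
HB.instance Definition _ := [SubChoice_isSubComNzRing of cluster_algebra by <:].

Fact ca_const_subproof c : iota c \in ca_pred.
Proof. by apply/asboolP; exact: in_ca_const. Qed.

Definition ca_const (c : C) : cluster_algebra := ClusterElt (ca_const_subproof c).

Definition ca_scale (c : C) (a : cluster_algebra) : cluster_algebra :=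
  ca_const c * a.

Fact ca_scaleA a b v : ca_scale a (ca_scale b v) = ca_scale (a * b) v.
Proof. by apply: val_inj; rewrite /ca_scale !rmorphM /= rmorphM mulrA. Qed.
Fact ca_scale1 : left_id 1 ca_scale.
Proof. by move=> v; apply: val_inj; rewrite /ca_scale !rmorphM /= rmorph1 mul1r. Qed.
Fact ca_scaleDr : right_distributive ca_scale +%R.
Proof. by move=> a u v; rewrite /ca_scale mulrDr. Qed.
Fact ca_scaleDl v : {morph ca_scale^~ v : a b / a + b}.
Proof.
by move=> a b; apply: val_inj; rewrite /ca_scale rmorphD !rmorphM /= rmorphD mulrDl.
Qed.

HB.instance Definition _ := GRing.Zmodule_isLmodule.Build C cluster_algebra
  ca_scaleA ca_scale1 ca_scaleDr ca_scaleDl.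

Fact ca_scaleAl (a : C) (u v : cluster_algebra) : a *: (u * v) = a *: u * v.
Proof. exact: mulrA. Qed.

HB.instance Definition _ :=
  GRing.Lmodule_isLalgebra.Build C cluster_algebra ca_scaleAl.
HB.instance Definition _ :=
  GRing.Lalgebra_isComAlgebra.Build C cluster_algebra.

Fact ca_var_subproof ks i : variables (mutate_seq s ks) i \in ca_pred.
Proof. by apply/asboolP; exact: in_ca_var. Qed.

(* The variable at vertex i (mutable or frozen) of the seed reached from s by
   the mutations ks, as an element of the cluster algebra. *)
Definition ca_var (ks : seq 'I_n) (i : 'I_(n + m)) : cluster_algebra :=
  ClusterElt (ca_var_subproof ks i).

End ClusterAlgebra.

Section ClusterVariety.
Variables (C K : fieldType) (iota : {rmorphism C -> K}).
Variables (n m : nat) (s : seed K n m).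
Local Notation A := (cluster_algebra iota s).

(* Closed points of Spec A.  Over the complex numbers every residue field of A
   at a maximal ideal is C, because A has countable dimension. *)
Definition cluster_variety : Type := {lrmorphism A -> C^o}.

Definition cluster_torus (ks : seq 'I_n) : set cluster_variety :=
  [set p : cluster_variety | forall i, p (ca_var iota s ks i) != 0]%classic.

Definition deep_locus : set cluster_variety :=
  (~` \bigcup_ks cluster_torus ks)%classic.

Definition cluster_automorphism : set {lrmorphism A -> A} :=
  [set g : {lrmorphism A -> A} | bijective g /\ forall ks i, exists c : C,
     c != 0 /\ g (ca_var iota s ks i) = c *: ca_var iota s ks i]%classic.

Definition stabilizer (p : cluster_variety) : set {lrmorphism A -> A} :=
  [set g : {lrmorphism A -> A} | cluster_automorphism g /\ p \o g =1 p]%classic.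

Definition stabilizer_locus : set cluster_variety :=
  [set p | exists2 g, stabilizer p g & ~ (g =1 @id A)]%classic.

Definition mysterious_points : set cluster_variety :=
  (deep_locus `\` stabilizer_locus)%classic.

End ClusterVariety.

Arguments cluster_torus {C K} iota {n m} s ks.
Arguments deep_locus {C K} iota {n m} s.
Arguments stabilizer_locus {C K} iota {n m} s.
Arguments mysterious_points {C K} iota {n m} s.

Definition Qkl_type (K : fieldType) (n m : nat) (s : seed K n m) : Prop :=
  exists k l : nat,
    mutation_equivalent_to (principal_part (exchange_matrix s)) (@Qkl k l).

Definition simply_laced_finite_type (K : fieldType) (n m : nat)
    (s : seed K n m) : Prop :=
  exists (d : dynkin) (arrow : rel 'I_(dynkin_rank d)),
    [/\ dynkin_valid d, orientation_of (@dynkin_edge d) arrow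
      & mutation_equivalent_to (principal_part (exchange_matrix s)) arrow].

(* Scott's seed for the top positroid stratum of Gr(k, k + p); its cluster
   algebra is the coordinate ring of the stratum (Scott's theorem).  The Pluecker coordinates are normalized by Delta_{1, ..., k} = 1, so that
   they are rational functions on Gr(k, k + p): the generic point is the row
   span of the matrix [1 | Z], with Z a matrix of k * p indeterminates. *)

Section Scott.
Variables (C : fieldType) (k p : nat).

Definition grass_field : fieldType := {fraction {mpoly C[k * p]}}.

Definition grass_const : {rmorphism C -> grass_field} :=
  @FracField.tofrac {mpoly C[k * p]} \o @mpolyC (k * p) C.

Definition generic_matrix : 'M[grass_field]_(k, k + p) :=
  row_mx 1%:M (\matrix_(i, j) FracField.tofrac 'X_(mxvec_index i j)).

Definition pluecker (I : {set 'I_(k + p)}) : grass_field :=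
  \det (\matrix_(r < k, c < k) nth 0 [seq generic_matrix r j | j <- enum I] c).

(* Position (a, b) stands for the rectangular Young diagram with a + 1 rows and
   b + 1 columns inside the k x p box; its Pluecker coordinate is indexed by
   {1, ..., k-a-1} u {k-a+b+1, ..., k+b+1}.  The empty diagram is omitted, its
   Pluecker coordinate Delta_{1, ..., k} being 1. *)
Definition rectangle_set (ab : nat * nat) : {set 'I_(k + p)} :=
  [set c : 'I_(k + p) |
     (c < k - ab.1.+1) || (k - ab.1.+1 + ab.2.+1 <= c < k + ab.2.+1)]%N.

Definition rectangle_arrow (u v : nat * nat) : bool :=
  [|| (v.1 == u.1) && (v.2 == u.2.+1),
      (v.1 == u.1.+1) && (v.2 == u.2)
    | (u.1 == v.1.+1) && (u.2 == v.2.+1)].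

(* The mutable vertices are the rectangles with fewer than k rows and fewer
   than p columns; the frozen ones are those with k rows, followed by those
   with p columns and fewer than k rows. *)
Definition rectangle_of
    (v : 'I_((k - 1) * (p - 1) + (k + p - 1))) : nat * nat :=
  match split v with
  | inl u => (u %/ (p - 1), u %% (p - 1))%N
  | inr w => if (w < p)%N then (k - 1, w : nat)%N else (w - p, p - 1)%N
  end.

Definition scott_seed :
    seed grass_field ((k - 1) * (p - 1)) (k + p - 1) :=
  Seed [ffun v => pluecker (rectangle_set (rectangle_of v))]
       (\matrix_(u, v)
          let ru := rectangle_of u in
          let rv := rectangle_of (lshift (k + p - 1) v) in
          ((rectangle_arrow ru rv : nat)%:Z - (rectangle_arrow rv ru : nat)%:Z)).

End Scott.

(* Main.v *)
Require Import Defs.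
From HB Require Import structures.
From mathcomp Require Import all_boot all_order all_algebra.
From mathcomp Require Import fraction complex mpoly.
From mathcomp Require Import boolp classical_sets reals.
From mathcomp Require Import zify ring.

Set Implicit Arguments.
Unset Strict Implicit.
Unset Printing Implicit Defensive.

Import Order.TTheory GRing.Theory Num.Theory.
Local Open Scope ring_scope.

(* A point at which a mutable variable x_v and its mutable neighbours do not
   vanish is a deep point of the cluster algebra in which v is frozen, and a
   torus element that fixes it there also fixes it here; hence an induction on
   quivers.  Let l be a leaf attached to r.  At a deep point with x_r <> 0, one
   of x_l, x_l' can be frozen unless both vanish, and then the point comes from
   a deep point of the quiver without l and r.  If x_r = 0, then x_l and x_l' do
   not vanish; when the other neighbours of r do not vanish either, which is
   automatic if at most one of them is not a leaf, the pentagon relation leads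
   to a seed where a variable can be frozen.  Freezing is harmless as long as
   the cluster algebra equals its upper cluster algebra, which follows from the
   Laurent phenomenon by the same induction.  Mutating Q_(k,l) at up to three
   vertices produces such leaves, and removing them leads to three families of
   ladder quivers that are stable under this procedure.

   Orientations of a tree are related by mutations at sinks and sources, so the
   Dynkin quivers reduce to A_n = Q_(0,n), D_n ~ Q_(2,n-4) and E_(6+l) ~ Q_(3,l).
   Scott's quivers for Gr(2,N) and Gr(3,N) are Q_(0,N-3) and Q_(N-4,0); the
   rectangular minors are algebraically independent because each of them is
   affine in its upper right entry, with a nonzero coefficient, and involves
   only smaller entries otherwise. *)

(** * Specialization of rational functions *)

(** The two properties carried through the induction need each other. Freezing keeps the seed and
    the field and only shrinks the set of mutable vertices, and a point is a function on the whole
    field that is constrained on the algebra alone, so nothing has to be transported between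
    different objects. The obstacle in the Laurent phenomenon is that the exchange polynomials at
    two successive vertices may have common factors. Extra frozen vertices attached to both make
    them coprime, and setting their variables to 1 afterwards returns to the given seed.
    Divisibility in Laurent rings is tested by a specialization with known kernel, which takes the
    place of unique factorization. *)

(* [sg] is the substitution x_i := w_i, defined on the local ring [D] of the
   rational functions whose denominator does not vanish at w. *)
Record specialization (C K K' : fieldType) (iota : {rmorphism C -> K})
    (iota' : {rmorphism C -> K'}) (N : nat) (x : 'I_N -> K) (w : 'I_N -> K')
    (D : K -> Prop) (sg : K -> K') : Prop := Specialization {
  spec_const c : D (iota c) /\ sg (iota c) = iota' c;
  spec_var i : D (x i) /\ sg (x i) = w i;
  spec_add a b : D a -> D b -> D (a + b) /\ sg (a + b) = sg a + sg b;
  spec_mul a b : D a -> D b -> D (a * b) /\ sg (a * b) = sg a * sg b;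
  spec_inv a : D a -> sg a != 0 -> D a^-1 /\ sg a^-1 = (sg a)^-1;
  spec_frac a : D a -> exists p q, [/\ a = mmap iota x p / mmap iota x q,
    sg a = mmap iota' w p / mmap iota' w q & mmap iota' w q != 0] }.

(** A value is read off from any fraction whose denominator survives at [w]. Two such fractions for
    one element cross-multiply to a relation between the [x i], hence to an identity of polynomials,
    which persists at [w]. Elsewhere [sg] has the dummy value 0. *)
Lemma specialization_exists (C K K' : fieldType) (iota : {rmorphism C -> K})
    (iota' : {rmorphism C -> K'}) (N : nat) (x : 'I_N -> K) (w : 'I_N -> K') :
  freely_generates iota x -> exists D sg, specialization iota iota' x w D sg.
Proof.
move=> [indep _].
pose rep (y : K) (pq : {mpoly C[N]} * {mpoly C[N]}) :=
  y = mmap iota x pq.1 / mmap iota x pq.2 /\ mmap iota' w pq.2 != 0.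
have nz q : mmap iota' w q != 0 -> mmap iota x q != 0.
  by apply: contra_neq => /indep ->; rewrite mmap0.
pose sg y := match pselect (exists pq, rep y pq) with
  | left h => mmap iota' w (projT1 (cid h)).1 / mmap iota' w (projT1 (cid h)).2
  | right _ => 0 end.
have sgE y p q : rep y (p, q) -> sg y = mmap iota' w p / mmap iota' w q.
  move=> [/= ypq q0]; rewrite /sg; case: pselect => [h|[]]; last by exists (p, q).
  case: (cid h) => -[p1 q1] /= [/= ypq1 q10]; apply/eqP; rewrite eqr_div //.
  have := ypq1; rewrite ypq => /eqP; rewrite eqr_div ?nz // -!rmorphM -subr_eq0.
  rewrite -rmorphB => /eqP/indep/eqP; rewrite subr_eq0 => /eqP e.
  by apply/eqP; move: (congr1 (mmap iota' w) e); rewrite !rmorphM => ->.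
exists (fun y => exists pq, rep y pq), sg.
have mk y p q : rep y (p, q) ->
    (exists pq, rep y pq) /\ sg y = mmap iota' w p / mmap iota' w q.
  by move=> r; split; [exists (p, q)|exact: sgE].
split.
- move=> c; have [//|h ->] := @mk (iota c) c%:MP 1; last by rewrite mmapC rmorph1 divr1.
  by split; rewrite /= rmorph1 ?divr1 ?mmapC ?oner_neq0.
- move=> i; have [//|h ->] := @mk (x i) 'X_i 1; last by rewrite mmapX mmap1U rmorph1 divr1.
  by split; rewrite /= rmorph1 ?divr1 ?mmapX ?mmap1U ?oner_neq0.
- move=> a b [[p q] ha] [[p' q'] hb]; rewrite (sgE _ _ _ ha) (sgE _ _ _ hb).
  case: ha hb => /= -> q0 [/= -> q'0].
  have [|h ->] := @mk (mmap iota x p / mmap iota x q + mmap iota x p' / mmap iota x q')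
     (p * q' + p' * q) (q * q'); last by split=> //; rewrite addf_div // !rmorphD !rmorphM.
  by split; rewrite /= ?addf_div ?nz // ?rmorphD ?rmorphM ?mulf_neq0.
- move=> a b [[p q] ha] [[p' q'] hb]; rewrite (sgE _ _ _ ha) (sgE _ _ _ hb).
  case: ha hb => /= -> q0 [/= -> q'0].
  have [|h ->] := @mk (mmap iota x p / mmap iota x q * (mmap iota x p' / mmap iota x q'))
     (p * p') (q * q'); last by split=> //; rewrite mulf_div !rmorphM.
  by split; rewrite /= ?mulf_div // !rmorphM ?mulf_neq0.
- move=> a [[p q] ha]; rewrite (sgE _ _ _ ha) => n0.
  case: ha => /= -> q0.
  have p0 : mmap iota' w p != 0.
    by move: n0; apply: contra_neq => ->; rewrite mul0r.
  have [|h ->] := @mk (mmap iota x p / mmap iota x q)^-1 q p; first by split; rewrite /= ?invf_div.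
  by split=> //; rewrite invf_div.
- by move=> a [[p q] h]; exists p, q; rewrite (sgE _ _ _ h); case: h => /= ->.
Qed.

Section SpecializationTheory.
Variables (C K K' : fieldType) (iota : {rmorphism C -> K}).
Variables (iota' : {rmorphism C -> K'}) (N : nat) (x : 'I_N -> K) (w : 'I_N -> K').
Variables (D : K -> Prop) (sg : K -> K').
Hypothesis S : specialization iota iota' x w D sg.

Lemma spec_mmap p : D (mmap iota x p) /\ sg (mmap iota x p) = mmap iota' w p.
Proof.
elim/mpolyind: p => [|c m p _ _ [D1 s1]].
  by rewrite !rmorph0 -(rmorph0 iota) -(rmorph0 iota'); exact: (spec_const S).
have [Dc sc] := spec_const S c.
have [Dm sm] : D (mmap iota x 'X_[m]) /\ sg (mmap iota x 'X_[m]) = mmap iota' w 'X_[m].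
  rewrite !mmapX /mmap1; elim/big_rec2: _ => [|i y1 y2 _ [Dy <-]].
    by rewrite -(rmorph1 iota) -(rmorph1 iota'); exact: (spec_const S).
  have [Di <-] := spec_var S i.
  have [De <-] : D (x i ^+ m i) /\ sg (x i ^+ m i) = sg (x i) ^+ m i.
    elim: (m i) => [|n [Dn sn]].
      by rewrite !expr0 -(rmorph1 iota) -(rmorph1 iota'); exact: (spec_const S).
    by rewrite !exprS -sn; exact: (spec_mul S).
  exact: (spec_mul S).
have [Dcm scm] := spec_mul S Dc Dm.
rewrite !mmapD !mmapZ -s1 -sm -sc -scm.
exact: (spec_add S).
Qed.

Lemma spec0 : D 0 /\ sg 0 = 0.
Proof. by rewrite -(rmorph0 iota) -(rmorph0 iota'); exact: (spec_const S). Qed.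
Lemma spec1 : D 1 /\ sg 1 = 1.
Proof. by rewrite -(rmorph1 iota) -(rmorph1 iota'); exact: (spec_const S). Qed.
Lemma specN1 : D (-1) /\ sg (-1) = -1.
Proof.
rewrite -(rmorphN1 iota) -(rmorphN1 iota'); exact: (spec_const S).
Qed.

Lemma spec_exp a n : D a -> D (a ^+ n) /\ sg (a ^+ n) = sg a ^+ n.
Proof.
move=> Da; elim: n => [|n [Dn sn]]; first by rewrite !expr0; exact: spec1.
by rewrite !exprS -sn; exact: (spec_mul S).
Qed.

Lemma spec_expz a (n : int) : D a -> (0 <= n) || (sg a != 0) ->
  D (a ^ n) /\ sg (a ^ n) = sg a ^ n.
Proof.
move=> Da; case: n => n h; first exact: spec_exp.
have [D1 s1] := spec_exp n.+1 Da.
by rewrite !NegzE -!exprnN -s1; apply: (spec_inv S) => //; rewrite s1 expf_neq0.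
Qed.

Lemma spec_prod (I : finType) (F : I -> K) (G : I -> K') :
  (forall i, D (F i) /\ sg (F i) = G i) ->
  D (\prod_i F i) /\ sg (\prod_i F i) = \prod_i G i.
Proof.
move=> h; elim/big_rec2: _ => [|i y1 y2 _ [Dy <-]]; first exact: spec1.
by have [Di <-] := h i; exact: (spec_mul S).
Qed.

End SpecializationTheory.

(** * Generated subfields and change of generators *)

Section GeneratedSubfield.
Variables (C K : fieldType) (iota : {rmorphism C -> K}) (N : nat).
Implicit Types (x w v : 'I_N -> K) (P : pred 'I_N).

Inductive subfield_gen P x : K -> Prop :=
| sfg_const c : subfield_gen P x (iota c)
| sfg_var i : P i -> subfield_gen P x (x i)
| sfg_add a b : subfield_gen P x a -> subfield_gen P x b -> subfield_gen P x (a + b)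
| sfg_mul a b : subfield_gen P x a -> subfield_gen P x b -> subfield_gen P x (a * b)
| sfg_inv a : subfield_gen P x a -> subfield_gen P x a^-1.

Lemma sfg_0 P x : subfield_gen P x 0.
Proof. by rewrite -(rmorph0 iota); exact: sfg_const. Qed.

Lemma sfg_1 P x : subfield_gen P x 1.
Proof. by rewrite -(rmorph1 iota); exact: sfg_const. Qed.

Lemma sfg_exp P x a n : subfield_gen P x a -> subfield_gen P x (a ^+ n).
Proof.
by move=> ha; elim: n => [|n IH]; [exact: sfg_1|rewrite exprS; exact: sfg_mul].
Qed.

Lemma sfg_expz P x a (n : int) : subfield_gen P x a -> subfield_gen P x (a ^ n).
Proof.
move=> ha; case: n => n; first exact: sfg_exp.
by rewrite NegzE -exprnN; apply: sfg_inv; exact: sfg_exp.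
Qed.

Lemma sfg_prod P x (I : Type) (r : seq I) (Q : pred I) F :
  (forall i, Q i -> subfield_gen P x (F i)) -> subfield_gen P x (\prod_(i <- r | Q i) F i).
Proof.
move=> h; apply: (big_ind (subfield_gen P x)) => //; first exact: sfg_1.
exact: sfg_mul.
Qed.

Lemma sfg_mmap P x w p : (forall i, subfield_gen P w (x i)) ->
  subfield_gen P w (mmap iota x p).
Proof.
move=> h; elim/mpolyind: p => [|c m p _ _ hp]; first by rewrite rmorph0; exact: sfg_0.
rewrite mmapD mmapZ; apply: sfg_add => //; apply: sfg_mul; first exact: sfg_const.
by rewrite mmapX; apply: sfg_prod => i _; exact: sfg_exp.
Qed.

Lemma sfg_frac P x y : subfield_gen P x y ->
  exists p q, mmap iota x q != 0 /\ y = mmap iota x p / mmap iota x q.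
Proof.
elim=> {y} [c|i _|a b _ [p [q [q0 ->]]] _ [p' [q' [q'0 ->]]]
           |a b _ [p [q [q0 ->]]] _ [p' [q' [q'0 ->]]]|a _ [p [q [q0 ->]]]].
- by exists c%:MP, 1; rewrite rmorph1 mmapC divr1 oner_neq0.
- by exists 'X_i, 1; rewrite rmorph1 mmapX mmap1U divr1 oner_neq0.
- exists (p * q' + p' * q), (q * q').
  by rewrite addf_div // !rmorphD !rmorphM mulf_neq0.
- by exists (p * p'), (q * q'); rewrite mulf_div !rmorphM mulf_neq0.
- have [p0|p0] := eqVneq (mmap iota x p) 0; last by exists q, p; rewrite invf_div.
  by exists 0, 1; rewrite p0 mul0r invr0 rmorph0 rmorph1 mul0r oner_neq0.
Qed.

(* Substitutions are inverted by substitutions: if [x_i := v_i] sends the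
   [w_i] to the [x_i], a polynomial relation between the [w_i] would be one
   between the [x_i]. *)
Lemma freely_generates_subst x w v D sg :
  freely_generates iota x ->
  specialization iota iota x v D sg ->
  (forall i, D (w i) /\ sg (w i) = x i) ->
  (forall i, subfield_gen predT w (x i)) ->
  freely_generates iota w.
Proof.
move=> fx S hw gen.
have sp p : D (mmap iota w p) /\ sg (mmap iota w p) = mmap iota x p.
  elim/mpolyind: p => [|c m p _ _ [Dp sp]].
    by rewrite !rmorph0; exact: (spec0 S).
  have [Dm sm] : D (mmap iota w 'X_[m]) /\ sg (mmap iota w 'X_[m]) = mmap iota x 'X_[m].
    rewrite !mmapX /mmap1; apply: (spec_prod S) => i.
    by have [Di <-] := hw i; exact: (spec_exp S).
  have [Dc sc] := spec_const S c.
  have [Dcm scm] := spec_mul S Dc Dm.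
  by rewrite !mmapD !mmapZ -sp -sm -{3}sc -scm; exact: (spec_add S).
split=> [p p0|y].
  apply: (proj1 fx); have [_ <-] := sp p.
  by rewrite p0; have [] := spec0 S.
have [p [q [q0 ->]]] := proj2 fx y; apply: (@sfg_frac predT).
by apply: sfg_mul; [|apply: sfg_inv]; exact: sfg_mmap.
Qed.

End GeneratedSubfield.
(** * Quiver and seed mutation *)

(** Functions instead of matrices: one function on infinitely many labels serves all its finite full
    subquivers, and closed instances can be evaluated. *)
Definition bmut (W : eqType) (k : W) (b : W -> W -> int) : W -> W -> int :=
  fun i j => if (i == k) || (j == k) then - b i j
             else b i j + zpos (b i k) * zpos (b k j) - zpos (- b i k) * zpos (- b k j).

Definition bmuts (W : eqType) (b : W -> W -> int) (ks : seq W) : W -> W -> int :=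
  foldl (fun b' k => bmut k b') b ks.

Definition skew (W : Type) (b : W -> W -> int) := forall i j, b i j = - b j i.

Lemma zpos_ge0 a : 0 <= zpos a.
Proof. by rewrite /zpos le_max lexx orbT. Qed.

Lemma zpos_id a : 0 <= a -> zpos a = a.
Proof. by move=> h; rewrite /zpos max_l. Qed.

Lemma zpos_0 a : a <= 0 -> zpos a = 0.
Proof. by move=> h; rewrite /zpos max_r. Qed.

Lemma zposB a : zpos a - zpos (- a) = a.
Proof.
by case: (lerP 0 a) => h; rewrite /zpos; [rewrite max_l // max_r|rewrite max_r 1?max_l]; lia.
Qed.

Lemma skew_diag (W : Type) (b : W -> W -> int) i : skew b -> b i i = 0.
Proof. by move/(_ i i); lia. Qed.

Lemma bmut_skew (W : eqType) k (b : W -> W -> int) : skew b -> skew (bmut k b).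
Proof.
move=> sk i j; rewrite /bmut orbC; case: ifP => _; rewrite (sk i j) //.
by rewrite (sk k j) (sk i k) !opprK [zpos (b k i) * _]mulrC [zpos (- b k i) * _]mulrC; ring.
Qed.

Lemma bmutK (W : eqType) k (b : W -> W -> int) : bmut k (bmut k b) = b.
Proof.
apply/funext => i; apply/funext => j; rewrite /bmut eqxx orbT.
by case: (i == k); case: (j == k) => /=; rewrite ?opprK //; ring.
Qed.

Definition bopp (W : Type) (b : W -> W -> int) : W -> W -> int := fun i j => - b i j.

Lemma bmut_opp (W : eqType) k (b : W -> W -> int) : bmut k (bopp b) = bopp (bmut k b).
Proof.
apply/funext => i; apply/funext => j; rewrite /bopp /bmut.
by case: ifP => // _; rewrite !opprK; ring.
Qed.

(** * Laurent monomials and seeds with square matrices *)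

Definition mon (K : fieldType) (N : nat) (x : 'I_N -> K) (e : 'I_N -> int) : K :=
  \prod_i x i ^ e i.

Record sd (K : fieldType) (N : nat) := Sd { vx : 'I_N -> K; vB : 'I_N -> 'I_N -> int }.

Definition ppos (K : fieldType) N (s : sd K N) k := mon (vx s) (fun i => zpos (vB s i k)).
Definition pneg (K : fieldType) N (s : sd K N) k := mon (vx s) (fun i => zpos (- vB s i k)).

Definition mu (K : fieldType) N (k : 'I_N) (s : sd K N) : sd K N :=
  Sd (fun i => if i == k then (vx s k)^-1 * (ppos s k + pneg s k) else vx s i)
     (bmut k (vB s)).

Definition mus (K : fieldType) N (s : sd K N) (ks : seq 'I_N) : sd K N :=
  foldl (fun s' k => mu k s') s ks.

Lemma eq_sd (K : fieldType) N (s t : sd K N) : vx s =1 vx t -> vB s =2 vB t -> s = t.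
Proof.
case: s t => x B [y D] /= /funext -> h; congr Sd.
by apply/funext => i; apply/funext => j; exact: h.
Qed.

Section Monomials.
Variables (K : fieldType) (N : nat) (x : 'I_N -> K).

Lemma mon_neq0 e : (forall i, e i != 0 -> x i != 0) -> mon x e != 0.
Proof.
move=> h; apply/prodf_neq0 => i _; have [->|/h] := eqVneq (e i) 0; last exact: expfz_neq0.
by rewrite expr0z oner_neq0.
Qed.

Lemma monD e f : (forall i, x i != 0) -> mon x (fun i => e i + f i) = mon x e * mon x f.
Proof. by move=> h; rewrite -big_split; apply: eq_bigr => i _; rewrite expfzDr. Qed.

Lemma monN e : mon x (fun i => - e i) = (mon x e)^-1.
Proof.
rewrite /mon -prodfV; apply: eq_bigr => i _.
by rewrite invr_expz.
Qed.

Lemma monM e (n : int) : mon x (fun i => e i * n) = mon x e ^ n.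
Proof.
rewrite /mon; elim/big_rec2: _ => [|i y z _ ->]; first by rewrite exp1rz.
by rewrite expfzMl exprz_exp.
Qed.

Lemma mon_delta k : mon x (fun i => (i == k)%:R) = x k.
Proof.
rewrite /mon (bigD1 k) //= eqxx expr1z big1 ?mulr1 // => i /negbTE ->.
by rewrite expr0z.
Qed.

Lemma eq_mon e f : e =1 f -> mon x e = mon x f.
Proof. by move=> h; apply: eq_bigr => i _; rewrite h. Qed.

Lemma eq_monx (y : 'I_N -> K) e : (forall i, e i != 0 -> x i = y i) -> mon x e = mon y e.
Proof.
move=> h; apply: eq_bigr => i _; have [->|/h -> //] := eqVneq (e i) 0.
by rewrite !expr0z.
Qed.

Lemma mon_split k e : mon x e = x k ^ e k * mon x (fun i => if i == k then 0 else e i).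
Proof.
rewrite /mon (bigD1 k) //= [in RHS](bigD1 k) //= eqxx expr0z mul1r; congr (_ * _).
by apply: eq_bigr => i /negbTE ->.
Qed.

End Monomials.

Lemma mus_rcons (K : fieldType) N (s : sd K N) ks k : mus s (rcons ks k) = mu k (mus s ks).
Proof. by rewrite /mus -cats1 foldl_cat. Qed.

Lemma mu_vxN (K : fieldType) N (s : sd K N) k i : i != k -> vx (mu k s) i = vx s i.
Proof. by move=> /= /negbTE ->. Qed.

Lemma mu_vx (K : fieldType) N (s : sd K N) k :
  vx (mu k s) k = (vx s k)^-1 * (ppos s k + pneg s k).
Proof. by rewrite /= eqxx. Qed.

Lemma mu_exch (K : fieldType) N (s : sd K N) k : vx s k != 0 ->
  vx s k * vx (mu k s) k = ppos s k + pneg s k.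
Proof. by move=> h; rewrite /= eqxx mulVKf. Qed.

Section Seeds.
Variables (C : numFieldType) (K : fieldType) (iota : {rmorphism C -> K}) (N : nat).
Implicit Types s : sd K N.

Definition gseed s := freely_generates iota (vx s) /\ skew (vB s).

Lemma iota_natf_neq0 n : n != 0%N -> n%:R != 0 :> K.
Proof. by move=> h; rewrite -(rmorph_nat iota) fmorph_eq0 pnatr_eq0. Qed.

(** Specializing all variables to 1 would turn a vanishing [x i] into 1 = 0. *)
Lemma fg_neq0 (x : 'I_N -> K) i : freely_generates iota x -> x i != 0.
Proof.
move=> fx; have [D [sg S]] := @specialization_exists _ _ _ iota iota _ x (fun=> 1) fx.
apply: contra_neq (oner_neq0 K) => x0.
by have [_ <-] := spec_var S i; rewrite x0; have [] := spec0 S.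
Qed.

Lemma gseed_neq0 s i : gseed s -> vx s i != 0.
Proof. by case=> /fg_neq0. Qed.

Lemma spec_mon (K' : fieldType) (iota' : {rmorphism C -> K'}) (x : 'I_N -> K) w D sg
    (e : 'I_N -> int) :
  specialization iota iota' x w D sg -> (forall i, (0 <= e i) || (w i != 0)) ->
  D (mon x e) /\ sg (mon x e) = mon w e.
Proof.
move=> S h; apply: (spec_prod S) => i; have [Di si] := spec_var S i.
by rewrite -si; apply: (spec_expz S) => //; rewrite si.
Qed.

(** Where all variables are 1 the exchange binomial has the value 2, nonzero in characteristic 0. *)
Lemma exch_neq0 s k : gseed s -> ppos s k + pneg s k != 0.
Proof.
move=> [fx sk]; have [D [sg S]] := @specialization_exists _ _ _ iota iota _ _ (fun=> 1) fx.
have h e : D (mon (vx s) e) /\ sg (mon (vx s) e) = 1.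
  have [? ->] := @spec_mon _ _ _ _ _ _ e S (fun=> ltac:(by rewrite oner_neq0 orbT)).
  by split=> //; rewrite /mon big1 // => i _; rewrite exp1rz.
have [D1 s1] := h (fun i => zpos (vB s i k)).
have [D2 s2] := h (fun i => zpos (- vB s i k)).
have [D12 s12] := spec_add S D1 D2.
apply: contra_neq (@iota_natf_neq0 2 isT) => e.
move: s12; rewrite s1 s2; move: e; rewrite /ppos /pneg => -> h12.
by rewrite mulr2n -h12; have [] := spec0 S.
Qed.

Lemma mu_neq0 s k i : gseed s -> vx (mu k s) i != 0.
Proof.
move=> gs /=; case: ifP => _; last exact: gseed_neq0.
by rewrite mulf_neq0 ?invr_neq0 ?exch_neq0 // gseed_neq0.
Qed.

Lemma exch_mu s k : gseed s -> ppos (mu k s) k = pneg s k /\ pneg (mu k s) k = ppos s k.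
Proof.
move=> [_ sk]; have h0 : vB s k k = 0 by exact: skew_diag.
split; apply: etrans (eq_monx _) (eq_mon _ _) => /= i.
- by rewrite /bmut eqxx orbT; have [->|//] := eqVneq i k; rewrite h0 /zpos oppr0 maxxx eqxx.
- by rewrite /bmut eqxx orbT.
- by rewrite /bmut eqxx orbT; have [->|//] := eqVneq i k; rewrite h0 /zpos !oppr0 maxxx eqxx.
- by rewrite /bmut eqxx orbT opprK.
Qed.

Lemma muK s k : gseed s -> mu k (mu k s) = s.
Proof.
move=> gs; have [e1 e2] := exch_mu k gs.
apply: eq_sd => [i|i j]; last by rewrite /= bmutK.
rewrite /= e1 e2; have [->|//] := eqVneq i k; rewrite eqxx invfM invrK.
by rewrite [pneg s k + _]addrC mulrVK // unitfE exch_neq0.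
Qed.

(** The exchange binomial does not contain x_k, so substituting x_k' for x_k sends x_k' back to x_k:
    the change of variables is an involution. *)
Lemma mu_gseed s k : gseed s -> gseed (mu k s).
Proof.
move=> gs; case: (gs) => fx sk; split; last exact: bmut_skew.
have P0 := exch_neq0 k gs; have h0 : vB s k k = 0 by exact: skew_diag.
pose v i := if i == k then (vx s k)^-1 * (ppos s k + pneg s k) else vx s i.
have v0 i : v i != 0 by exact: (mu_neq0 k i gs).
have [D [sg S]] := @specialization_exists _ _ _ iota iota _ (vx s) v fx.
have fixm e : e k = 0 -> D (mon (vx s) e) /\ sg (mon (vx s) e) = mon (vx s) e.
  move=> ek; have [D1 ->] := @spec_mon _ _ _ _ _ _ e S (fun i => ltac:(by rewrite v0 orbT)).
  split=> //; apply: eq_monx => i; rewrite /v; have [->|//] := eqVneq i k.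
  by rewrite ek eqxx.
have [Dp sp] : D (ppos s k) /\ sg (ppos s k) = ppos s k.
  by apply: fixm; rewrite h0 zpos_0.
have [Dn sn] : D (pneg s k) /\ sg (pneg s k) = pneg s k.
  by apply: fixm; rewrite h0 oppr0 zpos_0.
have [DP sP] := spec_add S Dp Dn; rewrite sp sn in sP.
apply: (freely_generates_subst fx S) => i.
  rewrite /=; have [->|ik] := eqVneq i k; last first.
    by have := spec_var S i; rewrite /v (negbTE ik).
  have [Dk sk'] := spec_var S k.
  have [DV sV] := spec_inv S Dk ltac:(by rewrite sk').
  have [Da sa] := spec_mul S DV DP; split=> //.
  by rewrite sa sV sP sk' /v eqxx invfM invrK mulrVK // unitfE.
have [->|ik] := eqVneq i k; last by rewrite -(@mu_vxN _ _ s k) //; exact: sfg_var.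
have fg e : e k = 0 -> subfield_gen iota predT (vx (mu k s)) (mon (vx s) e).
  move=> ek; apply: sfg_prod => j _; have [->|jk] := eqVneq j k.
    by rewrite ek expr0z; exact: sfg_1.
  by rewrite -(@mu_vxN _ _ s k) //; apply: sfg_expz; exact: sfg_var.
have -> : vx s k = (ppos s k + pneg s k) * (vx (mu k s) k)^-1.
  by rewrite mu_vx invfM invrK mulrCA divff ?mulr1.
apply: sfg_mul; last by apply: sfg_inv; exact: sfg_var.
by apply: sfg_add; apply: fg; rewrite h0 ?oppr0 zpos_0.
Qed.

Lemma mus_gseed s ks : gseed s -> gseed (mus s ks).
Proof. by elim: ks s => [|k ks IH] s //= gs; apply: IH; exact: mu_gseed. Qed.

End Seeds.
(** * Two consecutive mutations *)

Section TwoStep.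
Variables (C : numFieldType) (K : fieldType) (iota : {rmorphism C -> K}) (N : nat).
Variables (s : sd K N) (j k : 'I_N) (c : nat).
Hypotheses (gs : gseed iota s) (njk : j != k) (Bjk : vB s j k = c%:Z).

Let x := vx s.
Let s1 := mu j s.
Let s2 := mu k s1.
Let a' := vx s1 j.
Let b' := vx s2 k.
Let G := mon x (fun i => if i == j then 0 else zpos (vB s1 i k)).
Let m := mon x (fun i => if i == j then 0 else - vB s1 i k).
Let H := mon x (fun i => if (i == j) || (i == k) then 0 else zpos (vB s2 i j)).
Let yj := mon x (fun i => vB s i j).
Let yk := mon x (fun i => vB s i k).

Local Lemma sk : skew (vB s). Proof. by case: gs. Qed.
Local Lemma x0 i : x i != 0. Proof. exact: (gseed_neq0 i gs). Qed.
Local Lemma Bkj : vB s k j = - c%:Z. Proof. by rewrite sk Bjk. Qed.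

Lemma exch_factor (t : sd K N) l : gseed iota t ->
  ppos t l + pneg t l = pneg t l * (1 + mon (vx t) (fun i => vB t i l)).
Proof.
move=> gt; have t0 i : vx t i != 0 by exact: (gseed_neq0 i gt).
rewrite mulrDr mulr1 addrC; congr (_ + _); rewrite -monD //; apply: eq_mon => i.
by rewrite -{3}(zposB (vB t i l)); ring.
Qed.

Lemma onestep : a' = (x j)^-1 * pneg s j * (1 + yj).
Proof. by rewrite /a' /= eqxx (exch_factor _ gs) mulrA. Qed.

Local Lemma B1jk : vB s1 j k = - c%:Z.
Proof. by rewrite /s1 /= /bmut eqxx Bjk. Qed.

Local Lemma B1kj : vB s1 k j = c%:Z.
Proof. by rewrite /s1 /= /bmut eqxx orbT Bkj opprK. Qed.

Lemma mut_column i : i != j -> vB s1 i k = vB s i k + zpos (vB s i j) * c%:Z.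
Proof.
move=> ij; rewrite /s1 /= /bmut (negbTE ij) eq_sym (negbTE njk) /= Bjk.
by rewrite (zpos_id (isT : 0 <= c%:Z)) (@zpos_0 (- c%:Z)) ?oppr_le0 // mulr0 subr0.
Qed.

Local Lemma B2ij i : i != j -> i != k ->
  vB s2 i j = - vB s i j + zpos (vB s1 i k) * c%:Z.
Proof.
move=> ij ik; rewrite /s2 /= {1}/bmut (negbTE ik) (negbTE njk) /= -/s1.
rewrite -[bmut j (vB s)]/(vB s1) B1kj (@zpos_id c) // (@zpos_0 (- c%:Z)) ?oppr_le0 //.
by rewrite mulr0 subr0 {1}/s1 /= {1}/bmut eqxx orbT.
Qed.

(** After mutation at j the entry at j of column k is -c, so only the negative exchange monomial can
    contain [a'], to the power c. [G] is the positive monomial, and [m] the ratio of what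
    remains. *)
Lemma twostep_b : b' = (x k)^-1 * G * (1 + a' ^+ c * m).
Proof.
have g1 : gseed iota s1 by exact: mu_gseed.
have xk : vx s1 k = x k by rewrite /s1 mu_vxN // eq_sym.
rewrite /b' /= eqxx -[if k == j then _ else _]/(vx s1 k) xk -mulrA; congr (_ * _).
rewrite mulrDr mulr1; congr (_ + _).
  rewrite /ppos /G; apply: etrans (eq_monx _) (eq_mon _ _) => i.
    by rewrite /s1 /=; have [->|//] := eqVneq i j; rewrite -[bmut _ _]/(vB s1) B1jk zpos_0 ?eqxx ?oppr_le0.
  by have [->|//] := eqVneq i j; rewrite B1jk zpos_0 ?oppr_le0.
rewrite /pneg (mon_split _ j) B1jk opprK zpos_id // -exprnP mulrCA; congr (_ * _).
rewrite -monD; last exact: x0.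
apply: etrans (eq_monx _) (eq_mon _ _) => i /=.
  by have [->|//] := eqVneq i j; rewrite eqxx.
have [_|ij] := eqVneq i j; first by rewrite addr0.
by have := zposB (bmut j (vB s) i k); lia.
Qed.

(** For c = 0 the last quotient is 0; for c > 0 its numerator is divisible by [a'] to the power c.
    In this form the third variable is visibly a Laurent polynomial. *)
Lemma twostep_a : vx (mu j s2) j =
  H * x j / pneg s j + H * yj * (((1 + a' ^+ c * m) ^+ c - 1) / a').
Proof.
have g1 : gseed iota s1 by exact: mu_gseed.
have g2 : gseed iota s2 by exact: mu_gseed.
have a'0 : a' != 0 by exact: (gseed_neq0 j g1).
have xj : vx s2 j = a' by rewrite /s2 mu_vxN.
have B2kj : vB s2 k j = - c%:Z by rewrite /s2 /= {1}/bmut eqxx -[bmut j (vB s)]/(vB s1) B1kj.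
have B2jj : vB s2 j j = 0 by apply: skew_diag; case: g2.
have xi i : i != j -> i != k -> vx s2 i = x i.
  by move=> ij ik; rewrite /s2 mu_vxN // /s1 mu_vxN.
have Pp : ppos s2 j = H.
  rewrite /ppos /H; apply: etrans (eq_monx _) (eq_mon _ _) => i.
    have [->|ij] := eqVneq i j; first by rewrite B2jj /zpos maxxx eqxx.
    have [->|ik] := eqVneq i k; first by rewrite B2kj zpos_0 ?oppr_le0 // eqxx.
    by rewrite xi.
  have [->|ij] := eqVneq i j; first by rewrite B2jj /zpos maxxx.
  by have [->|ik] := eqVneq i k; first by rewrite B2kj zpos_0 ?oppr_le0.
have Pn : pneg s2 j = H * yj * (1 + a' ^+ c * m) ^+ c.
  have G0 : G != 0 by apply: mon_neq0 => i _; exact: x0.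
  have -> : 1 + a' ^+ c * m = b' * x k / G.
    by rewrite twostep_b; field; rewrite x0 G0.
  rewrite /pneg (mon_split _ k) B2kj opprK zpos_id // -exprnP -[vx s2 k]/b'.
  pose R := mon x (fun i => if (i == j) || (i == k) then 0 else vB s i j).
  have -> : yj = R / x k ^+ c.
    rewrite /yj (mon_split _ k) Bkj -exprnN mulrC; congr (_ / _).
    apply: eq_mon => i; have [_|ik] := eqVneq i k; first by rewrite orbT.
    by rewrite orbF; have [->|//] := eqVneq i j; rewrite skew_diag //; exact: sk.
  have -> : mon (vx s2) (fun i => if i == k then 0 else zpos (- vB s2 i j)) = H * R / G ^+ c.
    rewrite exprnP -monM -monN /H -!monD; try exact: x0.
    apply: etrans (eq_monx _) (eq_mon _ _) => i.
      have [_|ik] := eqVneq i k; first by rewrite eqxx.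
      have [->|ij] := eqVneq i j; last by rewrite xi.
      by rewrite B2jj /zpos oppr0 maxxx eqxx.
    have [->|ij] := eqVneq i j.
      by rewrite (negbTE njk) B2jj /zpos oppr0 maxxx.
    have [->|ik] := eqVneq i k.
      have -> : vB s1 k k = 0 by apply: skew_diag; case: g1.
      by rewrite /zpos maxxx mul0r oppr0 orbT !addr0.
    have -> : zpos (- vB s2 i j) = zpos (vB s2 i j) - vB s2 i j.
      by rewrite -{3}(zposB (vB s2 i j)); ring.
    by rewrite {2}(B2ij ij ik) [false || false]/=; ring.
  by rewrite !exprMn exprVn; field; rewrite !expf_neq0 ?x0.
rewrite mu_vx xj Pp Pn.
have F0 : pneg s j != 0 by apply: mon_neq0 => i _; exact: x0.
have e : x j * a' = pneg s j * (1 + yj) by rewrite onestep; field; exact: x0.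
have -> : H * x j / pneg s j = H * (1 + yj) / a'.
  by apply/eqP; rewrite eqr_div // -mulrA e; apply/eqP; ring.
by field.
Qed.

(** For a single arrow this makes the second summand of [twostep_a] equal to the first one divided
    by y_k, so the third variable is a monomial times 1 + 1/y_k. *)
Lemma twostep_y : c = 1%N -> yj * m * pneg s j = x j / yk.
Proof.
move=> c1; rewrite /yk -monN -(mon_delta x j) /yj /m /pneg -!monD; try exact: x0.
apply: eq_mon => i; cbv beta; have [->|ij] := eqVneq i j.
  by rewrite Bjk c1 skew_diag ?oppr0 /zpos ?maxxx //; exact: sk.
have [->|ik] := eqVneq i k.
  have -> : vB s1 k k = 0 by apply: skew_diag; case: (mu_gseed j gs).
  by rewrite Bkj opprK c1 skew_diag //; exact: sk.
by rewrite mut_column // c1; have := zposB (vB s i j); lia.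
Qed.

End TwoStep.
(** * Algebras generated by cluster variables *)

(* The cluster algebra with mutable vertices [M] in which the variables at the
   vertices of [E] are left out. *)
Inductive inA (C K : fieldType) (iota : {rmorphism C -> K}) (N : nat)
    (M E : {set 'I_N}) (s : sd K N) : K -> Prop :=
| inA_const c : inA iota M E s (iota c)
| inA_var ks i : all (fun k => k \in M) ks -> i \notin E ->
    inA iota M E s (vx (mus s ks) i)
| inA_inv i : i \notin M -> i \notin E -> inA iota M E s (vx s i)^-1
| inA_add a b : inA iota M E s a -> inA iota M E s b -> inA iota M E s (a + b)
| inA_mul a b : inA iota M E s a -> inA iota M E s b -> inA iota M E s (a * b).

Lemma all_set0 (T : finType) (r : seq T) : all (fun k => k \in finset.set0) r -> r = [::].
Proof. by case: r => //= k r; rewrite inE. Qed.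

Section InA.
Variables (C : numFieldType) (K : fieldType) (iota : {rmorphism C -> K}) (N : nat).
Implicit Types (s : sd K N) (M E : {set 'I_N}).

Lemma inA_0 M E s : inA iota M E s 0.
Proof. by rewrite -(rmorph0 iota); constructor. Qed.
Lemma inA_1 M E s : inA iota M E s 1.
Proof. by rewrite -(rmorph1 iota); constructor. Qed.

Lemma inA_opp M E s a : inA iota M E s a -> inA iota M E s (- a).
Proof.
by move=> h; rewrite -mulN1r -(rmorphN1 iota); apply: inA_mul => //; constructor.
Qed.

Lemma inA_exp M E s a n : inA iota M E s a -> inA iota M E s (a ^+ n).
Proof.
by move=> h; elim: n => [|n IH]; [rewrite expr0; exact: inA_1|rewrite exprS; exact: inA_mul].
Qed.

Lemma inA_sum M E s (I : Type) (r : seq I) (P : pred I) F :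
  (forall i, P i -> inA iota M E s (F i)) -> inA iota M E s (\sum_(i <- r | P i) F i).
Proof.
move=> h; apply: (big_ind (inA iota M E s)) => //; first exact: inA_0.
by move=> *; exact: inA_add.
Qed.

Lemma inA_prod M E s (I : Type) (r : seq I) (P : pred I) F :
  (forall i, P i -> inA iota M E s (F i)) -> inA iota M E s (\prod_(i <- r | P i) F i).
Proof.
move=> h; apply: (big_ind (inA iota M E s)) => //; first exact: inA_1.
by move=> *; exact: inA_mul.
Qed.

Lemma inA_x M E s i : i \notin E -> inA iota M E s (vx s i).
Proof. exact: (@inA_var _ _ iota N M E s [::] i). Qed.

Lemma inA_mon M E s e :
  (forall i, e i = 0 \/ (i \notin E /\ (0 <= e i \/ i \notin M))) ->
  inA iota M E s (mon (vx s) e).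
Proof.
move=> h; apply: inA_prod => i _; have [->|[iE]] := h i; first by rewrite expr0z; exact: inA_1.
case: (e i) => n; first by move=> _; apply: inA_exp; exact: inA_x.
case=> // iM; rewrite NegzE -exprnN -exprVn; apply: inA_exp; exact: inA_inv.
Qed.

Lemma inA_mu M E s k a : gseed iota s -> k \in M ->
  inA iota M E (mu k s) a <-> inA iota M E s a.
Proof.
move=> gs kM; split.
  elim=> [c|ks i hks iE|i iM iE|b c _ hb _ hc|b c _ hb _ hc].
  - exact: inA_const.
  - by apply: (@inA_var _ _ iota N M E s (k :: ks)) => //=; rewrite kM.
  - by rewrite mu_vxN; [exact: inA_inv|apply: contraNneq iM => ->].
  - exact: inA_add.
  - exact: inA_mul.
elim=> [c|ks i hks iE|i iM iE|b c _ hb _ hc|b c _ hb _ hc].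
- exact: inA_const.
- have -> : mus s ks = mus (mu k s) (k :: ks) by rewrite /= (muK k gs).
  by apply: (@inA_var _ _ iota N M E (mu k s) (k :: ks)) => //=; rewrite kM.
- by rewrite -(@mu_vxN _ _ s k); [exact: inA_inv|apply: contraNneq iM => ->].
- exact: inA_add.
- exact: inA_mul.
Qed.

Lemma inA_mus M E s ks a : gseed iota s -> all (fun k => k \in M) ks ->
  inA iota M E (mus s ks) a <-> inA iota M E s a.
Proof.
elim: ks s => [|k ks IH] s gs //= /andP[kM h].
by rewrite IH ?inA_mu //; exact: mu_gseed.
Qed.

End InA.

(** * The Laurent phenomenon *)

Notation laurent iota s := (inA iota finset.set0 finset.set0 s).

Section LaurentStep.
Variables (C : numFieldType) (K : fieldType) (iota : {rmorphism C -> K}) (N : nat).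
Variables (s : sd K N) (j k p q : 'I_N) (c : nat).
Hypotheses (gs : gseed iota s) (njk : j != k) (Bjk : vB s j k = c%:Z).
Hypothesis nq : q \notin [:: j; k; p].
Hypotheses (Bpj : vB s p j = 1) (Bqj : vB s q j = 0) (Bqk : vB s q k = 1).

Local Notation x := (vx s).
Local Notation L := (laurent iota s).
Let s1 := mu j s.
Let s2 := mu k s1.
Let s3 := mu j s2.
Let a' := vx s1 j.

Local Lemma L_mon e : L (mon x e).
Proof. by apply: inA_mon => i; right; rewrite !inE; split; [|right]. Qed.

Local Lemma xn0 i : x i != 0. Proof. exact: (gseed_neq0 i gs). Qed.

(** Column j has the exponent 1 at [p], so 1 + y_j = 1 + x_p R, and the substitution x_p := -1/R
    kills [a']. *)
Let R := mon x (fun i => if i == p then 0 else vB s i j).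
Let w i := if i == p then - R^-1 else x i.

Local Lemma R0 : R != 0. Proof. by apply: mon_neq0 => i _; exact: xn0. Qed.

Local Lemma w0 i : w i != 0.
Proof. by rewrite /w; case: ifP => _; rewrite ?oppr_eq0 ?invr_eq0 ?R0 ?xn0. Qed.

Local Lemma yjE : mon x (fun i => vB s i j) = x p * R.
Proof. by rewrite (mon_split _ p) Bpj expr1z. Qed.

Local Lemma wj : mon w (fun i => vB s i j) = -1.
Proof.
rewrite (mon_split _ p) Bpj expr1z {1}/w eqxx (_ : mon w _ = R).
  by rewrite mulNr mulVf // R0.
by apply: eq_monx => i; rewrite /w; have [_|//] := eqVneq i p; rewrite eqxx.
Qed.

Local Lemma a'0 : a' != 0. Proof. exact: (mu_neq0 j j gs). Qed.

Local Lemma L_a' : L a'.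
Proof.
rewrite /a' (onestep j gs) /pneg yjE; apply: inA_mul; last first.
  by apply: inA_add; [exact: inA_1|rewrite -yjE; exact: L_mon].
by apply: inA_mul; [apply: inA_inv; rewrite inE|exact: L_mon].
Qed.

Section Phi.
Variables (D : K -> Prop) (phi : K -> K).
Hypothesis S : specialization iota iota x w D phi.

Local Lemma phi_mon e : D (mon x e) /\ phi (mon x e) = mon w e.
Proof. by apply: (spec_mon S) => i; rewrite w0 orbT. Qed.

Local Lemma phi_a' : phi a' = 0.
Proof.
rewrite /a' (onestep j gs).
have [D1 s1'] := spec_var S j.
have [D2 s2'] := spec_inv S D1 ltac:(by rewrite s1' w0).
have [D3 s3'] := phi_mon (fun i => zpos (- vB s i j)).
have [D4 s4'] := phi_mon (fun i => vB s i j).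
have [D5 s5'] := spec_add S (proj1 (spec1 S)) D4.
have [D6 s6'] := spec_mul S D2 D3.
have [_ ->] := spec_mul S D6 D5.
by rewrite s5' (proj2 (spec1 S)) s4' wj subrr mulr0.
Qed.

(* The Laurent ring modulo a' is obtained by eliminating x_p. *)
Local Lemma phi_kernel f : L f -> [/\ D f, L (phi f) & exists2 g, L g & f - phi f = a' * g].
Proof.
have diffE : x p - w p = a' * (R^-1 * x j / pneg s j).
  have n0 : pneg s j != 0 by apply: mon_neq0 => i _; exact: xn0.
  rewrite /a' (onestep j gs) yjE /w eqxx; field; rewrite R0 n0 xn0 //.
have Ldiff : L (R^-1 * x j / pneg s j).
  rewrite -!monN; apply: inA_mul; last exact: L_mon.
  by apply: inA_mul; [exact: L_mon|apply: inA_x; rewrite inE].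
have Lw : L (w p) by rewrite /w eqxx -monN; apply: inA_opp; exact: L_mon.
have LwV : L (w p)^-1.
  by rewrite /w eqxx invrN invrK; apply: inA_opp; exact: L_mon.
elim=> [c0|ks i hks _|i _ _|u v Lu [Du Lpu [g Lg hg]] Lv [Dv Lpv [h Lh hh]]
       |u v Lu [Du Lpu [g Lg hg]] Lv [Dv Lpv [h Lh hh]]].
- have [Dc ->] := spec_const S c0; split=> //; first exact: inA_const.
  by exists 0; [exact: inA_0|rewrite subrr mulr0].
- rewrite (all_set0 hks).
  have [Di ->] := spec_var S i; split=> //.
    by rewrite /w; case: eqP => [_|_]; [rewrite /w eqxx in Lw|apply: inA_x; rewrite inE].
  have [->|ip] := eqVneq i p; first by exists (R^-1 * x j / pneg s j).
  by exists 0; [exact: inA_0|rewrite /w (negbTE ip) subrr mulr0].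
- have [Di si] := spec_var S i.
  have [DV sV] := spec_inv S Di ltac:(by rewrite si w0).
  rewrite sV si; split=> //.
    rewrite /w; case: eqP => [_|_]; first by rewrite /w eqxx in LwV.
    by apply: inA_inv; rewrite inE.
  have [->|ip] := eqVneq i p; last first.
    by exists 0; [exact: inA_0|rewrite /w (negbTE ip) subrr mulr0].
  exists (- (R^-1 * x j / pneg s j) * ((x p)^-1 / w p)).
    apply: inA_mul; first exact: inA_opp.
    by apply: inA_mul => //; apply: inA_inv; rewrite inE.
  by rewrite mulrA mulrN -diffE; field; rewrite w0 xn0.
- have [Dd ->] := spec_add S Du Dv; split=> //; first exact: inA_add.
  by exists (g + h); [exact: inA_add|rewrite mulrDr -hg -hh; ring].
- have [Dd ->] := spec_mul S Du Dv; split=> //; first exact: inA_mul.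
  exists (g * v + phi u * h); first by apply: inA_add; exact: inA_mul.
  by rewrite mulrDr mulrA -hg mulrCA -hh; ring.
Qed.

(** Doubling x_q leaves w_p alone, since q is not joined to j, and halves the monomial. The monomial
    is therefore not the constant -1. *)
Local Lemma phi_1D e : e q = -1 -> 1 + mon w e != 0.
Proof.
move=> eq1; have n2 : 2%:R != 0 :> K by exact: (@iota_natf_neq0 _ _ iota 2).
pose v i := if i == q then 2%:R * x i else x i.
have v0 i : v i != 0.
  by rewrite /v; case: ifP => _; rewrite ?mulf_neq0 ?xn0 ?n2.
have [D2 [psi S2]] := @specialization_exists _ _ _ iota iota _ x v (proj1 gs).
have psiw i : D2 (w i) /\ psi (w i) = if i == q then 2%:R * w i else w i.
  rewrite /w; have [->|ip] := eqVneq i p; last exact: (spec_var S2).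
  have pq : (p == q) = false by apply: contraNF nq => /eqP <-; rewrite !inE eqxx !orbT.
  rewrite pq /R -monN -mulN1r.
  have [D3 s3'] := @spec_mon _ _ _ _ _ _ _ _ _ _ (fun i => - (if i == p then 0 else vB s i j)) S2
    (fun i => ltac:(by rewrite v0 orbT)).
  have [D4 ->] := spec_mul S2 (proj1 (specN1 S2)) D3.
  split=> //; rewrite s3' (proj2 (specN1 S2)); congr (_ * _).
  apply: eq_monx => l; rewrite /v; have [->|//] := eqVneq l q.
  by rewrite [q == p]eq_sym pq Bqj oppr0 eqxx.
have [D5 s5] : D2 (mon w e) /\ psi (mon w e) = mon (fun i => if i == q then 2%:R * w i else w i) e.
  apply: (spec_prod S2) => i; have [Di si] := psiw i; rewrite -si.
  apply: (spec_expz S2) => //; rewrite si; case: ifP => _; by rewrite ?mulf_neq0 ?w0 ?n2 ?orbT.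
apply/eqP => h; have hm : mon w e = -1 by apply/eqP; rewrite -subr_eq0 opprK addrC h.
move: s5; rewrite hm (proj2 (specN1 S2)) (mon_split _ q) eqxx eq1 => h1.
have h2 : mon w (fun i => if i == q then 0 else e i) / w q = -1.
  rewrite -hm (mon_split w q e) eq1 -[w q ^ (-1)]/((w q)^-1); exact: mulrC.
have h3 : mon (fun i => if i == q then 2%:R * w i else w i) (fun i => if i == q then 0 else e i)
   = mon w (fun i => if i == q then 0 else e i).
  by apply: eq_monx => i; have [_|//] := eqVneq i q; rewrite eqxx.
move: h1; rewrite h3 -[(2%:R * w q) ^ -1]/((2%:R * w q)^-1) => h1.
have h4 : (2%:R * w q)^-1 * mon w (fun i => if i == q then 0 else e i) = - 2%:R^-1.
  rewrite -[RHS]mulN1r -h2; field; by rewrite n2 w0.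
move: h1; rewrite h4 => /eqP; rewrite eqr_opp => /eqP h1.
have : 2%:R = 1 :> K by rewrite -[LHS]invrK -h1 invr1.
move=> /eqP; rewrite -subr_eq0 (_ : 2%:R - 1 = 1 :> K) ?oner_eq0 //.
by rewrite mulr2n addrK.
Qed.

Local Lemma phi_spec f : L f -> D f. Proof. by case/phi_kernel. Qed.

Let em i := if i == j then 0 else - vB s1 i k.

Local Lemma emq : em q = -1.
Proof.
have qj : q != j by apply: contraNneq nq => ->; rewrite !inE eqxx.
by rewrite /em (negbTE qj) /s1 (mut_column njk Bjk qj) Bqj Bqk /zpos maxxx mul0r addr0.
Qed.

Local Lemma mon_inv e : (mon x e)^-1 = mon x (fun i => - e i).
Proof. by rewrite monN. Qed.

Local Lemma b'E : exists e, vx s2 k = mon x e * (1 + a' ^+ c * mon x em).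
Proof.
rewrite (twostep_b gs njk Bjk) -(mon_delta x k) mon_inv -monD; last exact: xn0.
by eexists.
Qed.

Local Lemma a''E : exists e, vx s3 j = mon x e + mon x e * pneg s j / x j *
  mon x (fun i => vB s i j) * (((1 + a' ^+ c * mon x em) ^+ c - 1) / a').
Proof.
rewrite (twostep_a gs njk Bjk) -/s1 -/a'.
set H := mon x (fun i => if _ || _ then _ else _).
have n0 : pneg s j != 0 by apply: mon_neq0 => i _; exact: xn0.
have -> : H * mon x (vB s ^~ j) = H * x j / pneg s j * pneg s j / x j * mon x (vB s ^~ j).
  by field; rewrite n0 xn0.
have -> : H * x j / pneg s j = mon x (fun i =>
   (if (i == j) || (i == k) then 0 else zpos (vB s2 i j)) + (i == j)%:R - zpos (- vB s i j)).
  by rewrite !monD ?monN ?mon_delta //; exact: xn0.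
by eexists.
Qed.

(** Modulo [a'] the variable is a monomial if c > 0; if c = 0 it is a monomial times 1 plus a
    monomial with exponent -1 at q. *)
Local Lemma phi_b' : L (vx s2 k) /\ phi (vx s2 k) != 0.
Proof.
have [e ->] := b'E; have [D1 h1] := phi_mon e; have [D2 h2] := phi_mon em.
have L1 : L (1 + a' ^+ c * mon x em).
  by apply: inA_add; [exact: inA_1|apply: inA_mul; [apply: inA_exp; exact: L_a'|exact: L_mon]].
split; first by apply: inA_mul => //; exact: L_mon.
have [D3 h3] := spec_exp S c (phi_spec L_a').
have [D4 h4] := spec_mul S D3 D2.
have [D5 h5] := spec_add S (proj1 (spec1 S)) D4.
have [_ ->] := spec_mul S D1 D5; rewrite h5 h4 h3 h2 h1 phi_a' (proj2 (spec1 S)).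
apply: mulf_neq0; first by apply: mon_neq0 => i _; exact: w0.
case: (c) => [|c']; first by rewrite mul1r; apply: phi_1D; exact: emq.
by rewrite expr0n mul0r addr0 oner_neq0.
Qed.

Local Lemma phi_a'' : L (vx s3 j) /\ phi (vx s3 j) != 0.
Proof.
have n0 : pneg s j != 0 by apply: mon_neq0 => i _; exact: xn0.
have [e eE] := a''E; have [D1 h1] := phi_mon e.
have e0 : mon w e != 0 by apply: mon_neq0 => i _; exact: w0.
(* The quotient ((1 + a'^c m)^c - 1) / a' is 0 for c = 0, equal to m for c = 1, and still divisible
   by a' for c >= 2. *)
have [c0|[c1|[c' cE]]] : c = 0%N \/ c = 1%N \/ exists c', c = c'.+2.
- by case: (c) => [|[|c']]; [left|right; left|right; right; exists c'].
- by rewrite eE c0 expr0 subrr mul0r mulr0 addr0 h1; split=> //; exact: L_mon.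
- have -> : vx s3 j = mon x e * (1 + mon x (fun i => - vB s i k)).
    rewrite eE c1 !expr1 [1 + _]addrC addrK [a' * _ / _]mulrC mulKf ?a'0 //.
    have := twostep_y gs njk Bjk c1; rewrite -/s1 -/x => h.
    rewrite mulrDr mulr1; congr (_ + _); rewrite monN.
    have -> : (mon x (fun i => vB s i k))^-1 = mon x (vB s ^~ j) * mon x em * pneg s j / x j.
      rewrite h; field; rewrite xn0.
      by rewrite (mon_neq0 (fun i _ => xn0 i)).
    by ring.
  split; first by apply: inA_mul; [|apply: inA_add; [exact: inA_1|]]; exact: L_mon.
  have [D2 h2] := phi_mon (fun i => - vB s i k).
  have [D3 h3] := spec_add S (proj1 (spec1 S)) D2.
  have [_ ->] := spec_mul S D1 D3; rewrite h3 h2 h1 (proj2 (spec1 S)).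
  by apply: mulf_neq0 => //; apply: phi_1D; rewrite Bqk.
- pose Z := mon x e * pneg s j / x j * mon x (fun i => vB s i j) *
     (a' ^+ c' * mon x em * \sum_(i < c) (1 + a' ^+ c * mon x em) ^+ i).
  have LZ : L Z.
    apply: inA_mul.
      apply: inA_mul; last exact: L_mon.
      apply: inA_mul; last by apply: inA_inv; rewrite inE.
      by apply: inA_mul; exact: L_mon.
    apply: inA_mul.
      by apply: inA_mul; [apply: inA_exp; exact: L_a'|exact: L_mon].
    apply: inA_sum => i _; apply: inA_exp; apply: inA_add; first exact: inA_1.
    by apply: inA_mul; [apply: inA_exp; exact: L_a'|exact: L_mon].
  have aE : vx s3 j = mon x e + a' * Z.
    rewrite eE subrX1 [1 + _ - 1]addrC addKr /Z.
    congr (_ + _); set Sg := \sum_(_ < _) _; have -> : a' ^+ c = a' * (a' * a' ^+ c').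
      by rewrite cE !exprS.
    by field; rewrite a'0 xn0.
  rewrite aE; split; first by apply: inA_add; [exact: L_mon|apply: inA_mul => //; exact: L_a'].
  have [D2 h2] := spec_mul S (phi_spec L_a') (phi_spec LZ).
  by have [_ ->] := spec_add S D1 D2; rewrite h2 h1 phi_a' mul0r addr0.
Qed.

End Phi.

Local Lemma denominators (t : sd K N) d z : (forall i, L (vx t i)) -> L d ->
  (forall i, exists n, L ((vx t i)^-1 * d ^+ n)) ->
  laurent iota t z -> exists n, L (z * d ^+ n).
Proof.
move=> Lt Ld LV; elim=> [c0|ks i hks _|i _ _|u v _ [n Ln] _ [m Lm]|u v _ [n Ln] _ [m Lm]].
- by exists 0%N; rewrite mulr1; exact: inA_const.
- rewrite (all_set0 hks).
  by exists 0%N; rewrite mulr1.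
- exact: LV.
- exists (n + m)%N; have -> : (u + v) * d ^+ (n + m) =
    u * d ^+ n * d ^+ m + v * d ^+ m * d ^+ n by rewrite exprD; ring.
  by apply: inA_add; apply: inA_mul => //; exact: inA_exp.
- exists (n + m)%N; have -> : u * v * d ^+ (n + m) = u * d ^+ n * (v * d ^+ m).
    by rewrite exprD; ring.
  exact: inA_mul.
Qed.

(** In [z] only [a'] can be a denominator with respect to [s1], and only the two new variables of
    [s3] with respect to [s3]. The latter do not vanish under [phi], whose kernel on the Laurent
    ring is generated by [a']; hence the powers of [a'] cancel. *)
Lemma laurent_step_pos z : laurent iota s1 z -> laurent iota s3 z -> L z.
Proof.
have [D [phi S]] := @specialization_exists _ _ _ iota iota _ x w (proj1 gs).
have [Lb b0] := phi_b' S; have [La a0] := phi_a'' S.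
have kerphi := phi_kernel S.
have Dphi := phi_spec S.
have L1 i : L (vx s1 i).
  have [->|ij] := eqVneq i j; first exact: L_a'.
  by rewrite /s1 mu_vxN //; apply: inA_x; rewrite inE.
have L3 i : L (vx s3 i).
  have [->|ij] := eqVneq i j; first exact: La.
  rewrite /s3 mu_vxN //; have [->|ik] := eqVneq i k; first exact: Lb.
  by rewrite /s2 mu_vxN.
have g1 : gseed iota s1 by exact: mu_gseed.
have g2 : gseed iota s2 by exact: mu_gseed.
have g3 : gseed iota s3 by exact: mu_gseed.
move=> z1 z3.
have [n Ln] : exists n, L (z * a' ^+ n).
  apply: denominators L1 L_a' _ z1 => i.
  have [->|ij] := eqVneq i j; first by exists 1%N; rewrite expr1 mulVf ?a'0 //; exact: inA_1.
  by exists 0%N; rewrite /s1 mu_vxN // mulr1; apply: inA_inv; rewrite inE.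
pose d := vx s3 j * vx s2 k.
have Ld : L d by exact: inA_mul.
have [m Lm] : exists m, L (z * d ^+ m).
  apply: denominators L3 Ld _ z3 => i.
  have [->|ij] := eqVneq i j.
    by exists 1%N; rewrite expr1 /d mulrA mulVf ?mul1r // (gseed_neq0 j g3).
  rewrite /s3 mu_vxN // -/s3; have [->|ik] := eqVneq i k.
    by exists 1%N; rewrite expr1 /d mulrCA mulVf ?mulr1 // (gseed_neq0 k g2).
  by exists 0%N; rewrite /s2 mu_vxN // /s1 mu_vxN // mulr1; apply: inA_inv; rewrite inE.
have phid : phi (d ^+ m) != 0.
  have [_ ->] := spec_exp S m (Dphi _ Ld); apply: expf_neq0.
  by have [_ ->] := spec_mul S (Dphi _ La) (Dphi _ Lb); exact: mulf_neq0.
(* Removes one power of [a'] at a time: [phi] kills z a'^(n+1), because it kills its product with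
   d^m and not d^m itself. *)
elim: n Ln => [|n IH] Ln; first by rewrite mulr1 in Ln.
apply: IH; have [Df _ [g Lg hg]] := kerphi _ Ln.
have pf : phi (z * a' ^+ n.+1) = 0.
  apply/eqP; have /eqP := congr1 phi (erefl (z * a' ^+ n.+1 * d ^+ m)).
  have Lda := inA_exp n.+1 L_a'; have Ldm := inA_exp m Ld.
  have [_ h1] := spec_mul S Df (Dphi _ Ldm).
  have [_ h2] := spec_mul S (Dphi _ Lm) (Dphi _ Lda).
  have [_ h3] := spec_exp S n.+1 (Dphi _ L_a').
  rewrite {1}h1 mulrAC h2 h3 (phi_a' S) expr0n mulr0 mulf_eq0 (negbTE phid).
  by rewrite orbF.
move: hg; rewrite pf subr0 => hg.
rewrite (_ : z * a' ^+ n = g) //; apply: (mulfI a'0); rewrite -hg exprS; ring.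
Qed.

End LaurentStep.

(** * Fraction fields of polynomial rings and the Laurent phenomenon in general *)

Lemma frac_numden (R : idomainType) (y : {fraction R}) :
  exists n d : R, d != 0 /\ y = FracField.tofrac n / FracField.tofrac d.
Proof.
elim/quotW: y => r; exists (frac r).1, (frac r).2; split; first exact: denom_ratioP.
unlock FracField.tofrac; rewrite -[_^-1]FracField.pi_inv -[RHS]FracField.pi_mul.
rewrite /FracField.mulf /FracField.invf /= !numden_Ratio ?oner_neq0 ?denom_ratioP //.
by rewrite mulr1 mul1r Ratio_numden.
Qed.

Definition frac_const (C : fieldType) (N : nat) :
    {rmorphism C -> {fraction {mpoly C[N]}}} :=
  @FracField.tofrac {mpoly C[N]} \o @mpolyC N C.

Lemma mmap_tofrac (C : fieldType) (N : nat) (p : {mpoly C[N]}) :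
  mmap (frac_const C N) (fun i => FracField.tofrac 'X_i) p = FracField.tofrac p.
Proof.
elim/mpolyind: p => [|c m p _ _ IH]; first by rewrite !rmorph0.
rewrite mmapD mmapZ IH rmorphD -mul_mpolyC rmorphM; congr (_ * _ + _).
rewrite mmapX /mmap1 mpolyXE_id rmorph_prod; apply: eq_bigr => i _.
by rewrite rmorphXn.
Qed.

Lemma freely_generates_frac (C : fieldType) (N : nat) :
  freely_generates (frac_const C N) (fun i : 'I_N => FracField.tofrac 'X_i).
Proof.
split=> [p|y]; first by rewrite mmap_tofrac => /eqP; rewrite tofrac_eq0 => /eqP.
have [n [d [d0 ->]]] := frac_numden y; exists n, d; rewrite !mmap_tofrac.
by rewrite tofrac_eq0.
Qed.

Definition sopp (K : fieldType) N (s : sd K N) : sd K N := Sd (vx s) (bopp (vB s)).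

(** Reversing all arrows swaps the two exchange monomials and so keeps all variables. This allows
    the sign of one entry to be prescribed. *)
Lemma mu_opp (K : fieldType) N (s : sd K N) k : mu k (sopp s) = sopp (mu k s).
Proof.
apply: eq_sd => [i|i j]; last by rewrite /= bmut_opp.
rewrite /=; case: ifP => // _; rewrite addrC /ppos /pneg /bopp /=; congr (_ * (_ + _)).
by apply: eq_mon => l; rewrite opprK.
Qed.

Lemma mus_opp (K : fieldType) N (s : sd K N) ks : mus (sopp s) ks = sopp (mus s ks).
Proof. by elim: ks s => //= k ks IH s; rewrite mu_opp IH. Qed.

Lemma gseed_opp (C : numFieldType) (K : fieldType) (iota : {rmorphism C -> K}) N
    (s : sd K N) : gseed iota s -> gseed iota (sopp s).
Proof. by case=> fx sk; split=> // i j; rewrite /= /bopp (sk i j). Qed.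

Lemma laurent_vx (C : numFieldType) (K : fieldType) (iota : {rmorphism C -> K}) N
    (s t : sd K N) z : vx s = vx t -> laurent iota s z -> laurent iota t z.
Proof.
move=> e; elim=> [c|ks i h _|i _ _|a b _ ha _ hb|a b _ ha _ hb]; last 2 first.
- exact: inA_add.
- exact: inA_mul.
- exact: inA_const.
- rewrite (all_set0 h).
  by rewrite /= e; apply: inA_x; rewrite inE.
- by rewrite e; apply: inA_inv; rewrite inE.
Qed.

(* Two frozen vertices are added, one attached to [j] and one to [k]: their
   variables make the exchange polynomials at [j] and [k] coprime. *)
Section Extension.
Variables (C : numFieldType) (K : fieldType) (iota : {rmorphism C -> K}) (N : nat).
Variables (s : sd K N) (j k : 'I_N).
Hypothesis gs : gseed iota s.

Let K' : fieldType := {fraction {mpoly C[N + 2]}}.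

Definition ext_matrix (u v : 'I_(N + 2)) : int :=
  match split u, split v with
  | inl i, inl i' => vB s i i'
  | inr e, inl i => if e == 0 :> nat then (i == j)%:R else (i == k)%:R
  | inl i, inr e => - (if e == 0 :> nat then (i == j)%:R else (i == k)%:R)
  | inr _, inr _ => 0
  end.

Definition ext_seed : sd K' (N + 2) := Sd (fun u => FracField.tofrac 'X_u) ext_matrix.

Local Notation emb := (@lshift N 2).

Lemma ext_gseed : gseed (frac_const C (N + 2)) ext_seed.
Proof.
split; first exact: freely_generates_frac.
move=> u v; rewrite /= /ext_matrix; case: (split u) => a; case: (split v) => b.
- by rewrite (proj2 gs).
- by [].
- by rewrite opprK.
- by rewrite oppr0.
Qed.

Variables (D : K' -> Prop) (sg : K' -> K).
Hypothesis S : specialization (frac_const C (N + 2)) iota (vx ext_seed)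
  (fun u => match split u with inl i => vx s i | inr _ => 1 end) D sg.

Definition restricts_to (t' : sd K' (N + 2)) (t : sd K N) : Prop :=
  [/\ forall i, D (vx t' (emb i)) /\ sg (vx t' (emb i)) = vx t i,
      forall e, D (vx t' (rshift N e)) /\ sg (vx t' (rshift N e)) = 1
    & forall i i', vB t' (emb i) (emb i') = vB t i i'].

Lemma restricts_ext : restricts_to ext_seed s.
Proof.
split=> [i|e|i i'].
- by have := spec_var S (emb i); rewrite -[lshift 2 i]/(unsplit (inl i)) unsplitK.
- by have := spec_var S (rshift N e); rewrite -[rshift N e]/(unsplit (inr e)) unsplitK.
- by rewrite /= /ext_matrix -[lshift 2 i]/(unsplit (inl i)) -[lshift 2 i']/(unsplit (inl i')) !unsplitK.
Qed.

(** The extra variables specialize to 1 and thus contribute the factor 1 to every exchange monomial;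
    they remain unchanged because only old vertices are mutated. *)
Lemma restricts_mu t' t l : gseed iota t -> restricts_to t' t ->
  restricts_to (mu (emb l) t') (mu l t).
Proof.
move=> gt [h1 h2 h3].
have embE i i' : (emb i == emb i') = (i == i') by exact: (inj_eq (@lshift_inj N 2)).
have hm (f : 'I_(N + 2) -> int) : (forall u, 0 <= f u) ->
    D (mon (vx t') f) /\ sg (mon (vx t') f) = mon (vx t) (fun i => f (emb i)).
  move=> f0; have := @spec_prod _ _ _ _ _ _ _ _ _ _ S _ (fun u => vx t' u ^ f u)
    (fun u => match split u with inl i => vx t i | inr _ => 1 end ^ f u).
  case=> [u|Dm ->].
    case: splitP => [i|e] ue.
      have -> : u = emb i by apply: val_inj.
      by have [? <-] := h1 i; apply: (spec_expz S) => //; rewrite f0.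
    have -> : u = rshift N e by apply: val_inj.
    by have [? <-] := h2 e; apply: (spec_expz S) => //; rewrite f0.
  split=> //; rewrite big_split_ord /= [X in _ * X]big1 ?mulr1 => [|e _].
    by apply: eq_bigr => i _; rewrite -[lshift 2 i]/(unsplit (inl i)) unsplitK.
  by rewrite -[rshift N e]/(unsplit (inr e)) unsplitK exp1rz.
split=> [i|e|i i'].
- have [->|il] := eqVneq i l; last by rewrite !mu_vxN ?embE.
  rewrite !mu_vx; have [D1 s1] := h1 l.
  have [D2 s2] := spec_inv S D1 ltac:(by rewrite s1 (gseed_neq0 l gt)).
  have [D3 s3] := hm (fun u => zpos (vB t' u (emb l))) (fun u => zpos_ge0 _).
  have [D4 s4] := hm (fun u => zpos (- vB t' u (emb l))) (fun u => zpos_ge0 _).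
  have [D5 s5] := spec_add S D3 D4; have [D6 s6] := spec_mul S D2 D5.
  split=> //; rewrite s6 s2 s5 s1 s3 s4 /ppos /pneg; congr (_ * (_ + _)).
    by apply: eq_mon => u; rewrite h3.
  by apply: eq_mon => u; rewrite h3.
- by rewrite mu_vxN // -val_eqE /= gtn_eqF // ltn_addr.
- by rewrite /= /bmut !embE !h3.
Qed.

Lemma restricts_mus t' t ls : gseed iota t -> restricts_to t' t ->
  restricts_to (mus t' (map emb ls)) (mus t ls).
Proof.
elim: ls t' t => //= l ls IH t' t gt h; apply: IH; first exact: mu_gseed.
exact: restricts_mu.
Qed.

Lemma restricts_laurent t' t z : gseed iota t -> restricts_to t' t ->
  laurent (frac_const C (N + 2)) t' z -> D z /\ laurent iota t (sg z).
Proof.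
move=> gt [h1 h2 h3]; elim=> [c|ks u h _|u _ _|a b _ [Da ha] _ [Db hb]|a b _ [Da ha] _ [Db hb]].
- by have [? ->] := spec_const S c; split=> //; exact: inA_const.
- rewrite (all_set0 h).
  rewrite /=; case: (split_ordP u) => i ->.
    by have [? ->] := h1 i; split=> //; apply: inA_x; rewrite inE.
  by have [? ->] := h2 i; split=> //; exact: inA_1.
- case: (split_ordP u) => i ->.
    have [D1 s1] := h1 i; have [D2 ->] := spec_inv S D1 ltac:(by rewrite s1 (gseed_neq0 i gt)).
    by rewrite s1; split=> //; apply: inA_inv; rewrite inE.
  have [D1 s1] := h2 i; have [D2 ->] := spec_inv S D1 ltac:(by rewrite s1 oner_neq0).
  by rewrite s1 invr1; split=> //; exact: inA_1.
- by have [? ->] := spec_add S Da Db; split=> //; exact: inA_add.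
- by have [? ->] := spec_mul S Da Db; split=> //; exact: inA_mul.
Qed.

End Extension.

(** Induction on the number of mutations, for all fields at once because the extended seed lives in
    another field. A variable reached by j, k, ks is Laurent in the seeds [s1] and [s3] of the
    two-step analysis, from which it is reached by fewer mutations. *)
Lemma laurent_phenomenon_bounded (C : numFieldType) d : forall (K : fieldType)
  (iota : {rmorphism C -> K}) N (s : sd K N) ks i, gseed iota s -> (size ks <= d)%N ->
  laurent iota s (vx (mus s ks) i).
Proof.
elim/ltn_ind: d => d IH.
suff pos (K : fieldType) (iota : {rmorphism C -> K}) N (s : sd K N) j k ks i (c : nat) :
    gseed iota s -> j != k -> vB s j k = c%:Z -> ((size ks).+2 <= d)%N ->
    laurent iota s (vx (mus s [:: j, k & ks]) i).
  move=> K iota N s ks i gs; case: ks => [|j [|k ks]] hd.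
  - by apply: inA_x; rewrite inE.
  - rewrite -[mus _ _]/(mu j s); have [->|ij] := eqVneq i j; last first.
      by rewrite mu_vxN //; apply: inA_x; rewrite inE.
    rewrite mu_vx; apply: inA_mul; first by apply: inA_inv; rewrite inE.
    by apply: inA_add; apply: inA_mon => l; right; rewrite !inE; split=> //; right.
  have [e|jk] := eqVneq j k.
    rewrite -e /= (muK j gs); apply: (IH (size ks)) => //.
    by apply: leq_trans hd => /=; rewrite ltnS leqnSn.
  case e: (vB s j k) => [n|n]; first exact: (pos _ _ _ _ _ _ _ _ _ gs jk e).
  have gs' := gseed_opp gs.
  have e' : vB (sopp s) j k = n.+1%:Z by rewrite /= /bopp e NegzE opprK.
  have := pos _ _ _ _ _ _ ks i _ gs' jk e' hd.
  by rewrite mus_opp; exact: laurent_vx.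
move=> gs jk Bjk hd.
pose x1 (u : 'I_(N + 2)) := match split u with inl i => vx s i | inr _ => 1 end.
have ge := ext_gseed j k gs.
have [D [sg S]] := @specialization_exists _ _ _ _ iota _ _ x1 (proj1 ge).
have rs := restricts_ext S.
have [_ <-] : D (vx (mus (ext_seed C s j k) (map (@lshift N 2) [:: j, k & ks])) (lshift 2 i)) /\
  sg (vx (mus (ext_seed C s j k) (map (@lshift N 2) [:: j, k & ks])) (lshift 2 i)) =
  vx (mus s [:: j, k & ks]) i.
  by have [h _ _] := restricts_mus S [:: j, k & ks] gs rs; exact: h.
apply: (proj2 (restricts_laurent S gs rs _)).
set t := ext_seed C s j k in ge S rs *; set z := vx _ _.
have hl a : lshift 2 a = unsplit (inl a) by [].
have hr a : rshift N a = unsplit (inr a) by [].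
have nlr (a : 'I_N) (e : 'I_2) : rshift N e != lshift 2 a.
  by rewrite -val_eqE /= gtn_eqF // ltn_addr.
apply: (@laurent_step_pos _ _ _ _ t (lshift 2 j) (lshift 2 k) (rshift N 0) (rshift N 1) c) => //.
- by have [_ _ ->] := rs.
- by rewrite !inE !negb_or !nlr /= (inj_eq (@rshift_inj N 2)).
- by rewrite /t /= /ext_matrix hl hr !unsplitK /= eqxx.
- by rewrite /t /= /ext_matrix hl hr !unsplitK /= (negbTE jk).
- by rewrite /t /= /ext_matrix hl hr !unsplitK /= eqxx.
- rewrite /z -[mus t _]/(mus (mu (lshift 2 j) t) (map (@lshift N 2) (k :: ks))).
  apply: (IH (size ks).+1) => //; last by rewrite /= size_map.
  exact: mu_gseed.
- rewrite /z -[mus t _]/(mus (mu (lshift 2 k) (mu (lshift 2 j) t)) (map (@lshift N 2) ks)).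
  have g2 : gseed (frac_const C (N + 2)) (mu (lshift 2 k) (mu (lshift 2 j) t)).
    by do 2!apply: mu_gseed.
  (* Since mutation at j is an involution, the target is reached from the third seed by j :: ks, one
     step shorter than j, k, ks. *)
  have -> : mus (mu (lshift 2 k) (mu (lshift 2 j) t)) (map (@lshift N 2) ks) =
      mus (mu (lshift 2 j) (mu (lshift 2 k) (mu (lshift 2 j) t)))
        (map (@lshift N 2) (j :: ks)).
    by rewrite /= (muK (lshift 2 j) g2).
  apply: (IH (size ks).+1) => //; last by rewrite /= size_map.
  exact: mu_gseed.
Qed.

Theorem laurent_phenomenon (C : numFieldType) (K : fieldType)
    (iota : {rmorphism C -> K}) N (s : sd K N) ks i :
  gseed iota s -> laurent iota s (vx (mus s ks) i).
Proof. by move=> gs; exact: (laurent_phenomenon_bounded _ gs (leqnn _)). Qed.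
Lemma inA_laurent (C : numFieldType) (K : fieldType) (iota : {rmorphism C -> K}) N
    M E (s : sd K N) a : gseed iota s -> inA iota M E s a -> laurent iota s a.
Proof.
move=> gs; elim=> [c|ks i _ _|i _ _|u v _ hu _ hv|u v _ hu _ hv].
- exact: inA_const.
- exact: laurent_phenomenon.
- by apply: inA_inv; rewrite inE.
- exact: inA_add.
- exact: inA_mul.
Qed.

(** * Torus action *)

Section Torus.
Variables (C : numFieldType) (K : fieldType) (iota : {rmorphism C -> K}) (N : nat).
Implicit Types (s : sd K N) (M E : {set 'I_N}) (c : 'I_N -> C) (g : K -> K).

Record scaling s c g : Prop := Scaling {
  scal_const a : g (iota a) = iota a;
  scal_add a b : g (a + b) = g a + g b;
  scal_mul a b : g (a * b) = g a * g b;
  scal_var i : g (vx s i) = iota (c i) * vx s i }.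

(** The column condition makes both exchange monomials scale by the same factor. Frozen variables
    are kept fixed: they vanish at no point, so an element of a stabilizer cannot rescale them. *)
Record torus M s c : Prop := Torus {
  torus_neq0 i : c i != 0;
  torus_frozen i : i \notin M -> c i = 1;
  torus_col j : j \in M -> mon c (fun i => vB s i j) = 1 }.

(** The inverse rescaling shows that no nonzero polynomial is sent to 0, so the substitution is
    defined on the whole field. *)
Lemma scaling_exists s c : gseed iota s -> (forall i, c i != 0) -> exists g, scaling s c g.
Proof.
move=> [fx _] c0.
have [D [g S]] := @specialization_exists _ _ _ iota iota _ _
   (fun i => iota (c i) * vx s i) fx.
have [D' [h S']] := @specialization_exists _ _ _ iota iota _ _
   (fun i => iota (c i)^-1 * vx s i) fx.
have hw i : D' (iota (c i) * vx s i) /\ h (iota (c i) * vx s i) = vx s i.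
  have [D1 s1] := spec_const S' (c i); have [D2 s2] := spec_var S' i.
  have [D3 ->] := spec_mul S' D1 D2; rewrite s1 s2 mulrA -rmorphM divff //.
  by rewrite rmorph1 mul1r.
have hp p : D' (mmap iota (fun i => iota (c i) * vx s i) p) /\
   h (mmap iota (fun i => iota (c i) * vx s i) p) = mmap iota (vx s) p.
  elim/mpolyind: p => [|a m p _ _ [Dp sp]]; first by rewrite !rmorph0; exact: (spec0 S').
  rewrite !mmapD !mmapZ.
  have [Dm sm] : D' (mmap iota (fun i => iota (c i) * vx s i) 'X_[m]) /\
    h (mmap iota (fun i => iota (c i) * vx s i) 'X_[m]) = mmap iota (vx s) 'X_[m].
    rewrite !mmapX /mmap1; apply: (spec_prod S') => i; have [Di e] := hw i.
    by have [? ->] := spec_exp S' (m i) Di; rewrite e.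
  have [Da sa] := spec_const S' a; have [D1 s1] := spec_mul S' Da Dm.
  by have [? ->] := spec_add S' D1 Dp; rewrite s1 sa sm sp.
have Dall y : D y.
  have [p [q [q0 ->]]] := proj2 fx y.
  have [Dp _] := spec_mmap S p; have [Dq sq] := spec_mmap S q.
  have gq0 : g (mmap iota (vx s) q) != 0.
    rewrite sq; apply: contra_neq q0 => e; have [_ <-] := hp q.
    by rewrite e; have [] := spec0 S'.
  by have [DV _] := spec_inv S Dq gq0; have [] := spec_mul S Dp DV.
exists g; split.
- by move=> a; have [] := spec_const S a.
- by move=> a b; have [] := spec_add S (Dall a) (Dall b).
- by move=> a b; have [] := spec_mul S (Dall a) (Dall b).
- by move=> i; have [] := spec_var S i.
Qed.

Section Scal.
Variables (s : sd K N) (c : 'I_N -> C) (g : K -> K).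
Hypothesis S : scaling s c g.

Lemma scal0 : g 0 = 0. Proof. by rewrite -(rmorph0 iota) (scal_const S). Qed.
Lemma scal1 : g 1 = 1. Proof. by rewrite -(rmorph1 iota) (scal_const S). Qed.

Lemma scal_exp a n : g (a ^+ n) = g a ^+ n.
Proof. by elim: n => [|n IH]; rewrite ?expr0 ?scal1 // !exprS (scal_mul S) IH. Qed.

Lemma scal_inv a : a != 0 -> g a^-1 = (g a)^-1.
Proof.
move=> a0; have h : g a * g a^-1 = 1 by rewrite -(scal_mul S) divff // scal1.
have ga0 : g a != 0 by apply: contra_eq_neq h => ->; rewrite mul0r eq_sym oner_neq0.
by apply: (mulfI ga0); rewrite h divff.
Qed.

Lemma scal_sum (I : Type) (r : seq I) (P : pred I) F :
  g (\sum_(i <- r | P i) F i) = \sum_(i <- r | P i) g (F i).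
Proof. by apply: (big_morph g (scal_add S) scal0). Qed.

Lemma scal_mon e : (forall i, 0 <= e i) -> g (mon (vx s) e) = iota (mon c e) * mon (vx s) e.
Proof.
move=> e0; rewrite /mon rmorph_prod -big_split (big_morph g (scal_mul S) scal1).
apply: eq_bigr => i _; have := e0 i; case: (e i) => // n _.
by rewrite -!exprnP scal_exp (scal_var S) exprMn rmorphXn.
Qed.

End Scal.

Definition cmut s k c : 'I_N -> C :=
  fun i => if i == k then (c k)^-1 * mon c (fun l => zpos (vB s l k)) else c i.

Lemma torus_pos c (e : 'I_N -> int) : (forall i, c i != 0) -> mon c e = 1 ->
  mon c (fun l => zpos (- e l)) = mon c (fun l => zpos (e l)).
Proof.
move=> c0 h; rewrite -[LHS]mul1r -h -monD //; apply: eq_mon => i.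
by have := zposB (e i); lia.
Qed.

Lemma scaling_mu s k c g : gseed iota s -> scaling s c g -> (forall i, c i != 0) ->
  mon c (fun i => vB s i k) = 1 -> scaling (mu k s) (cmut s k c) g.
Proof.
move=> gs S c0 col; split; [exact: scal_const S|exact: scal_add S|exact: scal_mul S|].
move=> i; rewrite /cmut; have [->|ik] := eqVneq i k; last first.
  by rewrite mu_vxN // (scal_var S).
rewrite mu_vx (scal_mul S) (scal_inv S) ?(gseed_neq0 k gs) // (scal_add S) (scal_var S).
rewrite !(scal_mon S) => [|l|l]; try exact: zpos_ge0.
rewrite torus_pos // -/(ppos s k) -/(pneg s k) rmorphM fmorphV invfM; ring.
Qed.

(** With P the common weight of the exchange monomials at k, the mutation multiplies the weight of
    column j away from k by P to the power B_kj; the new weight P/c_k at k, with exponent -B_kj,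
    compensates this. *)
Lemma torus_mu M s k c : gseed iota s -> k \in M -> torus M s c ->
  torus M (mu k s) (cmut s k c).
Proof.
move=> [_ sk] kM [c0 cf col]; have Bkk : vB s k k = 0 by exact: skew_diag.
have P0 : mon c (fun l => zpos (vB s l k)) != 0 by apply: mon_neq0 => i _.
split.
- by move=> i; rewrite /cmut; case: ifP => _ //; rewrite mulf_neq0 ?invr_eq0.
- by move=> i iM; rewrite /cmut; case: eqP => [ik|_]; [rewrite ik kM in iM|exact: cf].
move=> j jM; set B' := fun i => vB (mu k s) i j.
rewrite (mon_split _ k) {1}/cmut eqxx.
have -> : mon (cmut s k c) (fun i => if i == k then 0 else B' i) =
    mon c (fun i => if i == k then 0 else B' i).
  by apply: eq_monx => i; rewrite /cmut; have [_|//] := eqVneq i k; rewrite eqxx.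
have [jk|jk] := eqVneq j k.
  rewrite jk in B' *; rewrite {1}/B' /= /bmut eqxx /= Bkk oppr0 expr0z mul1r.
  rewrite -[RHS]invr1 -(col k kM) -monN; apply: eq_mon => i.
  have [->|ik] := eqVneq i k; first by rewrite Bkk oppr0.
  by rewrite /B' /= /bmut eqxx orbT.
have -> : B' k = - vB s k j by rewrite /B' /= /bmut eqxx.
set P := mon c (fun l => zpos (vB s l k)) in P0 *.
have -> : mon c (fun i => if i == k then 0 else B' i) =
   (c k ^ vB s k j)^-1 * P ^ zpos (vB s k j) * (P ^ zpos (- vB s k j))^-1.
  have PE : P = mon c (fun l => zpos (- vB s l k)) by rewrite torus_pos // col.
  have -> : (c k ^ vB s k j)^-1 = mon c (fun i => if i == k then 0 else vB s i j).
    have ck : c k ^ vB s k j != 0 by rewrite expfz_neq0.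
    by apply: (mulfI ck); rewrite divff // -(col j jM) [LHS](mon_split _ k).
  rewrite {2}PE /P -!monM -monN -!monD //.
  apply: eq_mon => i; have [->|ik] := eqVneq i k.
    by rewrite Bkk oppr0 /zpos maxxx !mul0r oppr0 !addr0.
  by rewrite /B' /= /bmut (negbTE ik) (negbTE jk).
rewrite -invr_expz expfzMl exprz_inv -[c k ^ - _]invr_expz.
have ck0 : c k ^ vB s k j != 0 by rewrite expfz_neq0.
have -> : (P ^ vB s k j) = P ^ zpos (vB s k j) / P ^ zpos (- vB s k j).
  by rewrite -{1}(zposB (vB s k j)) expfzDr // invr_expz.
by field; rewrite ck0 !expfz_neq0.
Qed.

Lemma scaling_mus M s ks c g : gseed iota s -> all (fun k => k \in M) ks ->
  torus M s c -> scaling s c g ->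
  exists2 c', torus M (mus s ks) c' & scaling (mus s ks) c' g.
Proof.
elim: ks s c => [|k ks IH] s c gs /=; first by exists c.
case/andP=> kM h T S; apply: (IH _ (cmut s k c)) => //; first exact: mu_gseed.
- exact: torus_mu.
- by apply: scaling_mu => //; case: T => // _ _; exact.
Qed.

Lemma scaling_inA M E s c g a : gseed iota s -> torus M s c -> scaling s c g ->
  inA iota M E s a -> inA iota M E s (g a).
Proof.
move=> gs T S; elim=> [b|ks i h iE|i iM iE|u v _ hu _ hv|u v _ hu _ hv].
- by rewrite (scal_const S); exact: inA_const.
- have [c' T' S'] := scaling_mus gs h T S.
  by rewrite (scal_var S'); apply: inA_mul; [exact: inA_const|exact: inA_var].
- rewrite (scal_inv S) ?(gseed_neq0 i gs) // (scal_var S) (torus_frozen T) // rmorph1 mul1r.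
  exact: inA_inv.
- by rewrite (scal_add S); exact: inA_add.
- by rewrite (scal_mul S); exact: inA_mul.
Qed.

End Torus.
(** * Points, deep points and stabilizers *)

Notation alg iota M s := (inA iota M finset.set0 s).

Lemma mus_vxN (K : fieldType) N (s : sd K N) ks v : v \notin ks ->
  vx (mus s ks) v = vx s v.
Proof.
elim: ks s => //= k ks IH s; rewrite inE negb_or => /andP[vk /IH ->].
by rewrite mu_vxN.
Qed.

Lemma all_setD1 (T : finType) (M : {set T}) v ks : all (fun k => k \in M :\ v) ks ->
  all (fun k => k \in M) ks /\ v \notin ks.
Proof.
move=> h; split; first by apply: sub_all h => k; rewrite inE => /andP[].
by apply/negP => /(allP h); rewrite !inE eqxx.
Qed.

Section Points.
Variables (C : numFieldType) (K : fieldType) (iota : {rmorphism C -> K}) (N : nat).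
Implicit Types (s : sd K N) (M : {set 'I_N}) (phi : K -> C).

Definition upper M s (u : K) := forall ks, all (fun k => k \in M) ks ->
  laurent iota (mus s ks) u.

Definition is_upper M s := forall u, upper M s u -> alg iota M s u.

(** A function on the whole field, constrained only on the algebra: its type then survives both
    mutation and freezing. *)
Record point M s phi : Prop := Point {
  pt_const c : phi (iota c) = c;
  pt_add a b : alg iota M s a -> alg iota M s b -> phi (a + b) = phi a + phi b;
  pt_mul a b : alg iota M s a -> alg iota M s b -> phi (a * b) = phi a * phi b }.

Definition deep M s phi := forall ks, all (fun k => k \in M) ks ->
  exists2 i, i \in M & phi (vx (mus s ks) i) = 0.

Definition stabilized M s phi := exists c g,
  [/\ torus M s c, exists i, c i != 1, scaling iota s c g
    & forall a, alg iota M s a -> phi (g a) = phi a].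

Definition no_mystery M s := forall phi, point M s phi -> deep M s phi -> stabilized M s phi.

Lemma alg_upper M s a : gseed iota s -> alg iota M s a -> upper M s a.
Proof.
move=> gs ha ks h; apply: (@inA_laurent _ _ _ _ M finset.set0); first exact: mus_gseed.
exact/inA_mus.
Qed.

Lemma upper_mu M s k u : gseed iota s -> k \in M -> upper M s u <-> upper M (mu k s) u.
Proof.
move=> gs kM; split=> h ks hks; first by apply: (h (k :: ks)); rewrite /= kM.
by have := h (k :: ks); rewrite /= (muK k gs); apply; rewrite kM.
Qed.

Lemma is_upper_mu M s k : gseed iota s -> k \in M -> is_upper M s <-> is_upper M (mu k s).
Proof.
by move=> gs kM; split=> h u /(upper_mu u gs kM)/h/(inA_mu _ _ gs kM).
Qed.

Lemma point_mu M s k phi : gseed iota s -> k \in M -> point M s phi <-> point M (mu k s) phi.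
Proof.
move=> gs kM; have e a : alg iota M (mu k s) a <-> alg iota M s a by exact: inA_mu.
by split=> -[h1 h2 h3]; split=> // a b /e ha /e hb; [apply: h2|apply: h3|apply: h2|apply: h3].
Qed.

Lemma deep_mu M s k phi : gseed iota s -> k \in M -> deep M s phi <-> deep M (mu k s) phi.
Proof.
move=> gs kM; split=> h ks hks; first by apply: (h (k :: ks)); rewrite /= kM.
by have := h (k :: ks); rewrite /= (muK k gs); apply; rewrite kM.
Qed.

Lemma stabilized_mu1 M s k phi : gseed iota s -> k \in M ->
  stabilized M s phi -> stabilized M (mu k s) phi.
Proof.
move=> gs kM [c [g [T [i ci] S h]]]; have [c0 _ col] := T.
exists (cmut s k c), g; split.
- exact: (torus_mu gs).
- have [ik|ik] := eqVneq i k; last by exists i; rewrite /cmut (negbTE ik).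
  have [[l lk]|nex] := pselect (exists l, l != k /\ c l != 1).
    by exists l; rewrite /cmut (negbTE (proj1 lk)); case: lk.
  (* If k is the only vertex with nontrivial weight, the exchange monomials at k have weight 1 and
     the new weight is the inverse of c_k. *)
  exists k; rewrite /cmut eqxx /mon big1 ?mulr1 => [|l _].
    by rewrite invr_eq1 -ik.
  have [lk|lk] := eqVneq (c l) 1; first by rewrite lk exp1rz.
  have [->|lk'] := eqVneq l k; first by rewrite skew_diag ?zpos_0 ?expr0z //; case: gs.
  by case: nex; exists l.
- by apply: scaling_mu => //; exact: col.
- by move=> a /(inA_mu _ _ gs kM); exact: h.
Qed.

Lemma stabilized_mu M s k phi : gseed iota s -> k \in M ->
  stabilized M s phi <-> stabilized M (mu k s) phi.
Proof.
move=> gs kM; split; first exact: stabilized_mu1.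
move=> h; rewrite -(muK k gs); apply: stabilized_mu1 => //; exact: mu_gseed.
Qed.

Lemma no_mystery_mu M s k : gseed iota s -> k \in M -> no_mystery M s <-> no_mystery M (mu k s).
Proof.
move=> gs kM; split=> h phi.
  move=> /(point_mu phi gs kM) hp /(deep_mu phi gs kM) hd.
  by apply/(stabilized_mu phi gs kM); exact: h.
move=> /(point_mu phi gs kM) hp /(deep_mu phi gs kM) hd.
by apply/(stabilized_mu phi gs kM); exact: h.
Qed.

Lemma no_mystery_mus M s ks : gseed iota s -> all (fun k => k \in M) ks ->
  no_mystery M s <-> no_mystery M (mus s ks).
Proof.
elim: ks s => [|k ks IH] s gs //= /andP[kM h].
by rewrite -IH //; [exact: no_mystery_mu|exact: mu_gseed].
Qed.

Lemma point_mus M s ks phi : gseed iota s -> all (fun k => k \in M) ks ->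
  point M s phi <-> point M (mus s ks) phi.
Proof.
elim: ks s => [|k ks IH] s gs //= /andP[kM h].
by rewrite -IH //; [exact: point_mu|exact: mu_gseed].
Qed.

Lemma deep_mus M s ks phi : gseed iota s -> all (fun k => k \in M) ks ->
  deep M s phi <-> deep M (mus s ks) phi.
Proof.
elim: ks s => [|k ks IH] s gs //= /andP[kM h].
by rewrite -IH //; [exact: deep_mu|exact: mu_gseed].
Qed.

Section PointTheory.
Variables (M : {set 'I_N}) (s : sd K N) (phi : K -> C).
Hypothesis P : point M s phi.

Lemma pt1 : phi 1 = 1. Proof. by rewrite -(rmorph1 iota) (pt_const P). Qed.

Lemma pt_exp a n : alg iota M s a -> phi (a ^+ n) = phi a ^+ n.
Proof.
move=> ha; elim: n => [|n IH]; first by rewrite !expr0 pt1.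
by rewrite !exprS (pt_mul P) ?IH //; exact: inA_exp.
Qed.

Lemma pt_mon ks e : all (fun k => k \in M) ks -> (forall i, 0 <= e i) ->
  phi (mon (vx (mus s ks)) e) = mon (fun i => phi (vx (mus s ks) i)) e.
Proof.
move=> h e0; rewrite /mon.
suff [_ ->] : alg iota M s (\prod_i vx (mus s ks) i ^ e i) /\
  phi (\prod_i vx (mus s ks) i ^ e i) = \prod_i phi (vx (mus s ks) i) ^ e i by [].
apply: (big_rec2 (fun a b => alg iota M s a /\ phi a = b)).
  by split; [exact: inA_1|exact: pt1].
move=> i y z _ [hz <-].
have hi : alg iota M s (vx (mus s ks) i) by apply: inA_var => //; rewrite inE.
have [hie <-] : alg iota M s (vx (mus s ks) i ^ e i) /\
    phi (vx (mus s ks) i ^ e i) = phi (vx (mus s ks) i) ^ e i.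
  have := e0 i; case: (e i) => // n _; rewrite -!exprnP pt_exp //.
  by split=> //; exact: inA_exp.
by rewrite (pt_mul P) //; split=> //; exact: inA_mul.
Qed.

Lemma pt_frozen i : gseed iota s -> i \notin M -> phi (vx s i) != 0.
Proof.
move=> gs iM; have h : phi (vx s i) * phi (vx s i)^-1 = 1.
  rewrite -(pt_mul P) ?divff ?pt1 ?(gseed_neq0 i gs) //.
    by apply: inA_x; rewrite inE.
  by apply: inA_inv; rewrite ?inE.
by apply: contra_eq_neq h => ->; rewrite mul0r eq_sym oner_neq0.
Qed.

Lemma pt_exch k : gseed iota s -> k \in M -> phi (vx s k) * phi (vx (mu k s) k) =
  mon (fun i => phi (vx s i)) (fun i => zpos (vB s i k)) +
  mon (fun i => phi (vx s i)) (fun i => zpos (- vB s i k)).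
Proof.
move=> gs kM.
have hm e : (forall i, 0 <= e i) -> alg iota M s (mon (vx s) e).
  by move=> e0; apply: inA_mon => i; right; rewrite inE; split=> //; left.
rewrite -(pt_mul P); last 2 first.
- by apply: inA_x; rewrite inE.
- by apply: (@inA_var _ _ _ _ M _ s [:: k]); rewrite /= ?kM ?inE.
rewrite mu_exch ?(gseed_neq0 k gs) // (pt_add P); last 2 first.
- by apply: hm => i; exact: zpos_ge0.
- by apply: hm => i; exact: zpos_ge0.
by rewrite /ppos /pneg !(pt_mon (ks := [::])) // => i; exact: zpos_ge0.
Qed.

(** The algebra with v frozen lies in the localization at x_v: the inverse of x_v is its only new
    generator. *)
Lemma freeze_clear v a : v \in M -> alg iota (M :\ v) s a -> exists n, alg iota M s (a * vx s v ^+ n).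
Proof.
move=> vM; have Lv : alg iota M s (vx s v) by apply: inA_x; rewrite inE.
elim=> [c|ks i h _|i iM _|b c _ [n hn] _ [m hm]|b c _ [n hn] _ [m hm]].
- by exists 0%N; rewrite mulr1; exact: inA_const.
- exists 0%N; rewrite mulr1; apply: inA_var; rewrite ?inE //.
  by apply: sub_all h => k; rewrite inE => /andP[].
- have [iM'|iM'] := boolP (i \in M); last by exists 0%N; rewrite mulr1; apply: inA_inv; rewrite ?inE.
  have -> : i = v by move: iM; rewrite !inE iM' andbT negbK => /eqP.
  have [v0|v0] := eqVneq (vx s v) 0.
    by exists 0%N; rewrite v0 invr0 mul0r; exact: inA_0.
  by exists 1%N; rewrite expr1 mulVf //; exact: inA_1.
- exists (n + m)%N; have -> : (b + c) * vx s v ^+ (n + m) =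
    b * vx s v ^+ n * vx s v ^+ m + c * vx s v ^+ m * vx s v ^+ n by rewrite exprD; ring.
  by apply: inA_add; apply: inA_mul => //; exact: inA_exp.
- exists (n + m)%N; have -> : b * c * vx s v ^+ (n + m) =
    b * vx s v ^+ n * (c * vx s v ^+ m) by rewrite exprD; ring.
  exact: inA_mul.
Qed.

(** The extension to the localization divides by powers of phi(x_v); the value does not depend on
    the power chosen to clear denominators. *)
Lemma freeze_point v : v \in M -> phi (vx s v) != 0 ->
  exists2 psi, point (M :\ v) s psi & forall a, alg iota M s a -> psi a = phi a.
Proof.
move=> vM v0; have Lv : alg iota M s (vx s v) by apply: inA_x; rewrite inE.
pose psi a := match pselect (exists n, alg iota M s (a * vx s v ^+ n)) with
  | left h => phi (a * vx s v ^+ projT1 (cid h)) / phi (vx s v) ^+ projT1 (cid h)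
  | right _ => 0 end.
have psiE a n : alg iota M s (a * vx s v ^+ n) ->
    psi a = phi (a * vx s v ^+ n) / phi (vx s v) ^+ n.
  move=> hn; rewrite /psi; case: pselect => [h|[]]; last by exists n.
  case: (cid h) => m hm /=; apply/eqP; rewrite eqr_div ?expf_neq0 //; apply/eqP.
  rewrite -!pt_exp // -!(pt_mul P) //; try exact: inA_exp.
  by rewrite -!mulrA -!exprD addnC.
exists psi; first split.
- move=> c; rewrite (@psiE _ 0%N) ?mulr1 ?divr1 ?(pt_const P) //; exact: inA_const.
- move=> a b /(freeze_clear vM)[n hn] /(freeze_clear vM)[m hm].
  have e : (a + b) * vx s v ^+ (n + m) =
    a * vx s v ^+ n * vx s v ^+ m + b * vx s v ^+ m * vx s v ^+ n by rewrite exprD; ring.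
  have h1 : alg iota M s (a * vx s v ^+ n * vx s v ^+ m) by apply: inA_mul => //; exact: inA_exp.
  have h2 : alg iota M s (b * vx s v ^+ m * vx s v ^+ n) by apply: inA_mul => //; exact: inA_exp.
  rewrite (psiE _ _ hn) (psiE _ _ hm) (@psiE _ (n + m)%N) e; last exact: inA_add.
  rewrite (pt_add P) // (pt_mul P hn) ?(pt_mul P hm) ?pt_exp //; try exact: inA_exp.
  by rewrite exprD; field; rewrite !expf_neq0.
- move=> a b /(freeze_clear vM)[n hn] /(freeze_clear vM)[m hm].
  have e : a * b * vx s v ^+ (n + m) = a * vx s v ^+ n * (b * vx s v ^+ m) by rewrite exprD; ring.
  rewrite (psiE _ _ hn) (psiE _ _ hm) (@psiE _ (n + m)%N) e; last exact: inA_mul.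
  by rewrite (pt_mul P hn hm) exprD; field; rewrite !expf_neq0.
- by move=> a ha; rewrite (@psiE _ 0%N) ?mulr1 ?divr1.
Qed.

Lemma alg_freeze v a : gseed iota s -> is_upper (M :\ v) s ->
  alg iota M s a -> alg iota (M :\ v) s a.
Proof.
move=> gs AU ha; apply: AU => ks h; apply: (alg_upper gs ha).
by apply: sub_all h => k; rewrite inE => /andP[].
Qed.

(** The torus element found with v frozen lacks only the condition on column v. The neighbours of v
    do not vanish at the point, which the element fixes, so they have weight 1 and the condition
    holds. *)
Lemma freeze_stabilized v : gseed iota s -> v \in M -> is_upper (M :\ v) s ->
  no_mystery (M :\ v) s -> deep M s phi -> phi (vx s v) != 0 ->
  (forall i, i \in M -> vB s i v != 0 -> phi (vx s i) != 0) -> stabilized M s phi.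
Proof.
move=> gs vM AU G dp v0 nb.
have [psi Ppsi psiE] := freeze_point vM v0.
have xA ks i : all (fun k => k \in M) ks -> alg iota M s (vx (mus s ks) i).
  by move=> h; apply: inA_var => //; rewrite inE.
have [|c [g [T [i ci] S h]]] := G psi Ppsi.
  move=> ks h; have hM : all (fun k => k \in M) ks.
    by apply: sub_all h => k; rewrite inE => /andP[].
  have [i iM i0] := dp ks hM; exists i; last by rewrite psiE //; exact: xA.
  rewrite !inE iM andbT; apply: contra_eq_neq i0 => ->.
  by rewrite mus_vxN //; case/all_setD1: h.
have [c0 cf col] := T.
have TM : torus M s c.
  split=> //; first by move=> j jM; apply: cf; rewrite inE (negbTE jM) andbF.
  move=> j jM; have [->|jv] := eqVneq j v; last by apply: col; rewrite !inE jv.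
  rewrite /mon big1 // => l _; have [->|Bl] := eqVneq (vB s l v) 0; first by rewrite expr0z.
  have [lM|lM] := boolP (l \in M); last first.
    by rewrite cf ?exp1rz // inE (negbTE lM) andbF.
  have := h (vx s l) ltac:(by apply: inA_x; rewrite inE).
  have xl := xA [::] l isT; rewrite (scal_var S) (psiE (vx s l)) // (psiE (_ * _)); last first.
    by apply: inA_mul => //; exact: inA_const.
  rewrite (pt_mul P) ?(pt_const P) //; last exact: inA_const.
  by rewrite -[RHS]mul1r => /(mulIf (nb l lM Bl)) ->; rewrite exp1rz.
exists c, g; split=> //; first by exists i.
move=> a ha; rewrite -!psiE //; last exact: (scaling_inA gs TM S ha).
by apply: h; exact: alg_freeze.
Qed.

End PointTheory.
End Points.
(** * Isolated vertices *)

Lemma poly_eq0_scalars (C : numFieldType) (K : fieldType) (iota : {rmorphism C -> K})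
    (p : {poly K}) : (forall a : C, a != 0 -> p.[iota a] = 0) -> p = 0.
Proof.
move=> h; apply/eqP; apply: contraT => p0.
pose rs := [seq iota (i.+1)%:R | i <- seq.iota 0 (size p)].
have : (size rs < size p)%N.
  apply: max_poly_roots => //.
    by apply/allP => _ /mapP[i _ ->]; apply/rootP/h; rewrite pnatr_eq0.
  rewrite map_inj_uniq ?iota_uniq // => i j /fmorph_inj /eqP.
  by rewrite eqr_nat => /eqP[].
by rewrite size_map size_iota ltnn.
Qed.

(** Truncation in degree below d, used to compare the parts of low degree of two homogeneous
    expansions. *)
Lemma sum_coef_monomials (R : nzRingType) (I : finType) (A : I -> R) (e : I -> nat) d :
  \sum_(l < d) (\sum_i A i *: 'X^(e i))`_l = \sum_(i | (e i < d)%N) A i.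
Proof.
under eq_bigr => l _ do rewrite coef_sum.
rewrite exchange_big [RHS]big_mkcond /=; apply: eq_bigr => i _.
case: ifP => hi.
  rewrite (bigD1 (Ordinal hi)) //= coefZ coefXn eqxx mulr1 big1 ?addr0 // => l.
  by rewrite -val_eqE coefZ coefXn /= => /negbTE ->; rewrite mulr0.
rewrite big1 // => l _; rewrite coefZ coefXn; case: eqP => [le|]; last by rewrite mulr0.
by move: (ltn_ord l); rewrite le hi.
Qed.

Section Isolated.
Variables (C : numFieldType) (K : fieldType) (iota : {rmorphism C -> K}) (N : nat).
Variables (s : sd K N) (M : {set 'I_N}) (l : 'I_N).
Hypotheses (gs : gseed iota s) (lM : l \in M) (iso : forall j, j \in M -> vB s j l = 0).

Local Notation M1 := (M :\ l).
Local Notation A0 := (inA iota M1 [set l]%SET).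

Lemma row_isolated j : j \in M -> vB s l j = 0.
Proof. by case: gs => _ sk jM; rewrite sk iso ?oppr0. Qed.

(** Row [l] vanishes on the mutable columns, so mutations away from [l] never involve its variable.
    This compares [s] with its mutation at [l], and with itself. *)
Record agree (s1 s2 : sd K N) : Prop := Agree {
  agree_vx i : i != l -> vx s1 i = vx s2 i;
  agree_vB i j : j \in M1 -> vB s1 i j = vB s2 i j;
  agree_row j : j \in M1 -> vB s1 l j = 0 }.

Lemma agree_mu s1 s2 k : k \in M1 -> agree s1 s2 -> agree (mu k s1) (mu k s2).
Proof.
move=> kM [h1 h2 h3]; have kl : k != l by move: kM; rewrite !inE => /andP[].
have e1 (f : int -> int) : f 0 = 0 ->
    mon (vx s1) (fun i => f (vB s1 i k)) = mon (vx s2) (fun i => f (vB s2 i k)).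
  move=> f0; apply: etrans (eq_monx _) (eq_mon _ _) => i; last by rewrite h2.
  by have [->|/h1 //] := eqVneq i l; rewrite h3 // f0 eqxx.
split.
- move=> i il; have [->|ik] := eqVneq i k; last by rewrite !mu_vxN ?h1.
  rewrite !mu_vx h1 // /ppos /pneg (e1 zpos) ?(e1 (fun a => zpos (- a))) //.
- by move=> i j jM; rewrite /= /bmut !h2.
- move=> j jM; rewrite /= /bmut; case: ifP => _; first by rewrite h3 ?oppr0.
  by rewrite !h3 // oppr0 /zpos maxxx !mul0r subr0 addr0.
Qed.

Lemma agree_mus s1 s2 ks : all (fun k => k \in M1) ks -> agree s1 s2 ->
  agree (mus s1 ks) (mus s2 ks).
Proof.
elim: ks s1 s2 => //= k ks IH s1 s2 /andP[kM h] ag.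
by apply: IH => //; exact: agree_mu.
Qed.

Lemma agree_refl : agree s s.
Proof.
by split=> // j; rewrite inE => /andP[_ jM]; exact: row_isolated.
Qed.

Lemma agree_flip : agree (mu l s) s.
Proof.
split=> [i il|i j|j]; first by rewrite mu_vxN.
  rewrite inE => /andP[jl jM]; rewrite /= /bmut; rewrite inE in jl; rewrite (negbTE jl) orbF.
  have rj := row_isolated jM; case: eqP => [->|_]; first by rewrite rj oppr0.
  by rewrite rj oppr0 /zpos maxxx !mulr0 subr0 addr0.
by rewrite inE => /andP[_ jM]; rewrite /= /bmut eqxx row_isolated ?oppr0.
Qed.

Lemma A0_flip a : A0 (mu l s) a -> A0 s a.
Proof.
elim=> [c|ks i h il|i iM il|u v _ hu _ hv|u v _ hu _ hv].
- exact: inA_const.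
- have [ag _ _] := agree_mus h agree_flip; rewrite ag; last by move: il; rewrite inE.
  exact: inA_var.
- by rewrite mu_vxN; [exact: inA_inv|move: il; rewrite inE].
- exact: inA_add.
- exact: inA_mul.
Qed.

Lemma A0_alg a : A0 s a -> alg iota M s a.
Proof.
elim=> [c|ks i h il|i iM il|u v _ hu _ hv|u v _ hu _ hv].
- exact: inA_const.
- by apply: inA_var; rewrite ?inE //; case/all_setD1: h.
- by apply: inA_inv; move: iM il; rewrite !inE // => h1 h2; rewrite h2 in h1.
- exact: inA_add.
- exact: inA_mul.
Qed.

Definition cdelta (a : C) : 'I_N -> C := fun i => if i == l then a else 1.

Lemma scaling_delta g a : a != 0 -> scaling iota s (cdelta a) g ->
  [/\ torus M s (cdelta a), forall b, A0 s b -> g b = b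
    & forall ks, all (fun k => k \in M1) ks -> scaling iota (mus s ks) (cdelta a) g].
Proof.
move=> a0 S; have c0 i : cdelta a i != 0 by rewrite /cdelta; case: ifP; rewrite ?oner_neq0.
have mon1 (e : 'I_N -> int) : e l = 0 -> mon (cdelta a) e = 1.
  move=> el; rewrite /mon big1 // => i _; rewrite /cdelta; case: eqP => [->|_].
    by rewrite el expr0z.
  by rewrite exp1rz.
have SS ks : all (fun k => k \in M1) ks -> scaling iota (mus s ks) (cdelta a) g.
  elim/last_ind: ks => [|ks k IH] //; rewrite all_rcons => /andP[kM h].
  have [_ _ hrow] := agree_mus h agree_refl.
  rewrite mus_rcons; have := scaling_mu (mus_gseed ks gs) (IH h) c0 (mon1 _ (hrow k kM)).
  case=> h1 h2 h3 h4; split=> // i; rewrite h4; congr (iota _ * _).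
  rewrite /cmut mon1 ?hrow /zpos ?maxxx //; case: eqP => // ->.
  by rewrite /cdelta; move: kM; rewrite !inE => /andP[/negbTE ->]; rewrite invr1 mulr1.
split=> //.
  split=> //; first by move=> i iM; rewrite /cdelta; case: eqP => // il; rewrite il lM in iM.
  by move=> j jM; apply: mon1; exact: row_isolated.
move=> b; elim=> [c|ks i h il|i iM il|u v _ hu _ hv|u v _ hu _ hv].
- exact: scal_const S _.
- rewrite (scal_var (SS ks h)) /cdelta; move: il; rewrite inE => /negbTE ->.
  by rewrite rmorph1 mul1r.
- rewrite (scal_inv S) ?(gseed_neq0 i gs) // (scal_var S) /cdelta.
  by move: il; rewrite inE => /negbTE ->; rewrite rmorph1 mul1r.
- by rewrite (scal_add S) hu hv.
- by rewrite (scal_mul S) hu hv.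
Qed.

End Isolated.

(** Once [l] is frozen, its variable enters the generators only as x_l and its inverse; clearing the
    inverses leaves a polynomial in x_l over the algebra generated by the others. *)
Lemma alg_poly (C : numFieldType) (K : fieldType) (iota : {rmorphism C -> K}) (N : nat)
    (s : sd K N) (M : {set 'I_N}) (l : 'I_N) a :
  gseed iota s -> alg iota (M :\ l) s a ->
  exists n (p : {poly K}), (forall i, inA iota (M :\ l) [set l]%SET s p`_i) /\
    a * vx s l ^+ n = p.[vx s l].
Proof.
move=> gs; set A := inA _ _ [set l]%SET s.
have Ac u : A u -> forall i, A (u%:P)`_i.
  by move=> hu i; rewrite coefC; case: ifP => _ //; exact: inA_0.
have Am (p q : {poly K}) : (forall i, A p`_i) -> (forall i, A q`_i) -> forall i, A (p * q)`_i.
  by move=> hp hq i; rewrite coefM; apply: inA_sum => j _; apply: inA_mul; [exact: hp|exact: hq].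
have Aa (p q : {poly K}) : (forall i, A p`_i) -> (forall i, A q`_i) -> forall i, A (p + q)`_i.
  by move=> hp hq i; rewrite coefD; apply: inA_add; [exact: hp|exact: hq].
have AX n i : A (('X^n : {poly K})`_i).
  by rewrite coefXn; case: eqP => _; [exact: inA_1|exact: inA_0].
elim=> [c|ks i h _|i iM _|u v _ [n [p [hp ep]]] _ [m [q [hq eq]]]
       |u v _ [n [p [hp ep]]] _ [m [q [hq eq]]]].
- exists 0%N, (iota c)%:P; rewrite hornerC mulr1; split=> //; apply: Ac; exact: inA_const.
- exists 0%N; have [il|il] := eqVneq i l.
    exists 'X; rewrite hornerX mulr1 il mus_vxN; last by case/all_setD1: h.
    by split=> // j; exact: (AX 1%N).
  exists (vx (mus s ks) i)%:P; rewrite hornerC mulr1; split=> //; apply: Ac.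
  by apply: inA_var => //; rewrite inE.
- have [->|il] := eqVneq i l.
    exists 1%N, 1; rewrite hornerE mulVf ?(gseed_neq0 l gs) //; split=> // j.
    exact: (AX 0%N).
  exists 0%N, ((vx s i)^-1)%:P; rewrite hornerC mulr1; split=> //; apply: Ac.
  by apply: inA_inv => //; rewrite inE.
- exists (n + m)%N, (p * 'X^m + q * 'X^n); split; first by apply: (Aa); apply: (Am).
  by rewrite !hornerE -ep -eq exprD; ring.
- exists (n + m)%N, (p * q); split; first exact: Am.
  by rewrite hornerM -ep -eq exprD; ring.
Qed.
Section IsolatedSplitting.
Variables (C : numFieldType) (K : fieldType) (iota : {rmorphism C -> K}) (N : nat).
Variables (s : sd K N) (M : {set 'I_N}) (l : 'I_N).
Hypotheses (gs : gseed iota s) (lM : l \in M) (iso : forall j, j \in M -> vB s j l = 0).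
Hypotheses (AU : is_upper iota (M :\ l) s) (AU' : is_upper iota (M :\ l) (mu l s)).

Local Notation A0 := (inA iota (M :\ l) [set l]%SET s).

(* Expand u in powers of x_l and in powers of x_l'; rescaling x_l shows that
   the homogeneous components of the two expansions agree. *)
Lemma isolated_ind (Q : K -> Prop) u : upper iota M s u ->
  (forall a, A0 a -> Q a) -> Q (vx s l) -> Q (vx (mu l s) l) ->
  (forall a b, Q a -> Q b -> Q (a + b)) -> (forall a b, Q a -> Q b -> Q (a * b)) -> Q u.
Proof.
move=> Uu Q0 Qx Qx' Qa Qm; set x := vx s l in Qx *; set x' := vx (mu l s) l in Qx' *.
have gs' : gseed iota (mu l s) by exact: mu_gseed.
have x0 : x != 0 by exact: (gseed_neq0 l gs).
have x'0 : x' != 0 by exact: (gseed_neq0 l gs').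
have U1 : upper iota (M :\ l) s u by move=> ks /all_setD1[h _]; exact: Uu.
have U1' : upper iota (M :\ l) (mu l s) u.
  by move=> ks /all_setD1[h _]; exact: (proj1 (upper_mu u gs lM) Uu).
have [n0 [p0 [hp0 ep0]]] := alg_poly gs (AU U1).
have [n1 [p1 [hp1 ep1]]] := alg_poly gs' (AU' U1').
rewrite -/x in ep0; rewrite -/x' in ep1.
pose n := (n0 + n1)%N; pose p := p0 * 'X^n1; pose q := p1 * 'X^n0.
have ep : u * x ^+ n = p.[x] by rewrite hornerM hornerXn -ep0 exprD mulrA.
have eq : u * x' ^+ n = q.[x'] by rewrite hornerM hornerXn -ep1 exprD; ring.
have hp i : A0 p`_i.
  by rewrite /p coefMXn; case: ifP => _; [exact: inA_0|exact: hp0].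
have hq i : A0 q`_i.
  rewrite /q coefMXn; case: ifP => _; [exact: inA_0|].
  exact: (A0_flip gs iso (hp1 _)).
clearbody n p q => {n0 p0 hp0 ep0 n1 p1 hp1 ep1}.
pose m := maxn (maxn (size p) (size q)) n.
have pm : (size p <= m)%N by rewrite /m !leq_max leqnn.
have qm : (size q <= m)%N by rewrite /m !leq_max leqnn orbT.
have nm : (n <= m)%N by rewrite /m !leq_max leqnn orbT.
pose A (i : 'I_m) := p`_i * x ^+ i / x ^+ n.
pose B (i : 'I_m) := q`_i * x' ^+ i / x' ^+ n.
have uA : u = \sum_i A i.
  rewrite /A -mulr_suml -(horner_coef_wide x pm) -ep; field; exact: expf_neq0.
(* Scaling x_l by a multiplies [A i] by a^(i - n) and [B i] by a^(n - i); the common shift by m + n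
   makes all exponents natural numbers. *)
pose FA := \sum_i A i *: 'X^(i + m); pose FB := \sum_i B i *: 'X^(n + n + m - i).
have FAB : FA = FB.
  apply/eqP; rewrite -subr_eq0; apply/eqP/(@poly_eq0_scalars _ _ iota) => a a0.
  have c0 i : cdelta l a i != 0 by rewrite /cdelta; case: ifP; rewrite ?oner_neq0.
  have [g S] := scaling_exists gs c0.
  have [T gA0 _] := scaling_delta gs lM iso a0 S.
  have gx : g x = iota a * x by rewrite (scal_var S) /cdelta eqxx.
  have gx' : g x' = (iota a)^-1 * x'.
    have := scaling_mu gs S c0 (torus_col T lM) => S'.
    rewrite (scal_var S') /cmut eqxx /cdelta eqxx -fmorphV; congr (iota _ * _).
    rewrite /mon big1 ?mulr1 // => i _; case: eqP => [->|_]; last by rewrite exp1rz.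
    by rewrite skew_diag ?/zpos ?maxxx //; case: gs.
  have ia0 : iota a != 0 by rewrite fmorph_eq0.
  have e1 : g u * (iota a ^+ (m + n)) = FA.[iota a].
    rewrite uA (scal_sum S) mulr_suml horner_sum; apply: eq_bigr => i _.
    rewrite hornerZ hornerXn /A (scal_mul S) (scal_mul S) gA0 //.
    rewrite (scal_inv S) ?expf_neq0 // !(scal_exp S) gx !exprMn !exprD.
    by field; rewrite !expf_neq0.
  have e2 : g u * (iota a ^+ (m + n)) = FB.[iota a].
    have -> : u = \sum_i B i.
      rewrite /B -mulr_suml -(horner_coef_wide x' qm) -eq; field; exact: expf_neq0.
    rewrite (scal_sum S) mulr_suml horner_sum; apply: eq_bigr => i _.
    rewrite hornerZ hornerXn /B (scal_mul S) (scal_mul S) gA0 //.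
    rewrite (scal_inv S) ?expf_neq0 // !(scal_exp S) gx' !exprMn.
    have -> : iota a ^+ (n + n + m - i) = iota a ^+ n * iota a ^+ n * iota a ^+ m / iota a ^+ i.
      rewrite -!exprD -expfB_cond ?(negbTE ia0) //; have := ltn_ord i; lia.
    rewrite exprD !exprVn; field.
    by rewrite !expf_neq0.
  by rewrite hornerD hornerN -e1 -e2 subrr.
have := congr1 (fun P : {poly K} => \sum_(d < n + m) P`_d) FAB.
rewrite !sum_coef_monomials => eAB.
have Qs (P : pred 'I_m) F : (forall i, P i -> Q (F i)) -> Q (\sum_(i | P i) F i).
  move=> h; apply: (big_ind Q) => //.
  by rewrite -(rmorph0 iota); apply: Q0; exact: inA_const.
have Qe a d : Q a -> Q (a ^+ d).
  move=> ha; elim: d => [|d IH]; last by rewrite exprS; exact: Qm.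
  by rewrite expr0 -(rmorph1 iota); apply: Q0; exact: inA_const.
have expB (y : K) (i : nat) : y != 0 -> (n <= i)%N -> y ^+ i / y ^+ n = y ^+ (i - n).
  by move=> y0 h; rewrite -expfB_cond ?(negbTE y0).
(* The terms of negative degree in x_l are traded for the equal sum of the terms of positive degree
   in x_l', which leaves no denominators. *)
rewrite uA (bigID (fun i : 'I_m => (i + m < n + m)%N)) /= eAB; apply: (Qa).
  apply: Qs => i hi; rewrite /B -mulrA expB //; last by lia.
  by apply: (Qm); [exact: Q0|exact: Qe].
apply: Qs => i hi; rewrite /A -mulrA expB //; last by lia.
by apply: (Qm); [exact: Q0|exact: Qe].
Qed.

Lemma isolated_is_upper : is_upper iota M s.
Proof.
move=> u Uu; apply: (isolated_ind Uu).
- by move=> a; exact: A0_alg.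
- by apply: inA_x; rewrite inE.
- by apply: (@inA_var _ _ _ _ _ _ s [:: l]); rewrite /= ?lM ?inE.
- by move=> *; exact: inA_add.
- by move=> *; exact: inA_mul.
Qed.

(** If x_l or x_l' is nonzero at the point, [l] is frozen in the corresponding seed. Otherwise
    scaling x_l by 2 fixes the point, because the algebra is generated by x_l, x_l' and elements
    that the scaling fixes. *)
Lemma isolated_no_mystery : no_mystery iota (M :\ l) s ->
  no_mystery iota (M :\ l) (mu l s) -> no_mystery iota M s.
Proof.
move=> G G' phi P dp; have gs' : gseed iota (mu l s) by exact: mu_gseed.
have [v0|v0] := eqVneq (phi (vx s l)) 0; last first.
  by apply: (freeze_stabilized P gs lM AU G dp v0) => i iM; rewrite iso ?eqxx.
have [w0|w0] := eqVneq (phi (vx (mu l s) l)) 0; last first.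
  apply/(stabilized_mu phi gs lM); move/(point_mu phi gs lM): P => P'.
  move/(deep_mu phi gs lM): dp => dp'.
  apply: (freeze_stabilized P' gs' lM AU' G' dp' w0) => i iM.
  by rewrite /= /bmut eqxx orbT oppr_eq0 iso ?eqxx.
have two0 : 2%:R != 0 :> C by rewrite pnatr_eq0.
have c0 i : cdelta l (2%:R : C) i != 0 by rewrite /cdelta; case: ifP; rewrite ?oner_neq0.
have [g S] := scaling_exists gs c0.
have [T gA0 _] := scaling_delta gs lM iso two0 S.
exists (cdelta l 2%:R), g; split=> //.
  by exists l; rewrite /cdelta eqxx -subr_eq0 mulr2n addrK oner_neq0.
move=> a ha; have Ua := alg_upper gs ha.
have S' := scaling_mu gs S c0 (torus_col T lM).
have x'A : alg iota M s (vx (mu l s) l).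
  by apply: (@inA_var _ _ _ _ _ _ s [:: l]); rewrite /= ?lM ?inE.
suff [] : alg iota M s a /\ phi (g a) = phi a by [].
apply: (isolated_ind (Q := fun b => alg iota M s b /\ phi (g b) = phi b) Ua).
- by move=> b hb; split; [exact: A0_alg hb|rewrite gA0].
- have xA : alg iota M s (vx s l) by apply: inA_x; rewrite inE.
  split=> //; rewrite (scal_var S) (pt_mul P) ?v0 ?mulr0 //; exact: inA_const.
- split=> //; rewrite (scal_var S') (pt_mul P) ?w0 ?mulr0 //; exact: inA_const.
- move=> b d [hb eb] [hd ed]; split; first exact: inA_add.
  by rewrite (scal_add S) !(pt_add P) ?eb ?ed //; exact: (scaling_inA gs T S).
- move=> b d [hb eb] [hd ed]; split; first exact: inA_mul.
  by rewrite (scal_mul S) !(pt_mul P) ?eb ?ed //; exact: (scaling_inA gs T S).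
Qed.

End IsolatedSplitting.
(** * Leaves *)

(** An exchange binomial at a vertex joined to [v] by a single arrow is affine in x_v; [f] and [h]
    are the exponents of slope and constant term, both supported on the other neighbours. *)
Lemma exch_split (F : fieldType) (N : nat) (x : 'I_N -> F) (e : 'I_N -> int) v :
  e v = 1 \/ e v = -1 -> exists f h : 'I_N -> int,
  [/\ forall i, 0 <= f i /\ 0 <= h i, f v = 0 /\ h v = 0,
      forall i, e i = 0 -> f i = 0 /\ h i = 0 &
      mon x (fun i => zpos (e i)) + mon x (fun i => zpos (- e i)) = x v * mon x f + mon x h].
Proof.
have z0 : zpos 0 = 0 by rewrite /zpos maxxx.
have zz a : 0 <= (if a is true then 0 else 0 : int) by case: a.
case=> ev.
  exists (fun i => if i == v then 0 else zpos (e i)), (fun i => zpos (- e i)); split.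
  - by move=> i; split; [case: ifP => // _|]; exact: zpos_ge0.
  - by rewrite eqxx ev.
  - by move=> i ->; rewrite oppr0 z0; case: ifP.
  - by rewrite (mon_split _ v) ev zpos_id.
exists (fun i => if i == v then 0 else zpos (- e i)), (fun i => zpos (e i)); split.
- by move=> i; split; [case: ifP => // _|]; exact: zpos_ge0.
- by rewrite eqxx ev.
- by move=> i ->; rewrite oppr0 z0; case: ifP.
- by rewrite addrC (mon_split _ v) ev zpos_id.
Qed.

(* In the pentagon of seeds obtained by mutating at [l] and [r], the variables
   at [r] in [mu r t] and at [l] in [mu l (mu r (mu l t))] agree up to frozen
   factors. *)
Lemma pentagon (C : numFieldType) (K : fieldType) (iota : {rmorphism C -> K}) (N : nat)
    (t : sd K N) (l r : 'I_N) :
  gseed iota t -> l != r -> vB t l r = 1 \/ vB t l r = -1 ->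
  exists f h : 'I_N -> int,
  [/\ forall i, 0 <= f i /\ 0 <= h i,
      forall i, f i != 0 \/ h i != 0 -> [/\ i != l, i != r & vB t i l != 0 \/ vB t i r != 0] &
      vx (mu l (mu r (mu l t))) l * mon (vx t) f = vx (mu r t) r * mon (vx t) h].
Proof.
have pos (s : sd K N) : gseed iota s -> l != r -> vB s l r = 1 -> exists f h : 'I_N -> int,
  [/\ forall i, 0 <= f i /\ 0 <= h i,
      forall i, f i != 0 \/ h i != 0 -> [/\ i != l, i != r & vB s i l != 0 \/ vB s i r != 0] &
      vx (mu l (mu r (mu l s))) l * mon (vx s) f = vx (mu r s) r * mon (vx s) h].
  move=> gs lr B1; have sk : skew (vB s) by case: gs.
  have x0 i : vx s i != 0 by exact: (gseed_neq0 i gs).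
  have z0 : zpos 0 = 0 by rewrite /zpos maxxx.
  pose f i := (if i == r then 0 else zpos (- vB s i l)) + (if i == l then 0 else zpos (vB s i r)).
  pose h i := if (i == l) || (i == r) then 0 else zpos (vB (mu r (mu l s)) i l).
  have hE i : i != l -> i != r ->
      vB (mu r (mu l s)) i l = - vB s i l + zpos (vB s i r + zpos (vB s i l)).
    move=> il ir; rewrite /= {1}/bmut (negbTE ir) (negbTE lr) /=.
    have -> : bmut l (vB s) r l = 1 by rewrite /bmut eqxx orbT sk B1 opprK.
    have -> : bmut l (vB s) i l = - vB s i l by rewrite /bmut eqxx orbT.
    have -> : bmut l (vB s) i r = vB s i r + zpos (vB s i l).
      rewrite /bmut (negbTE il) [r == l]eq_sym (negbTE lr) B1 /=.
      by rewrite (@zpos_id 1) // (@zpos_0 (- 1)) // mulr1 mulr0 subr0.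
    by rewrite (@zpos_id 1) // (@zpos_0 (- 1)) // mulr1 mulr0 subr0.
  exists f, h; split.
  - move=> i; rewrite /f /h; split; last by case: ifP => _ //; exact: zpos_ge0.
    by apply: addr_ge0; case: ifP => _ //; exact: zpos_ge0.
  - move=> i; rewrite /f /h; have [->|il] := eqVneq i l.
      by rewrite (negbTE lr) (skew_diag _ sk) oppr0 z0; case.
    have [->|ir] := eqVneq i r; first by rewrite (skew_diag _ sk) z0; case.
    rewrite [false || false]/= hE // => H; split=> //.
    have [e1|] := eqVneq (vB s i l) 0; last by left.
    have [e2|] := eqVneq (vB s i r) 0; last by right.
    by move: H; rewrite !(e1, e2, oppr0, z0, add0r) => -[].
  - have B1' : vB s l r = 1%N%:Z by rewrite B1.
    have g1 : gseed iota (mu l s) by exact: mu_gseed.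
    have a'0 : vx (mu l s) l != 0 by exact: (gseed_neq0 l g1).
    rewrite (twostep_a gs lr B1') !expr1 -/h [1 + _]addrC addrK [vx (mu l s) l * _]mulrC mulfK //.
    have := twostep_y gs lr B1' erefl.
    set yl := mon (vx s) _; set m := mon (vx s) _; set yr := mon (vx s) _ => ym.
    set H := mon (vx s) h.
    have F0 : pneg s l != 0 by apply: mon_neq0 => i _; exact: x0.
    have yr0 : yr != 0 by apply: mon_neq0 => i _; exact: x0.
    have rE : vx (mu r s) r = (vx s r)^-1 * pneg s r * (1 + yr).
      by rewrite mu_vx (exch_factor _ gs) mulrA.
    have -> : H * vx s l / pneg s l + H * yl * m = H * vx s l / pneg s l * (1 + yr^-1).
      have -> : H * yl * m = H * (vx s l / yr) / pneg s l by rewrite -ym; field.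
      by field; rewrite F0 yr0.
    rewrite rE; have -> : mon (vx s) f = (pneg s l / vx s r) * (pneg s r * yr / vx s l).
      rewrite -!(mon_delta (vx s)) -!monN -!monD //; apply: eq_mon => i; rewrite /f.
      have [->|ir] := eqVneq i r.
        have Brl : vB s r l = -1 by rewrite sk B1.
        rewrite ?eqxx [r == l]eq_sym (negbTE lr) Brl (skew_diag r sk) opprK oppr0 z0.
        by rewrite (@zpos_id 1).
      have [->|il] := eqVneq i l.
        by rewrite ?eqxx (skew_diag l sk) B1 oppr0 z0 (@zpos_0 (- 1)).
      by have := zposB (vB s i r); lia.
    by field; rewrite F0 yr0 !x0.
move=> gt lr [B|B]; first exact: pos.
have gt' := gseed_opp gt.
have [|f [h [h1 h2 h3]]] := pos _ gt' lr; first by rewrite /= /bopp B opprK.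
exists f, h; split=> //; last by move: h3; rewrite !mu_opp.
by move=> i /h2[? ?]; rewrite /= /bopp !oppr_eq0.
Qed.

Section Leaf.
Variables (C : numFieldType) (K : fieldType) (iota : {rmorphism C -> K}) (N : nat).
Variables (s : sd K N) (M : {set 'I_N}) (l r : 'I_N).
Hypotheses (gs : gseed iota s) (lM : l \in M) (rM : r \in M).
Hypothesis leaf : forall i, i \in M -> i != r -> vB s i l = 0.
Hypothesis edge : vB s r l = 1 \/ vB s r l = -1.

(** The only mutable neighbour of the leaf is r, so the constant term of its exchange binomial is a
    frozen monomial, hence a unit. The exchange relation then puts 1 in the ideal of x_l and x_r,
    and an element regular where either is inverted is regular. *)
Lemma leaf_is_upper : is_upper iota (M :\ l) s -> is_upper iota (M :\ r) s ->
  is_upper iota M s.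
Proof.
move=> AU1 AUr u Uu.
have sub v : upper iota (M :\ v) s u by move=> ks /all_setD1[h _]; exact: Uu.
have xA i : alg iota M s (vx s i) by apply: inA_x; rewrite inE.
have [n hn] := freeze_clear lM (AU1 _ (sub l)).
have [m hm] := freeze_clear rM (AUr _ (sub r)).
have [f [h [fh0 [fr hr] fh e]]] := @exch_split _ _ (vx s) (fun i => vB s i l) r edge.
have hA : alg iota M s (mon (vx s) (fun i => - h i)).
  apply: inA_mon => i; have [iM|iM] := boolP (i \in M); last first.
    by right; rewrite inE; split=> //; right.
  left; have [->|ir] := eqVneq i r; first by rewrite hr oppr0.
  by have [_ ->] := fh i (leaf iM ir); rewrite oppr0.
have fA : alg iota M s (mon (vx s) f).
  by apply: inA_mon => i; right; rewrite inE; split=> //; left; case: (fh0 i).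
have x'A : alg iota M s (vx (mu l s) l).
  by apply: (@inA_var _ _ _ _ _ _ s [:: l]); rewrite /= ?lM ?inE.
have h0 : mon (vx s) h != 0 by apply: mon_neq0 => i _; exact: (gseed_neq0 i gs).
pose al := vx (mu l s) l * mon (vx s) (fun i => - h i).
pose be := - (mon (vx s) f * mon (vx s) (fun i => - h i)).
have one : 1 = al * vx s l + be * vx s r.
  have e' : vx s l * vx (mu l s) l = vx s r * mon (vx s) f + mon (vx s) h.
    by rewrite mu_exch ?(gseed_neq0 l gs).
  apply: (mulIf h0); rewrite /al /be monN mul1r -[LHS](addKr (vx s r * mon (vx s) f)) -e'.
  by field.
have alA : alg iota M s al by exact: inA_mul.
have beA : alg iota M s be by apply: inA_opp; exact: inA_mul.
(* Multiplication by 1 = al x_l + be x_r raises one of the two exponents; the claim is clear once a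
   >= n or b >= m. *)
suff J d a b : (n - a + (m - b) <= d)%N -> alg iota M s (u * vx s l ^+ a * vx s r ^+ b).
  by have := J (n + m)%N 0%N 0%N; rewrite !subn0 !mulr1; exact.
elim: d a b => [|d IH] a b hd.
  have [d1 d2] : (n <= a)%N /\ (m <= b)%N by lia.
  rewrite -(subnKC d1) exprD mulrA; apply: inA_mul; last exact: inA_exp.
  by apply: inA_mul => //; exact: inA_exp.
have [na|an] := leqP n a.
  rewrite -(subnKC na) exprD mulrA; apply: inA_mul; last exact: inA_exp.
  by apply: inA_mul => //; exact: inA_exp.
have [mb|bm] := leqP m b.
  rewrite mulrAC -(subnKC mb) exprD mulrA; apply: inA_mul; last exact: inA_exp.
  by apply: inA_mul => //; exact: inA_exp.
rewrite -[_ * _ ^+ b]mul1r one.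
have -> : (al * vx s l + be * vx s r) * (u * vx s l ^+ a * vx s r ^+ b) =
   al * (u * vx s l ^+ a.+1 * vx s r ^+ b) + be * (u * vx s l ^+ a * vx s r ^+ b.+1).
  by rewrite !exprS; ring.
by apply: inA_add; apply: inA_mul => //; apply: IH; lia.
Qed.

End Leaf.

(** * Deep points at a leaf *)

Lemma exch_one (F : fieldType) (N : nat) (x : 'I_N -> F) (e : 'I_N -> int) v :
  e v = 1 \/ e v = -1 -> x v = 0 -> (forall i, i != v -> e i != 0 -> x i != 0) ->
  mon x (fun i => zpos (e i)) + mon x (fun i => zpos (- e i)) != 0.
Proof.
move=> ev xv nz; have [f [h [_ [_ hv] fh ->]]] := exch_split x ev.
rewrite xv mul0r add0r; apply: mon_neq0 => i hi; apply: nz.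
  by apply: contra_neq hi => ->.
by apply: contra_neq hi => /fh[].
Qed.

Section LeafPoints.
Variables (C : numFieldType) (K : fieldType) (iota : {rmorphism C -> K}) (N : nat).
Variables (s : sd K N) (M : {set 'I_N}) (l r : 'I_N).
Hypotheses (gs : gseed iota s) (lM : l \in M) (rM : r \in M) (lr : l != r).
Hypothesis leaf : forall i, i \in M -> i != r -> vB s i l = 0.
Hypothesis edge : vB s r l = 1 \/ vB s r l = -1.
Variables (phi : K -> C).
Hypotheses (P : point iota M s phi) (dp : deep M s phi).

Local Notation M2 := (M :\ r :\ l).
Local Notation A0 := (inA iota M2 [set l]%SET s).

Let gs' : gseed iota (mu l s). Proof. exact: mu_gseed. Qed.

Let iso j : j \in M :\ r -> vB s j l = 0.
Proof. by rewrite !inE => /andP[jr jM]; exact: leaf. Qed.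

Let lMr : l \in M :\ r. Proof. by rewrite !inE lr. Qed.

Let M2M ks : all (fun k => k \in M2) ks ->
  [/\ all (fun k => k \in M) ks, all (fun k => k \in M :\ r) ks, r \notin ks & l \notin ks].
Proof. by move=> /all_setD1[h1 h2]; have [h3 h4] := all_setD1 h1. Qed.

Let edge' : vB s l r = 1 \/ vB s l r = -1.
Proof.
case: gs => _ sk; rewrite sk; case: edge => ->; [right|left] => //; exact: opprK.
Qed.

Let col_mus ks i : all (fun k => k \in M2) ks ->
  vB (mus s ks) i l = vB s i l /\ vB (mus s ks) l i = vB s l i.
Proof.
move=> h; suff e j : vB (mus s ks) j l = vB s j l.
  split=> //; case: (gs) => _ sk; case: (mus_gseed ks gs) => _ sk'.
  by rewrite sk' e -sk.
elim/last_ind: ks j h => [|ks k IH] j //; rewrite all_rcons => /andP[kM h].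
have kl0 : vB (mus s ks) k l = 0.
  by rewrite IH // iso //; move: kM; rewrite !inE => /and3P[_ -> ->].
have kl : k != l by move: kM; rewrite !inE => /andP[].
rewrite mus_rcons /= /bmut [l == k]eq_sym (negbTE kl) orbF IH // -IH // kl0.
by case: eqP => [->|_]; rewrite ?kl0 oppr0 /zpos ?maxxx ?mulr0 ?subr0 ?addr0 // IH.
Qed.

(* All seeds below lie in the pentagon obtained by mutating at l and r: one of
   them has no vanishing variable. *)
Lemma pentagon_not_deep ks : all (fun k => k \in M2) ks ->
  (forall i, i \in M2 -> phi (vx (mus s ks) i) != 0) ->
  phi (vx s r) != 0 -> phi (vx s l) = 0 -> phi (vx (mu l s) l) = 0 -> False.
Proof.
move=> h nz r0 l0 l'0; have [hM hMr rks lks] := M2M h.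
set t := mus s ks in nz *; have gt : gseed iota t by exact: mus_gseed.
have Pt : point iota M t phi by apply/(point_mus phi gs hM).
have dt : deep M t phi by apply/(deep_mus phi gs hM).
have g1 : gseed iota (mu l t) by exact: mu_gseed.
have P1 : point iota M (mu l t) phi by apply/(point_mu phi gt lM).
have nzt i : i != l -> phi (vx t i) != 0.
  move=> il; have [iM|iM] := boolP (i \in M); last exact: (pt_frozen Pt gt).
  have [->|ir] := eqVneq i r; first by rewrite /t mus_vxN.
  by apply: nz; rewrite !inE il ir.
have tl0 : phi (vx t l) = 0 by rewrite /t mus_vxN.
have tB : vB t l r = 1 \/ vB t l r = -1 by have [_ ->] := col_mus r h.
have tl'0 : phi (vx (mu l t) l) = 0.
  rewrite -l'0; congr phi; rewrite !mu_vx /ppos /pneg /t mus_vxN //.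
  have e (f : int -> int) : f 0 = 0 ->
      mon (vx (mus s ks)) (fun i => f (vB (mus s ks) i l)) = mon (vx s) (fun i => f (vB s i l)).
    move=> f0; apply: etrans (eq_monx _) (eq_mon _ _) => i; last by have [-> _] := col_mus i h.
    have [-> _] := col_mus i h; have [iks|/mus_vxN -> //] := boolP (i \in ks).
    by rewrite iso ?f0 ?eqxx //; exact: (allP hMr).
  by rewrite (e zpos) ?(e (fun a => zpos (- a))) ?oppr0 /zpos ?maxxx.
have r'0 : phi (vx (mu r t) r) != 0.
  have : phi (vx t r) * phi (vx (mu r t) r) != 0.
    rewrite (pt_exch Pt gt rM); apply: (@exch_one _ _ _ (fun i => vB t i r) l) => //.
    by move=> i il _; exact: nzt.
  by rewrite mulf_eq0 negb_or => /andP[].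
have [f [hh [fh0 fh e]]] := pentagon gt lr tB.
have monA (u : 'I_N -> int) : (forall i, 0 <= u i) -> alg iota M t (mon (vx t) u).
  by move=> u0; apply: inA_mon => i; right; rewrite inE; split=> //; left.
have y0 : phi (vx (mu l (mu r (mu l t))) l) != 0.
  have := congr1 phi e; rewrite !(pt_mul Pt); first last.
  - by apply: monA => i; case: (fh0 i).
  - by apply: (@inA_var _ _ _ _ _ _ t [:: l; r; l]); rewrite /= ?lM ?rM ?inE.
  - by apply: monA => i; case: (fh0 i).
  - by apply: (@inA_var _ _ _ _ _ _ t [:: r]); rewrite /= ?rM ?inE.
  rewrite !(pt_mon Pt (ks := [::])) //; try by move=> i; case: (fh0 i).
  move=> e'; have : phi (vx (mu r t) r) * mon (fun i => phi (vx t i)) hh != 0.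
    rewrite mulf_neq0 //; apply: mon_neq0 => i hi; apply: nzt.
    by have [] := fh i (or_intror hi).
  by rewrite -e' mulf_eq0 negb_or => /andP[].
have r''0 : phi (vx (mu r (mu l t)) r) != 0.
  have rl : r != l by rewrite eq_sym.
  have : phi (vx (mu l t) r) * phi (vx (mu r (mu l t)) r) != 0.
    rewrite (pt_exch P1 g1 rM); apply: (@exch_one _ _ _ (fun i => vB (mu l t) i r) l) => //.
      rewrite /= /bmut eqxx; case: tB => ->; [by right|by left; rewrite opprK].
    by move=> i il _; rewrite mu_vxN //; exact: nzt.
  by rewrite mulf_eq0 negb_or => /andP[].
have [|i iM] := dt [:: l; r; l]; first by rewrite /= lM rM.
rewrite -[mus t _]/(mu l (mu r (mu l t))) => /eqP; apply/negP.
have [->|il] := eqVneq i l; first exact: y0.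
rewrite mu_vxN //; have [->|ir] := eqVneq i r; first exact: r''0.
by rewrite !mu_vxN //; exact: nzt.
Qed.

(** In the remaining case x_l = x_l' = 0, freezing r isolates l. Evaluating with x_l := 1 gives a
    point of the quiver without l and r, deep by the pentagon, and its stabilizer is lifted by a
    suitable weight at l. *)
Lemma leaf_stabilized :
  is_upper iota (M :\ l) s -> no_mystery iota (M :\ l) s ->
  is_upper iota (M :\ l) (mu l s) -> no_mystery iota (M :\ l) (mu l s) ->
  is_upper iota M2 s -> is_upper iota M2 (mu l s) -> no_mystery iota M2 s ->
  phi (vx s r) != 0 -> stabilized iota M s phi.
Proof.
move=> AU1 G1 AU1' G1' AU2 AU2' G2 r0.
have nbr i : i \in M -> vB s i l != 0 -> i = r.
  by move=> iM; have [//|/(leaf iM) ->] := eqVneq i r; rewrite eqxx.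
have [l0|l0] := eqVneq (phi (vx s l)) 0; last first.
  by apply: (freeze_stabilized P gs lM AU1 G1 dp l0) => i iM /(nbr i iM) ->.
have [l'0|l'0] := eqVneq (phi (vx (mu l s) l)) 0; last first.
  apply/(stabilized_mu phi gs lM); move/(point_mu phi gs lM): (P) => P'.
  move/(deep_mu phi gs lM): (dp) => dp'.
  apply: (freeze_stabilized P' gs' lM AU1' G1' dp' l'0) => i iM.
  rewrite {1}/mu /= /bmut eqxx orbT oppr_eq0 => /(nbr i iM) ->.
  by rewrite [r == l]eq_sym (negbTE lr).
have [psi Ppsi psiE] := freeze_point P rM r0.
have AUr : is_upper iota (M :\ r) s by exact: (isolated_is_upper gs lMr iso AU2 AU2').
(* A frozen variable must not vanish, while x_l does. As l is joined to no vertex of [M2], its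
   variable is a free parameter there and may be set to 1. *)
have [D [sg S]] := @specialization_exists _ _ _ iota iota _ _
   (fun i => if i == l then 1 else vx s i) (proj1 gs).
have ag0 := agree_refl gs iso.
have fix_mus ks i : all (fun k => k \in M2) ks -> i != l ->
    D (vx (mus s ks) i) /\ sg (vx (mus s ks) i) = vx (mus s ks) i.
  elim/last_ind: ks i => [|ks k IH] i.
    by move=> _ il; have := spec_var S i; rewrite (negbTE il).
  rewrite all_rcons => /andP[kM h] il; have [_ _ hrow] := agree_mus h ag0.
  rewrite mus_rcons; have [->|ik] := eqVneq i k; last by rewrite mu_vxN //; exact: IH.
  have kl : k != l by move: kM; rewrite !inE => /andP[].
  have fm (f : int -> int) : f 0 = 0 -> (forall a, 0 <= f a) ->
      D (mon (vx (mus s ks)) (fun i => f (vB (mus s ks) i k))) /\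
      sg (mon (vx (mus s ks)) (fun i => f (vB (mus s ks) i k))) =
      mon (vx (mus s ks)) (fun i => f (vB (mus s ks) i k)).
    move=> f0 fp; apply: (spec_prod S) => j; have [->|jl] := eqVneq j l.
      by rewrite hrow // f0 expr0z; exact: (spec1 S).
    have [Dj sj] := IH j h jl.
    have h0 : (0 <= f (vB (mus s ks) j k)) || (sg (vx (mus s ks) j) != 0) by rewrite fp.
    by have [? ->] := spec_expz S Dj h0; rewrite sj.
  have [Dk sk] := IH k h kl.
  have [DV sV] := spec_inv S Dk ltac:(by rewrite sk (gseed_neq0 k (mus_gseed ks gs))).
  have z0 : zpos 0 = 0 by rewrite /zpos maxxx.
  have [Dp sp] := fm zpos z0 zpos_ge0.
  have [Dn sn] := fm (fun a => zpos (- a)) (etrans (congr1 zpos (oppr0 _)) z0) (fun a => zpos_ge0 _).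
  have [Da sa] := spec_add S Dp Dn; have [Dm sm] := spec_mul S DV Da.
  by rewrite mu_vx; split=> //; rewrite sm sV sk sa sp sn.
have fixA0 a : A0 a -> D a /\ sg a = a.
  elim=> [c|ks i h il|i iM il|u v _ [Du su] _ [Dv sv]|u v _ [Du su] _ [Dv sv]].
  - exact: spec_const S c.
  - by apply: fix_mus => //; move: il; rewrite inE.
  - have [] := fix_mus [::] i isT ltac:(by move: il; rewrite inE) => Di si.
    have [DV ->] := spec_inv S Di ltac:(by rewrite si (gseed_neq0 i gs)).
    by rewrite si.
  - by have [? ->] := spec_add S Du Dv; rewrite su sv.
  - by have [? ->] := spec_mul S Du Dv; rewrite su sv.
have algM2 a : alg iota M2 s a -> D a /\ A0 (sg a).
  elim=> [c|ks i h _|i iM _|u v _ [Du su] _ [Dv sv]|u v _ [Du su] _ [Dv sv]].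
  - by have [? ->] := spec_const S c; split=> //; exact: inA_const.
  - have [->|il] := eqVneq i l.
      rewrite mus_vxN; last by have [] := M2M h.
      by have := spec_var S l; rewrite eqxx => -[? ->]; split=> //; exact: inA_1.
    by have [? ->] := fix_mus ks i h il; split=> //; apply: inA_var => //; rewrite inE.
  - have [->|il] := eqVneq i l.
      have := spec_var S l; rewrite eqxx => -[Dl sl].
      have [DV ->] := spec_inv S Dl ltac:(by rewrite sl oner_neq0).
      by rewrite sl invr1; split=> //; exact: inA_1.
    have [Di si] := fix_mus [::] i isT il.
    have [DV ->] := spec_inv S Di ltac:(by rewrite si (gseed_neq0 i gs)).
    by rewrite si; split=> //; apply: inA_inv => //; rewrite inE.
  - by have [? ->] := spec_add S Du Dv; split=> //; exact: inA_add.
  - by have [? ->] := spec_mul S Du Dv; split=> //; exact: inA_mul.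
have A0r a : A0 a -> alg iota (M :\ r) s a by exact: A0_alg.
have A0M2 a : A0 a -> alg iota M2 s a.
  elim=> [c|ks i h il|i iM il|u v _ hu _ hv|u v _ hu _ hv].
  - exact: inA_const.
  - by apply: inA_var; rewrite ?inE.
  - by apply: inA_inv; rewrite ?inE //; move: iM; rewrite !inE.
  - exact: inA_add.
  - exact: inA_mul.
pose phi2 a := psi (sg a).
have P2 : point iota M2 s phi2.
  split.
  - by move=> c; rewrite /phi2; have [_ ->] := spec_const S c; exact: pt_const Ppsi c.
  - move=> a b /algM2[Da ha] /algM2[Db hb]; rewrite /phi2; have [_ ->] := spec_add S Da Db.
    by rewrite (pt_add Ppsi) //; exact: A0r.
  - move=> a b /algM2[Da ha] /algM2[Db hb]; rewrite /phi2; have [_ ->] := spec_mul S Da Db.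
    by rewrite (pt_mul Ppsi) //; exact: A0r.
have d2 : deep M2 s phi2.
  move=> ks h; apply: contrapT => nex; have [hM _ _ _] := M2M h.
  apply: (pentagon_not_deep h _ r0 l0 l'0) => i iM; apply/eqP => i0; apply: nex.
  exists i => //; have il : i != l by move: iM; rewrite !inE => /andP[].
  rewrite /phi2; have [_ ->] := fix_mus ks i h il; rewrite psiE //.
  by apply: inA_var => //; rewrite inE.
have [c [g2 [T2 [i0 ci0] S2 h2]]] := G2 phi2 P2 d2.
have [c0 cf ccol] := T2.
have cl : c l = 1 by apply: cf; rewrite !inE eqxx.
have cr : c r = 1 by apply: cf; rewrite !inE eqxx andbF.
(* [rho] is the defect in the condition on column r, which [c] need not satisfy. The weight [m] at l
   repairs it since B_lr = 1 or -1, and has no effect at the point since x_l and x_l' vanish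
   there. *)
pose rho := mon c (fun i => vB s i r).
have rho0 : rho != 0 by apply: mon_neq0 => i _.
pose m := rho ^ (- vB s l r).
have m0 : m != 0 by rewrite expfz_neq0.
have cd0 i : cdelta l m i != 0 by rewrite /cdelta; case: ifP; rewrite ?oner_neq0.
have [h S3] := scaling_exists gs cd0.
have [T3 hA0 _] := scaling_delta gs lMr iso m0 S3.
pose ct i := if i == l then m else c i.
pose gt a := g2 (h a).
have St : scaling iota s ct gt.
  rewrite /gt; split.
  - by move=> a; rewrite (scal_const S3) (scal_const S2).
  - by move=> a b; rewrite (scal_add S3) (scal_add S2).
  - by move=> a b; rewrite (scal_mul S3) (scal_mul S2).
  - move=> i; rewrite (scal_var S3) (scal_mul S2) (scal_const S2) (scal_var S2) /ct /cdelta.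
    by case: eqP => [->|_]; rewrite ?cl rmorph1 mul1r.
have monct e : e l = 0 -> mon ct e = mon c e.
  move=> el; apply: eq_monx => i; rewrite /ct; have [->|//] := eqVneq i l.
  by rewrite el eqxx.
have [_ sk] := gs.
have Tt : torus M s ct.
  split.
  - by move=> i; rewrite /ct; case: ifP => _; [exact: m0|exact: c0].
  - move=> i iM; rewrite /ct; case: eqP => [il|_]; first by rewrite il lM in iM.
    by apply: cf; rewrite !inE (negbTE iM) !andbF.
  move=> j jM; have [->|jr] := eqVneq j r.
    rewrite (mon_split _ l) {1}/ct eqxx monct ?eqxx //.
    have -> : mon c (fun i => if i == l then 0 else vB s i r) = rho.
      by rewrite /rho [in RHS](mon_split _ l) cl exp1rz mul1r.
    rewrite /m exprz_exp -{2}(expr1z rho) -expfzDr //.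
    by case: edge' => ->.
  have Blj : vB s l j = 0 by rewrite sk leaf ?oppr0.
  rewrite monct //; have [->|jl] := eqVneq j l; last first.
    by apply: ccol; rewrite !inE jl jr.
  rewrite /mon big1 // => i _; have [iM|iM] := boolP (i \in M); last first.
    by rewrite cf ?exp1rz // !inE (negbTE iM) !andbF.
  by have [->|ir] := eqVneq i r; rewrite ?cr ?exp1rz // leaf // expr0z.
exists ct, gt; split=> //.
  exists i0; rewrite /ct; have [il|//] := eqVneq i0 l; move: ci0.
  by rewrite il cl eqxx.
have Ttr : torus (M :\ r) s ct.
  case: Tt => t1 t2 t3; split=> // [i iM|j]; last by rewrite inE => /andP[_]; exact: t3.
  have [->|ir] := eqVneq i r; first by rewrite /ct [r == l]eq_sym (negbTE lr).
  by apply: t2; move: iM; rewrite !inE ir.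
move=> a ha; have gaA := scaling_inA gs Tt St ha.
rewrite -!psiE //.
have Ua : upper iota (M :\ r) s a.
  by move=> ks /all_setD1[hks _]; exact: (alg_upper gs ha).
suff [] : alg iota (M :\ r) s a /\ psi (gt a) = psi a by [].
have xA : alg iota (M :\ r) s (vx s l) by apply: inA_x; rewrite inE.
have x'A : alg iota (M :\ r) s (vx (mu l s) l).
  by apply: (@inA_var _ _ _ _ _ _ s [:: l]); rewrite /= ?lMr ?inE.
have psix : psi (vx s l) = 0 by rewrite psiE //; apply: inA_x; rewrite inE.
have psix' : psi (vx (mu l s) l) = 0.
  by rewrite psiE //; apply: (@inA_var _ _ _ _ _ _ s [:: l]); rewrite /= ?lM ?inE.
apply: (isolated_ind gs lMr iso AU2 AU2'
  (Q := fun b => alg iota (M :\ r) s b /\ psi (gt b) = psi b) Ua).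
- move=> b hb; split; first exact: A0r.
  rewrite /gt (hA0 b hb).
  have gb : A0 (g2 b) by exact: (scaling_inA gs T2 S2).
  have := h2 b (A0M2 b hb); rewrite /phi2.
  by have [_ ->] := fixA0 b hb; have [_ ->] := fixA0 _ gb.
- by split=> //; rewrite (scal_var St) (pt_mul Ppsi) ?psix ?mulr0 //; exact: inA_const.
- have S' := scaling_mu gs St (torus_neq0 Ttr) (torus_col Ttr lMr).
  by split=> //; rewrite (scal_var S') (pt_mul Ppsi) ?psix' ?mulr0 //; exact: inA_const.
- move=> b d [hb eb] [hd ed]; split; first exact: inA_add.
  by rewrite (scal_add St) !(pt_add Ppsi) ?eb ?ed //; exact: (scaling_inA gs Ttr St).
- move=> b d [hb eb] [hd ed]; split; first exact: inA_mul.
  by rewrite (scal_mul St) !(pt_mul Ppsi) ?eb ?ed //; exact: (scaling_inA gs Ttr St).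
Qed.

End LeafPoints.
Section LeafNeighbours.
Variables (C : numFieldType) (K : fieldType) (iota : {rmorphism C -> K}) (N : nat).
Variables (s : sd K N) (M : {set 'I_N}) (l r : 'I_N).
Hypotheses (gs : gseed iota s) (lM : l \in M) (rM : r \in M) (lr : l != r).
Hypothesis leaf : forall i, i \in M -> i != r -> vB s i l = 0.
Hypothesis edge : vB s r l = 1 \/ vB s r l = -1.
Variables (phi : K -> C).
Hypotheses (P : point iota M s phi) (dp : deep M s phi).

(** With x_r = 0 the exchange relation at the leaf says that x_l x_l' is the value of a frozen
    monomial. *)
Lemma leaf_neq0 : phi (vx s r) = 0 -> phi (vx s l) != 0 /\ phi (vx (mu l s) l) != 0.
Proof.
move=> r0; have : phi (vx s l) * phi (vx (mu l s) l) != 0.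
  rewrite (pt_exch P gs lM); apply: (@exch_one _ _ _ (fun i => vB s i l) r) => // i ir.
  by have [iM|iM _] := boolP (i \in M); [rewrite leaf ?eqxx|exact: (pt_frozen P gs)].
by rewrite mulf_eq0 negb_or => /andP.
Qed.

(** If x_r' is nonzero, [l] can be frozen after mutation at r. If x_r' = 0, the pentagon makes the
    fifth variable vanish; the exchange relation producing it then forces the variable at r in
    [mu r (mu l s)] to be nonzero, and [l] can be frozen in that seed. *)
Lemma leaf_neighbours_stabilized :
  is_upper iota (M :\ l) s -> no_mystery iota (M :\ l) s ->
  is_upper iota (M :\ l) (mu l s) -> no_mystery iota (M :\ l) (mu l s) ->
  phi (vx s r) = 0 ->
  (forall i, i \in M -> i != l -> vB s i r != 0 -> phi (vx s i) != 0) ->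
  stabilized iota M s phi.
Proof.
move=> AU1 G1 AU1' G1' r0 nb; have [l0 l'0] := leaf_neq0 r0.
have rM1 : r \in M :\ l by rewrite !inE eq_sym lr.
have g1 : gseed iota (mu l s) by exact: mu_gseed.
have gr : gseed iota (mu r s) by exact: mu_gseed.
have g2 : gseed iota (mu r (mu l s)) by exact: mu_gseed.
have Pr : point iota M (mu r s) phi by apply/(point_mu phi gs rM).
have P1 : point iota M (mu l s) phi by apply/(point_mu phi gs lM).
have P2 : point iota M (mu r (mu l s)) phi by apply/(point_mu phi g1 rM).
have d1 : deep M (mu l s) phi by apply/(deep_mu phi gs lM).
have d2 : deep M (mu r (mu l s)) phi by apply/(deep_mu phi g1 rM).
have sk : skew (vB s) by case: gs.
have z0 : zpos 0 = 0 by rewrite /zpos maxxx.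
have rl : (r == l) = false by rewrite eq_sym (negbTE lr).
have nbr i : i \in M -> i != r -> vB s i r = 0 ->
    vB (mu r s) i l = 0 /\ vB (mu r (mu l s)) i l = 0.
  move=> iM ir Bir; have Bil := leaf iM ir.
  have e1 : vB (mu l s) i r = 0.
    rewrite /= /bmut rl orbF; case: ifP => _; first by rewrite Bir oppr0.
    by rewrite Bir Bil oppr0 z0 !mul0r subr0 addr0.
  have e2 : vB (mu l s) i l = 0 by rewrite /= /bmut eqxx orbT Bil oppr0.
  split; first by rewrite /= /bmut (negbTE ir) (negbTE lr) Bil Bir oppr0 z0 !mul0r subr0 addr0.
  rewrite /= {1}/bmut (negbTE ir) (negbTE lr) /=; move: e1 e2 => /= -> ->.
  by rewrite oppr0 z0 !mul0r subr0 addr0.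
have [r'0|r'0] := eqVneq (phi (vx (mu r s) r)) 0; last first.
  apply/(stabilized_mu phi gs rM).
  apply: (freeze_stabilized Pr gr lM); first exact/(is_upper_mu gs rM1).
  - exact/(no_mystery_mu gs rM1).
  - exact/(deep_mu phi gs rM).
  - by rewrite mu_vxN.
  - move=> i iM; have [->|ir] := eqVneq i r; first by [].
    rewrite mu_vxN //; have [->|il] := eqVneq i l; first by [].
    by move=> Bi; apply: nb => //; apply: contra_neq Bi => /(nbr i iM ir)[].
have edge' : vB s l r = 1 \/ vB s l r = -1.
  by rewrite sk; case: edge => ->; [right|left; rewrite opprK].
have [f [h [fh0 fh e]]] := pentagon gs lr edge'.
have monA (u : 'I_N -> int) : (forall i, 0 <= u i) -> alg iota M s (mon (vx s) u).
  by move=> u0; apply: inA_mon => i; right; rewrite inE; split=> //; left.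
have y0 : phi (vx (mu l (mu r (mu l s))) l) = 0.
  have := congr1 phi e; rewrite !(pt_mul P); first last.
  - by apply: monA => i; case: (fh0 i).
  - by apply: (@inA_var _ _ _ _ _ _ s [:: l; r; l]); rewrite /= ?lM ?rM ?inE.
  - by apply: monA => i; case: (fh0 i).
  - by apply: (@inA_var _ _ _ _ _ _ s [:: r]); rewrite /= ?rM ?inE.
  rewrite r'0 mul0r (pt_mon P (ks := [::])) //; last by move=> i; case: (fh0 i).
  move/eqP; rewrite mulf_eq0 => /orP[/eqP //|]; apply: contraTeq => _; apply: mon_neq0 => i fi.
  have [il ir B] := fh i (or_introl fi).
  have [iM|iM] := boolP (i \in M); last exact: (pt_frozen P gs).
  by apply: nb => //; case: B => //; rewrite leaf ?eqxx.
have nb4 i : i != r -> vB (mu r (mu l s)) i l != 0 -> phi (vx (mu r (mu l s)) i) != 0.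
  move=> ir B; have [iM|iM] := boolP (i \in M); last exact: (pt_frozen P2 g2).
  rewrite mu_vxN //; have [->//|il] := eqVneq i l.
  by rewrite mu_vxN //; apply: nb => //; apply: contra_neq B => /(nbr i iM ir)[].
have r''0 : phi (vx (mu r (mu l s)) r) != 0.
  apply/eqP => r''0; have := pt_exch P2 g2 lM; rewrite y0 mulr0 => /eqP.
  rewrite eq_sym; apply/negP; apply: (@exch_one _ _ _ (fun i => vB (mu r (mu l s)) i l) r) => //.
  rewrite /= /bmut eqxx /= eqxx orbT.
  by case: edge => ->; [left; rewrite opprK|right; rewrite opprK].
apply/(stabilized_mu phi gs lM)/(stabilized_mu phi g1 rM).
apply: (freeze_stabilized P2 g2 lM) => //.
- exact/(is_upper_mu g1 rM1).
- exact/(no_mystery_mu g1 rM1).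
- by rewrite mu_vxN.
- by move=> i iM; have [->|ir] := eqVneq i r; [|exact: nb4].
Qed.

End LeafNeighbours.

(** * Quivers all of whose cluster algebras are free of mysterious points *)

(* [f] embeds the quiver [b] on [Ms] as the mutable part of the seed [s]; the
   frozen vertices are arbitrary. *)
Definition tame (C : numFieldType) (W : eqType) (b : W -> W -> int) (Ms : seq W) : Prop :=
  forall (K : fieldType) (iota : {rmorphism C -> K}) (N : nat) (s : sd K N) (f : W -> 'I_N),
  gseed iota s -> {in Ms &, injective f} ->
  (forall i j, i \in Ms -> j \in Ms -> vB s (f i) (f j) = b i j) ->
  is_upper iota [set v in map f Ms] s /\ no_mystery iota [set v in map f Ms] s.

Section Tame.
Variable C : numFieldType.

Lemma tame_relabel (W W' : eqType) (h : W -> W') b Ms b' Ms' :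
  {in Ms &, injective h} -> Ms' =i map h Ms ->
  (forall i j, i \in Ms -> j \in Ms -> b' (h i) (h j) = b i j) ->
  tame C b Ms -> tame C b' Ms'.
Proof.
move=> ih eM hb T K iota N s f gs fi fb.
have hM i : i \in Ms -> h i \in Ms' by move=> iM; rewrite eM map_f.
have -> : ([set v in map f Ms'] = [set v in map (f \o h) Ms]).
  apply/setP => v; rewrite !inE; apply/mapP/mapP => -[w wM ->].
    by move: wM; rewrite eM => /mapP[w' w'M ->]; exists w'.
  by exists (h w) => //; exact: hM.
apply: T => //.
- by move=> i j iM jM /fi e; apply: ih => //; apply: e; exact: hM.
- by move=> i j iM jM; rewrite /= fb ?hM // hb.
Qed.

Lemma set_filter (W : eqType) N (f : W -> 'I_N) Ms l : {in Ms &, injective f} -> l \in Ms ->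
  [set v in map f [seq i <- Ms | i != l]] = [set v in map f Ms] :\ f l.
Proof.
move=> fi lM; apply/setP => v; rewrite !inE; apply/mapP/andP.
  move=> [w]; rewrite mem_filter => /andP[wl wM] ->; split; last exact: map_f.
  by apply: contra_neq wl => /fi ->.
by move=> [vl /mapP[w wM e]]; exists w => //; rewrite mem_filter wM andbT; apply: contra_neq vl => <-.
Qed.

Lemma tame_nil (W : eqType) (b : W -> W -> int) : tame C b [::].
Proof.
move=> K iota N s f gs _ _; have -> : [set v in map f [::]] = finset.set0.
  by apply/setP => v; rewrite !inE.
split=> [u|phi _ d]; first by move/(_ [::] isT).
by case: (d [::] isT) => j; rewrite inE.
Qed.

Lemma tame_mut (W : eqType) (b : W -> W -> int) Ms k : k \in Ms ->
  tame C (bmut k b) Ms -> tame C b Ms.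
Proof.
move=> kM T K iota N s f gs fi fb; have gs' : gseed iota (mu (f k) s) by exact: mu_gseed.
have kM' : f k \in [set v in map f Ms] by rewrite inE map_f.
have [|AU G] := T K iota N (mu (f k) s) f gs' fi.
  move=> i j iM jM; rewrite /= /bmut !fb //.
  by rewrite (inj_in_eq fi) // (inj_in_eq fi).
by split; [apply/(is_upper_mu gs kM')|apply/(no_mystery_mu gs kM')].
Qed.

Lemma tame_muts (W : eqType) (b : W -> W -> int) Ms ks : all (fun k => k \in Ms) ks ->
  tame C (bmuts b ks) Ms -> tame C b Ms.
Proof.
elim: ks b => //= k ks IH b /andP[kM h] T; apply: (tame_mut kM); exact: IH.
Qed.

Lemma zpos_mulN a : zpos a * zpos (- a) = 0.
Proof.
case: (lerP 0 a) => h; first by rewrite (@zpos_0 (- a)) ?mulr0 // oppr_le0.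
by rewrite (@zpos_0 a) ?mul0r // ltW.
Qed.

Lemma tame_isolated (W : eqType) (b : W -> W -> int) Ms l : l \in Ms ->
  (forall i, i \in Ms -> b i l = 0) ->
  tame C b [seq i <- Ms | i != l] -> tame C b Ms.
Proof.
move=> lM iso T K iota N s f gs fi fb; have gs' : gseed iota (mu (f l) s) by exact: mu_gseed.
have lM' : f l \in [set v in map f Ms] by rewrite inE map_f.
have iso' j : j \in [set v in map f Ms] -> vB s j (f l) = 0.
  by rewrite inE => /mapP[i iM ->]; rewrite fb // iso.
have fi' : {in [seq i <- Ms | i != l] &, injective f}.
  by move=> i j; rewrite !mem_filter => /andP[_ ?] /andP[_ ?]; exact: fi.
have [|AU G] := T K iota N s f gs fi'.
  by move=> i j; rewrite !mem_filter => /andP[_ iM] /andP[_ jM]; exact: fb.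
have [|AU' G'] := T K iota N (mu (f l) s) f gs' fi'.
  move=> i j; rewrite !mem_filter => /andP[il iM] /andP[jl jM].
  rewrite /= /bmut !(inj_in_eq fi) // (negbTE il) (negbTE jl) /= !fb // iso //.
  by rewrite oppr0 /zpos maxxx !mul0r subr0 addr0.
rewrite set_filter // in AU G AU' G'.
split; first exact: (isolated_is_upper gs lM' iso' AU AU').
exact: (isolated_no_mystery gs lM' iso' AU AU' G G').
Qed.

(** [s0] is the one neighbour of r that need not be a leaf; [s0 := l] expresses that there is none.
    When x_r = 0 the leaves at r do not vanish, and the exchange relation at r forces the same for
    [s0]. *)
Lemma tame_tail (W : eqType) (b : W -> W -> int) Ms l r s0 :
  l \in Ms -> r \in Ms -> l != r ->
  (forall i, i \in Ms -> i != r -> b i l = 0) -> (b r l = 1 \/ b r l = -1) ->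
  (forall i, i \in Ms -> i != l -> i != s0 -> b i r != 0 ->
     (forall j, j \in Ms -> j != r -> b j i = 0) /\ (b r i = 1 \/ b r i = -1)) ->
  (s0 \in Ms -> b s0 r != 0 -> b s0 r = 1 \/ b s0 r = -1) ->
  tame C b [seq i <- Ms | i != l] ->
  tame C b [seq i <- [seq i <- Ms | i != l] | i != r] ->
  tame C b Ms.
Proof.
move=> lM rM lr leaf edge nbrs hs0 T1 T2 K iota N s f gs fi fb.
have gs' : gseed iota (mu (f l) s) by exact: mu_gseed.
set M := [set v in map f Ms].
have lM' : f l \in M by rewrite inE map_f.
have rM' : f r \in M by rewrite inE map_f.
have lr' : f l != f r by rewrite (inj_in_eq fi).
have sk : skew (vB s) by case: gs.
have leaf' i : i \in M -> i != f r -> vB s i (f l) = 0.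
  rewrite inE => /mapP[w wM ->]; rewrite (inj_in_eq fi) // => wr.
  by rewrite fb // leaf.
have edge' : vB s (f r) (f l) = 1 \/ vB s (f r) (f l) = -1 by rewrite fb.
have m1 i : i \in [seq i <- Ms | i != l] -> i \in Ms by rewrite mem_filter => /andP[].
have m2 i : i \in [seq i <- [seq i <- Ms | i != l] | i != r] -> i \in [seq i <- Ms | i != l].
  by rewrite mem_filter => /andP[].
have fi1 : {in [seq i <- Ms | i != l] &, injective f} by move=> i j /m1 ? /m1; exact: fi.
have fi2 : {in [seq i <- [seq i <- Ms | i != l] | i != r] &, injective f}.
  by move=> i j /m2 ? /m2; exact: fi1.
(* No path through a leaf joins two different vertices, so mutation at l does not change the quiver
   on the others. *)
have fb' i j : i \in [seq i <- Ms | i != l] -> j \in [seq i <- Ms | i != l] ->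
    vB (mu (f l) s) (f i) (f j) = b i j.
  rewrite !mem_filter => /andP[il iM] /andP[jl jM].
  rewrite /= /bmut !(inj_in_eq fi) // (negbTE il) (negbTE jl) /= fb //.
  have z0 : zpos 0 = 0 by rewrite /zpos maxxx.
  have [->|ir] := eqVneq i r; last first.
    by rewrite (fb i l) // leaf // oppr0 z0 !mul0r subr0 addr0.
  have [->|jr] := eqVneq j r; last first.
    by rewrite (sk (f l) (f j)) (fb j l) // leaf // !oppr0 z0 !mulr0 subr0 addr0.
  rewrite (sk (f l) (f r)) opprK zpos_mulN.
  by rewrite [zpos (- _) * _]mulrC zpos_mulN subr0 addr0.
have [|AU1 G1] := T1 K iota N s f gs fi1.
  by move=> i j /m1 iM /m1 jM; exact: fb.
have [|AU1' G1'] := T1 K iota N (mu (f l) s) f gs' fi1; first exact: fb'.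
have [|AU2 G2] := T2 K iota N s f gs fi2.
  by move=> i j /m2/m1 iM /m2/m1 jM; exact: fb.
have [|AU2' G2'] := T2 K iota N (mu (f l) s) f gs' fi2.
  by move=> i j /m2 iM /m2 jM; exact: fb'.
have e2 : [set v in map f [seq i <- [seq i <- Ms | i != l] | i != r]] = M :\ f r :\ f l.
  rewrite set_filter // ?set_filter //; last by rewrite mem_filter eq_sym lr.
  by apply/setP => v; rewrite !inE; do !case: (_ == _).
rewrite set_filter // -/M in AU1 G1 AU1' G1'; rewrite e2 in AU2 G2 AU2' G2'.
have lMr : f l \in M :\ f r by rewrite !inE lr' map_f.
have isor j : j \in M :\ f r -> vB s j (f l) = 0.
  by rewrite in_setD1 => /andP[jr jM]; exact: leaf'.
split.
  apply: (leaf_is_upper gs lM' rM' leaf' edge' AU1).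
  exact: (isolated_is_upper gs lMr isor AU2 AU2').
move=> phi P dp; have [r0|r0] := eqVneq (phi (vx s (f r))) 0; last first.
  exact: (leaf_stabilized gs lM' rM' lr' leaf' edge' P dp AU1 G1 AU1' G1' AU2 AU2' G2 r0).
apply: (leaf_neighbours_stabilized gs lM' rM' lr' leaf' edge' P dp AU1 G1 AU1' G1' r0).
have nz i : i \in M -> i != f s0 -> vB s i (f r) != 0 -> phi (vx s i) != 0.
  rewrite inE => /mapP[w wM ->] ws; rewrite fb // => Bw.
  have [->|wl] := eqVneq w l; first by case: (leaf_neq0 gs lM' leaf' edge' P r0).
  have ws0 : w != s0 by apply: contra_neq ws => ->.
  have [lw ew] := nbrs w wM wl ws0 Bw.
  have wM' : f w \in M by rewrite inE map_f.
  have [||//] := @leaf_neq0 _ _ _ _ s M (f w) (f r) gs wM' _ _ phi P r0.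
    move=> i'; rewrite inE => /mapP[v vM ->]; rewrite (inj_in_eq fi) // => vr.
    by rewrite fb // lw.
  by rewrite fb.
move=> i iM il Bi; have [is0|is0] := eqVneq i (f s0); last exact: nz.
have Bs : vB s i (f r) = 1 \/ vB s i (f r) = -1.
  move: (iM); rewrite inE => /mapP[w wM ew]; move: Bi; rewrite ew fb //.
  have [ws|ws] := eqVneq w s0; last first.
    move=> Bw; have wl : w != l by apply: contra_neq il => <-.
    have [_] := nbrs w wM wl ws Bw.
    have -> : b w r = - b r w by rewrite -!fb // sk.
    by case=> ->; [right|left; rewrite opprK].
  by rewrite ws => Bw; apply: hs0 => //; rewrite -ws.
(* With x_r = 0 the relation at r reads 0 = x_i u + h, and h is a monomial in neighbours already
   known not to vanish, so x_i cannot vanish. *)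
have := pt_exch P gs rM'; rewrite r0 mul0r.
have [u [h [_ [_ hi] hz ->]]] := @exch_split _ _ (fun j => phi (vx s j)) (fun j => vB s j (f r)) i Bs.
move=> e; apply/eqP => i0; move: e; rewrite i0 mul0r add0r => /esym/eqP; apply/negP.
apply: mon_neq0 => j hj; have ji : j != i by apply: contra_neq hj => ->.
have [jM|jM] := boolP (j \in M); last exact: (pt_frozen P gs).
apply: nz => //; first by rewrite -is0.
by apply: contra_neq hj => /hz[].
Qed.

End Tame.
(** * Ladder quivers *)

(* Vertices are numbered from the right: the ladder of Q_(k,0) is
   ..., b_(k-1), t_k, b_k = ..., 2, 1, 0.  In [ufam] the vertex 0 is only
   attached to 2, in [yfam] it is only attached to 1. *)
Definition lad (i j : nat) : int :=
  (j == i.+1)%:Z - (i == j.+1)%:Z + (i == j.+2)%:Z - (j == i.+2)%:Z.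

Definition ufam (i j : nat) : int :=
  if (i == 0%N) && (j == 1%N) || (i == 1%N) && (j == 0%N) then 0 else lad i j.

Definition yfam (i j : nat) : int :=
  if (i == 0%N) && (j == 2%N) || (i == 2%N) && (j == 0%N) then 0 else lad i j.

(** Identifies what is left of the ladder, mutated at 1, when the leaf 0 and its neighbour 1 are
    removed. *)
Lemma bmut1_lad i j : bmut 1%N lad i.+2 j.+2 = ufam i j.
Proof.
rewrite /bmut /=; have z0 : zpos 0 = 0 by [].
case: i => [|[|i]]; last by rewrite (_ : lad i.+4 1 = 0) // oppr0 z0 !mul0r subr0 addr0.
all: case: j => [|[|j]]; try (by vm_compute).
all: by rewrite (_ : lad 1 j.+4 = 0) // oppr0 z0 !mulr0 subr0 addr0.
Qed.

Lemma ufam_shift i j : ufam i.+1 j.+1 = lad i j. Proof. by rewrite /ufam andbF. Qed.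
Lemma yfam_shift i j : yfam i.+1 j.+1 = lad i j. Proof. by rewrite /yfam andbF. Qed.

(** Removing 0 and 2 from [ufam] leaves the labels 1, 3, 4, ...; renumbered from 0, they carry the
    quiver [yfam] mutated at 0. *)
Lemma ufam_yfam i j :
  ufam (if i is i'.+1 then i'.+3 else 1%N) (if j is j'.+1 then j'.+3 else 1%N) =
  bmut 0%N yfam i j.
Proof.
have z0 : zpos 0 = 0 by [].
case: i => [|[|i]]; case: j => [|[|j]]; try by vm_compute.
all: have y0 v : yfam v.+2 0 = 0 by case: v.
all: have y0' v : yfam 0 v.+2 = 0 by case: v.
all: rewrite /bmut [_ || _]/= ?y0 ?y0' ?oppr0 ?z0 ?mulr0 ?mul0r ?subr0 ?addr0 //.
all: by rewrite /ufam /yfam /= ?andbF.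
Qed.

Section Ladders.
Variable C : numFieldType.

Lemma tame_shift d n b b' (Ms : seq nat) :
  (forall v, (v \in Ms) = (d <= v < d + n)%N) ->
  (forall i j, b' (d + i)%N (d + j)%N = b i j) ->
  tame C b (iota 0 n) -> tame C b' Ms.
Proof.
move=> hM hb; apply: (tame_relabel (h := addn d)) => //.
- by move=> i j _ _ /addnI.
- move=> v; rewrite hM; apply/idP/mapP => [h|[w]].
    by exists (v - d)%N; rewrite ?mem_iota; lia.
  by rewrite mem_iota => h ->; lia.
Qed.

Lemma tame_singleton b (v : nat) : b v v = 0 -> tame C b [:: v].
Proof.
move=> h; apply: (tame_isolated (l := v)); rewrite ?inE //.
  by move=> i; rewrite inE => /eqP ->.
by rewrite /= eqxx; exact: tame_nil.
Qed.

Lemma tame_ladders n : [/\ tame C lad (iota 0 n), tame C ufam (iota 0 n) & tame C yfam (iota 0 n)].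
Proof.
elim/ltn_ind: n => n IH.
have L m : (m < n)%N -> tame C lad (iota 0 m) by case/IH.
have U m : (m < n)%N -> tame C ufam (iota 0 m) by case/IH.
have Y m : (m < n)%N -> tame C yfam (iota 0 m) by case/IH.
split.
- case: n {IH Y} L U => [|[|[|[|[|n]]]]] L U.
  + exact: tame_nil.
  + exact: tame_singleton.
  + apply: (tame_tail (l := 0%N) (r := 1%N) (s0 := 0%N)) => //; try by right.
    * by case=> [|[|i]].
    * by case=> [|[|i]].
    * by move=> _ _; left.
    * exact: tame_singleton.
    * exact: tame_nil.
  + apply: (tame_muts (ks := [:: 1%N])) => //.
    apply: (tame_tail (l := 0%N) (r := 1%N) (s0 := 2%N)) => //.
    * by case=> [|[|[|i]]].
    * by left.
    * by case=> [|[|[|i]]].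
    * by move=> _ _; left.
    * apply: (tame_muts (ks := [:: 1%N])) => //; rewrite /bmuts [foldl _ _ _]/= bmutK.
      by apply: (tame_shift (d := 1) (n := 2)) (L 2%N _) => // v; rewrite /= !inE; case: v => [|[|[|v]]].
    * exact: tame_singleton.
  + apply: (tame_muts (ks := [:: 1%N])) => //.
    apply: (tame_tail (l := 0%N) (r := 1%N) (s0 := 2%N)) => //.
    * by case=> [|[|[|[|i]]]].
    * by left.
    * case=> [|[|[|[|i]]]] // _ _ _ _; split; last by left.
      by case=> [|[|[|[|i]]]].
    * by move=> _ _; left.
    * apply: (tame_muts (ks := [:: 1%N])) => //; rewrite /bmuts [foldl _ _ _]/= bmutK.
      by apply: (tame_shift (d := 1) (n := 3)) (L 3%N _) => // v; rewrite /= !inE; case: v => [|[|[|[|v]]]].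
    * apply: (tame_shift (d := 2) (n := 2)) (U 2%N _) => //; first by move=> v; rewrite /= !inE; case: v => [|[|[|[|v]]]].
      exact: bmut1_lad.
  (* Mutation at 1 makes 0 a leaf there, but its neighbours 2 and 3 both have further neighbours;
     mutations at 4 and 3 then detach 2 from 1. *)
  + apply: (tame_muts (ks := [:: 1; 4; 3]%N)) => //.
    apply: (tame_tail (l := 0%N) (r := 1%N) (s0 := 3%N)) => //.
    * by case=> [|[|[|[|[|[|[|[|i]]]]]]]] // _ _; vm_compute.
    * by left.
    * by case=> [|[|[|[|[|[|[|[|i]]]]]]]] // _ _ _; vm_compute.
    * by move=> _ _; left.
    (* The mutated vertices are still present, so the mutations are undone in reverse order and a
       shorter ladder remains. In the next case 1 is removed as well, and only 3 and 4 are
       undone. *)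
    * apply: (tame_muts (ks := [:: 3; 4; 1]%N)) => //; rewrite /bmuts [foldl _ _ _]/= !bmutK.
      apply: (tame_shift (d := 1) (n := n.+4)) (L n.+4 _) => //.
      by move=> v; rewrite mem_filter mem_iota; case: v => [|v] //=; lia.
    * apply: (tame_muts (ks := [:: 3; 4]%N)) => //; rewrite /bmuts [foldl _ _ _]/= !bmutK.
      apply: (tame_shift (d := 2) (n := n.+3)) (U n.+3 _) => //; last exact: bmut1_lad.
      by move=> v; rewrite !mem_filter mem_iota; case: v => [|[|v]] //=; lia.
- case: n {IH U} L Y => [|[|[|[|n]]]] L Y.
  + exact: tame_nil.
  + exact: tame_singleton.
  + apply: (tame_isolated (l := 0%N)) => //; first by case=> [|[|i]].
    exact: tame_singleton.
  + apply: (tame_tail (l := 0%N) (r := 2%N) (s0 := 1%N)) => //.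
    * by case=> [|[|[|i]]].
    * by left.
    * by case=> [|[|[|i]]].
    * by move=> _ _; left.
    * by apply: (tame_shift (d := 1) (n := 2)) (L 2%N _) => // [v|i j]; rewrite ?ufam_shift //= !inE; case: v => [|[|[|v]]].
    * exact: tame_singleton.
  (* The leaf 0 hangs at 2; mutation at 3 cancels the arrows joining 2 to 1 and, if present, to
     4. *)
  + apply: (tame_muts (ks := [:: 3%N])) => //.
    apply: (tame_tail (l := 0%N) (r := 2%N) (s0 := 3%N)) => //.
    * by case=> [|[|[|[|[|[|[|[|i]]]]]]]] // _ _; vm_compute.
    * by left.
    * by case=> [|[|[|[|[|[|[|[|i]]]]]]]] // _ _ _; vm_compute.
    * by move=> _ _; left.
    * apply: (tame_muts (ks := [:: 3%N])) => //; rewrite /bmuts [foldl _ _ _]/= bmutK.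
      apply: (tame_shift (d := 1) (n := n.+3)) (L n.+3 _) => //; last exact: ufam_shift.
      by move=> v; rewrite mem_filter mem_iota; case: v => [|v] //=; lia.
    * apply: (tame_muts (ks := [:: 3%N])) => //; rewrite /bmuts [foldl _ _ _]/= bmutK.
      apply: (tame_relabel (h := fun i => if i is i'.+1 then i'.+3 else 1%N)
        (b := bmut 0%N yfam) (Ms := iota 0 n.+2)).
      - by case=> [|i] [|j] // _ _ [->].
      - move=> v; rewrite !mem_filter mem_iota; apply/idP/mapP => [h|[[|w]]].
        + case: v h => [|[|[|v]]] //=; first by exists 0%N.
          by move=> h; exists v.+1 => //; rewrite (mem_iota 0 n.+2); lia.
        + by move=> _ ->.
        + by rewrite mem_iota => h ->; lia.
      - by move=> i j _ _; exact: ufam_yfam.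
      - by apply: (tame_mut (k := 0%N)) => //; rewrite bmutK; apply: Y; lia.
- case: n {IH U Y} L => [|[|[|n]]] L.
  + exact: tame_nil.
  + exact: tame_singleton.
  + apply: (tame_tail (l := 0%N) (r := 1%N) (s0 := 0%N)) => //; try by right.
    * by case=> [|[|i]].
    * by case=> [|[|i]].
    * by move=> _ _; left.
    * exact: tame_singleton.
    * exact: tame_nil.
  (* The leaf 0 hangs at 1; mutation at 2 cancels the arrow joining 1 to 3, if present. *)
  + apply: (tame_muts (ks := [:: 2%N])) => //.
    apply: (tame_tail (l := 0%N) (r := 1%N) (s0 := 2%N)) => //.
    * by case=> [|[|[|[|[|[|[|[|i]]]]]]]] // _ _; vm_compute.
    * by right.
    * by case=> [|[|[|[|[|[|[|[|i]]]]]]]] // _ _ _; vm_compute.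
    * by move=> _ _; left.
    * apply: (tame_muts (ks := [:: 2%N])) => //; rewrite /bmuts [foldl _ _ _]/= bmutK.
      apply: (tame_shift (d := 1) (n := n.+2)) (L n.+2 _) => //; last exact: yfam_shift.
      by move=> v; rewrite mem_filter mem_iota; case: v => [|v] //=; lia.
    * apply: (tame_muts (ks := [:: 2%N])) => //; rewrite /bmuts [foldl _ _ _]/= bmutK.
      apply: (tame_shift (d := 2) (n := n.+1)) (L n.+1 _) => //; last by move=> i j; rewrite yfam_shift.
      by move=> v; rewrite !mem_filter mem_iota; case: v => [|[|v]] //=; lia.
Qed.

End Ladders.
(** * The quivers Q_(k,l) *)

Definition qarrow (k : nat) (u v : nat + nat) : bool :=
  match u, v with
  | inl i, inl j => j == i.+1
  | inr i, inr j => j == i.+1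
  | inr i, inl j => j == i
  | inl i, inr j => (i == j.+1) && (j.+1 < k)%N
  end.

Definition arrow_matrix (V : Type) (arrow : rel V) (u v : V) : int :=
  (arrow u v : nat)%:Z - (arrow v u : nat)%:Z.

Definition qvertices (k l : nat) : seq (nat + nat) :=
  [seq inl i | i <- iota 0 (k + l)] ++ [seq inr i | i <- iota 0 k].

Lemma mem_qvertices k l u : (u \in qvertices k l) =
  match u with inl i => (i < k + l)%N | inr i => (i < k)%N end.
Proof.
rewrite mem_cat; case: u => i.
  rewrite mem_map; last by move=> a b [].
  rewrite mem_iota add0n /=; case: (boolP (inl i \in _)) => [/mapP[]|] //.
  by rewrite orbF.
rewrite orbC mem_map; last by move=> a b [].
rewrite mem_iota add0n /=; case: (boolP (inr i \in _)) => [/mapP[]|] //.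
by rewrite orbF.
Qed.

Definition qlabel (k v : nat) : nat + nat :=
  if odd v then inl (k.-1 - v./2)%N else inr (k.-1 - v./2)%N.

Lemma qlabel_arrow k i j : (i < k.*2)%N -> (j < k.*2)%N ->
  arrow_matrix (qarrow k) (qlabel k i) (qlabel k j) = lad i j.
Proof.
rewrite /qlabel => hi hj; rewrite /arrow_matrix /lad.
have := odd_double_half i; have := odd_double_half j.
by case: (odd i); case: (odd j) => /= hj' hi'; lia.
Qed.

Lemma qlabel_mem k i : (i < k.*2)%N ->
  match qlabel k i with inl v => (v < k)%N | inr v => (v < k)%N end.
Proof. by rewrite /qlabel; case: ifP => _; lia. Qed.

Lemma qlabel_inj k : {in gtn k.*2 &, injective (qlabel k)}.
Proof.
move=> i j; rewrite !inE /qlabel => hi hj.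
have := odd_double_half i; have := odd_double_half j.
by case: (odd i); case: (odd j) => //= hj' hi' [] ?; lia.
Qed.

Lemma qlabel_surj k u : match u with inl v => (v < k)%N | inr v => (v < k)%N end ->
  exists2 i, (i < k.*2)%N & u = qlabel k i.
Proof.
case: u => v h.
  exists (k.-1 - v).*2.+1; first by lia.
  by rewrite /qlabel /= odd_double /= uphalf_double; congr inl; lia.
exists (k.-1 - v).*2; first by lia.
by rewrite /qlabel odd_double doubleK; congr inr; lia.
Qed.

(** For l = 0 this is the ladder on 2k vertices, for l = 1 it is [ufam] with t_(k+1) as vertex 0.
    For larger l the end of the tail is a leaf whose neighbour has only one other neighbour, and
    both are removed. *)
Lemma tame_qarrow (C : numFieldType) k l : tame C (arrow_matrix (qarrow k)) (qvertices k l).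
Proof.
elim/ltn_ind: l => -[|[|l]] IH.
- have [T _ _] := tame_ladders C k.*2; apply: (tame_relabel (h := qlabel k)) T.
  + by move=> i j; rewrite !mem_iota !add0n => hi hj; apply: (@qlabel_inj k); rewrite inE.
  + move=> u; rewrite mem_qvertices addn0; apply/idP/mapP => [h|[w]].
      have [i hi ->] := qlabel_surj h.
      by exists i; rewrite // mem_iota add0n.
    by rewrite mem_iota add0n => /qlabel_mem hi ->; case: (qlabel k w) hi.
  + by move=> i j; rewrite !mem_iota !add0n; exact: qlabel_arrow.
- have [_ T _] := tame_ladders C k.*2.+1.
  apply: (tame_relabel (h := fun v => if v is v'.+1 then qlabel k v' else inl k)) T.
  + case=> [|i] [|j] //; rewrite !mem_iota !add0n.
    * by move=> _ /qlabel_mem; case: (qlabel k j) => //= a h [] ?; lia.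
    * by move=> /qlabel_mem + _; case: (qlabel k i) => //= a h [] ?; lia.
    * by move=> hi hj e; congr S; apply: (@qlabel_inj k); rewrite ?inE.
  + move=> u; rewrite mem_qvertices addn1; apply/idP/mapP => [h|[[|i]]].
    * have [->|uk] := eqVneq u (inl k); first by exists 0%N.
      have [|i hi ->] := @qlabel_surj k u.
        by case: u h uk => // v h vk; rewrite ltn_neqAle -ltnS h andbT; apply: contra_neq vk => ->.
      by exists i.+1 => //; rewrite mem_iota.
    * by rewrite mem_iota => _ ->.
    * by rewrite mem_iota add0n => /qlabel_mem hi ->; case: (qlabel k i) hi => //= a; exact: leqW.
  + have kq j : (j < k.*2)%N -> arrow_matrix (qarrow k) (inl k) (qlabel k j) = ufam 0 j.+1.
      rewrite /qlabel /arrow_matrix /ufam /lad => hj; have := odd_double_half j.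
      case: j hj => [|j] hj; first by rewrite /= subn0; lia.
      by case: (odd j.+1) => hj'; rewrite /= ?andbF /=; lia.
    have anti (V : Type) (a : rel V) u v : arrow_matrix a u v = - arrow_matrix a v u.
      by rewrite /arrow_matrix opprB.
    case=> [|i] [|j]; rewrite !mem_iota !add0n => hi hj.
    * by rewrite /arrow_matrix subrr.
    * exact: kq.
    * rewrite anti kq // /ufam /lad; case: i hi => [|i] hi //=; case: eqP; lia.
    * by rewrite qlabel_arrow ?ufam_shift.
- apply: (tame_tail (l := inl (k + l.+1)%N) (r := inl (k + l)%N) (s0 := inl (k + l).-1)).
  + by rewrite mem_qvertices; lia.
  + by rewrite mem_qvertices; lia.
  + by apply/eqP => -[]; lia.
  + case=> i; rewrite mem_qvertices /arrow_matrix /= => hi.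
      move=> h; have {}h : i != (k + l)%N by apply: contra_neq h => ->.
      by lia.
    by move=> _; lia.
  + by left; rewrite /arrow_matrix /=; lia.
  + case=> i; rewrite mem_qvertices /arrow_matrix /= => hi h1 h2 h3; exfalso.
      have {}h1 : i != (k + l.+1)%N by apply: contra_neq h1 => ->.
      have {}h2 : i != (k + l).-1 by apply: contra_neq h2 => ->.
      by move: h3; lia.
    by move: h3; lia.
  + by move=> _ h; move: h; rewrite /arrow_matrix /= => h; lia.
  + apply: (tame_relabel (h := id)) (IH l.+1 _) => // u; rewrite map_id mem_filter !mem_qvertices.
    by case: u => i; rewrite ?andTb // (inj_eq (@inl_inj _ _)); lia.
  + apply: (tame_relabel (h := id)) (IH l _) => // u; rewrite map_id !mem_filter !mem_qvertices.
    by case: u => i; rewrite ?andTb // !(inj_eq (@inl_inj _ _)); lia.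
Qed.
(** * Comparison with the cluster varieties *)

Section Comparison.
Variables (C : numFieldType) (K : fieldType) (iota : {rmorphism C -> K}) (n m : nat).
Implicit Types (s : seed K n m) (t : sd K (n + m)) (ks : seq 'I_n).
Local Notation emb := (@lshift n m).

(** The rectangular matrix is completed to a square skew-symmetric one, with zero block between
    frozen vertices. *)
Definition sd_of s : sd K (n + m) :=
  Sd (variables s) (fun i j => match split j, split i with
    | inl j', _ => exchange_matrix s i j'
    | inr _, inl i' => - exchange_matrix s j i'
    | inr _, inr _ => 0
    end).

(* Mutation may create arrows between frozen vertices in [t]; they play no
   role. *)
Definition models t s := vx t =1 variables s /\
  forall i j, vB t i (emb j) = exchange_matrix s i j.

Lemma models_sd_of s : models (sd_of s) s.
Proof. by split=> // i j; rewrite /= -[lshift m j]/(unsplit (inl j)) unsplitK. Qed.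

Lemma sd_of_gseed s : is_seed iota s -> gseed iota (sd_of s).
Proof.
case=> fx sk; split=> // i j.
rewrite /=; case: (split_ordP i) => i' ei; case: (split_ordP j) => j' ej; rewrite ?ei ?ej.
- by move/matrixP: sk => /(_ j' i'); rewrite !mxE.
- by [].
- by rewrite opprK.
- by rewrite oppr0.
Qed.

Lemma models_mu t s k : models t s -> models (mu (emb k) t) (mutate k s).
Proof.
case=> hx hB; split=> [i|i j]; last first.
  by rewrite /= mxE /bmut !hB (inj_eq (@lshift_inj n m)).
have zE (a : int) : zpos a = if 0 < a then `|a|%N%:Z else 0.
  by case: ltP => h; [rewrite zpos_id ?ltW //; lia|rewrite zpos_0].
rewrite /= ffunE; case: ifP => // /eqP ->; rewrite hx; congr (_ * (_ + _)).
  rewrite big_mkcond; apply: eq_bigr => j _; rewrite hx hB zE.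
  by case: ifP; rewrite ?expr0z.
rewrite big_mkcond; apply: eq_bigr => j _; rewrite hx hB zE oppr_gt0 abszN.
by case: ifP; rewrite ?expr0z.
Qed.

Lemma models_mus t s ks : models t s -> models (mus t (map emb ks)) (mutate_seq s ks).
Proof. by elim: ks t s => //= k ks IH t s h; apply: IH; exact: models_mu. Qed.

Definition mutables : {set 'I_(n + m)} := [set emb i | i : 'I_n].

Lemma emb_mutable i : emb i \in mutables. Proof. exact: imset_f. Qed.

Lemma rshift_frozen j : rshift n j \notin mutables.
Proof. by apply/imsetP => -[i _ /eqP]; rewrite eq_rlshift. Qed.

Lemma all_mutables ks : all (fun k => k \in mutables) (map emb ks).
Proof. by apply/allP => k /mapP[i _ ->]; exact: emb_mutable. Qed.

Lemma mutables_map (ls : seq 'I_(n + m)) : all (fun k => k \in mutables) ls ->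
  exists ks, ls = map emb ks.
Proof.
elim: ls => [|l ls IH] /=; first by exists [::].
by case/andP=> /imsetP[i _ ->] /IH[ks ->]; exists (i :: ks).
Qed.

Lemma alg_models s t a : models t s -> alg iota mutables t a <-> in_cluster_algebra iota s a.
Proof.
move=> h; split; elim=> {a} [c|ls i|i|a b _ ha _ hb|a b _ ha _ hb].
- exact: in_ca_const.
- move=> /mutables_map[ks ->] _; have [-> _] := models_mus ks h.
  exact: in_ca_var.
- case: (split_ordP i) => j ->; first by rewrite emb_mutable.
  by case: h => -> _ _ _; exact: in_ca_frozenV.
- exact: in_ca_add.
- exact: in_ca_mul.
- exact: inA_const.
- have [<- _] := models_mus ls h.
  by apply: inA_var; rewrite ?inE // all_mutables.
- by case: h => <- _; apply: inA_inv; rewrite ?inE // rshift_frozen.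
- exact: inA_add.
- exact: inA_mul.
Qed.

End Comparison.

(** * Automorphisms and points of the cluster variety *)

Section ClusterPoints.
Variables (C : numFieldType) (K : fieldType) (iota : {rmorphism C -> K}) (n m : nat).
Variable s : seed K n m.
Hypothesis ss : is_seed iota s.
Local Notation A := (cluster_algebra iota s).
Local Notation t := (sd_of s).
Local Notation M := (mutables n m).
Local Notation emb := (@lshift n m).

Let gs : gseed iota t := sd_of_gseed ss.

Lemma algP a : reflect (alg iota M t a) (a \in ca_pred iota s).
Proof.
apply: (iffP idP) => [/asboolP|h]; first by case: (alg_models iota a (models_sd_of s)) => _; apply.
by apply/asboolP; case: (alg_models iota a (models_sd_of s)) => + _; apply.
Qed.

Lemma ca_varE ks i : val (ca_var iota s ks i) = vx (mus t (map emb ks)) i.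
Proof. by have [-> _] := models_mus ks (models_sd_of s). Qed.

Section Scaling.
Variables (c : 'I_(n + m) -> C) (g : K -> K).
Hypotheses (T : torus M t c) (S : scaling iota t c g).

Lemma scaling_pred (u : A) : g (val u) \in ca_pred iota s.
Proof. by apply/algP; apply: (scaling_inA gs T S); apply/algP; case: u. Qed.

Definition ca_aut (u : A) : A := ClusterElt (scaling_pred u).

Lemma ca_aut_additive : zmod_morphism ca_aut.
Proof.
move=> u v; apply: val_inj => /=; rewrite -[- val v]mulN1r -(rmorphN1 iota).
by rewrite (scal_add S) (scal_mul S) (scal_const S) rmorphN1 mulN1r.
Qed.

Lemma ca_aut_multiplicative : monoid_morphism ca_aut.
Proof.
split=> [|u v]; apply: val_inj; first by rewrite /= (scal1 S).
by rewrite /= (scal_mul S).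
Qed.

Lemma ca_aut_scalable : scalable ca_aut.
Proof. by move=> a u; apply: val_inj; rewrite /= (scal_mul S) (scal_const S). Qed.

HB.instance Definition _ := GRing.isZmodMorphism.Build A A ca_aut ca_aut_additive.
HB.instance Definition _ := GRing.isMonoidMorphism.Build A A ca_aut ca_aut_multiplicative.
HB.instance Definition _ := GRing.isScalable.Build C A A *:%R ca_aut ca_aut_scalable.

Definition ca_automorphism : {lrmorphism A -> A} := ca_aut.

End Scaling.

(** Both maps are determined on Laurent polynomials by the initial variables, and the Laurent
    phenomenon places the algebra among these. *)
Lemma scaling_inv c g h a : scaling iota t c g -> scaling iota t (fun i => (c i)^-1) h ->
  (forall i, c i != 0) -> alg iota M t a -> h (g a) = a.
Proof.
move=> S S' c0 /(inA_laurent gs).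
have hx i : h (g (vx t i)) = vx t i.
  rewrite (scal_var S) (scal_mul S') (scal_const S') (scal_var S') mulrA -rmorphM.
  by rewrite divff // rmorph1 mul1r.
elim=> [b|ks i h0 _|i _ _|u v _ hu _ hv|u v _ hu _ hv].
- by rewrite (scal_const S) (scal_const S').
- rewrite (all_set0 h0).
  exact: hx.
- have xi := gseed_neq0 i gs.
  rewrite (scal_inv S xi) (scal_inv S') ?hx // (scal_var S) mulf_neq0 //.
  by rewrite fmorph_eq0.
- by rewrite (scal_add S) (scal_add S') hu hv.
- by rewrite (scal_mul S) (scal_mul S') hu hv.
Qed.

Lemma ca_automorphism_scales c g (T : torus M t c) (S : scaling iota t c g) ks i :
  exists c' : C,
    c' != 0 /\ ca_automorphism T S (ca_var iota s ks i) = c' *: ca_var iota s ks i.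
Proof.
 have [c' T' S'] := scaling_mus gs (all_mutables m ks) T S.
exists (c' i); split; first exact: (torus_neq0 T').
by apply: val_inj; have /= -> := ca_varE ks i; rewrite (scal_var S').
Qed.

Lemma torus_inv (c : 'I_(n + m) -> C) : torus M t c -> torus M t (fun i => (c i)^-1).
Proof.
case=> c0 cf col; split=> [i|i /cf ->|j jM]; rewrite ?invr_eq0 ?invr1 //.
rewrite -[RHS]invr1 -(col j jM) -monN; apply: eq_bigr => i _.
by rewrite exprz_inv.
Qed.

Lemma ca_automorphism_bij c g (T : torus M t c) (S : scaling iota t c g) :
  bijective (ca_automorphism T S).
Proof.
have T' := torus_inv T; have [h S'] := scaling_exists gs (torus_neq0 T').
have S2 : scaling iota t (fun i => ((c i)^-1)^-1) g.
  by case: S => *; split=> // i; rewrite invrK.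
exists (ca_automorphism T' S') => u; apply: val_inj => /=.
  by apply: (scaling_inv S S' (torus_neq0 T)); apply/algP; case: u.
by apply: (scaling_inv S' S2 (torus_neq0 T')); apply/algP; case: u.
Qed.

Variable p : cluster_variety iota s.

Definition eval_at (a : K) : C :=
  if pselect (a \in ca_pred iota s) is left h then p (ClusterElt h) else 0.

Lemma eval_at_val (u : A) : eval_at (val u) = p u.
Proof.
rewrite /eval_at; case: pselect => [h|]; last by case: u.
by congr (p _); apply: val_inj.
Qed.

Lemma eval_atE a (h : a \in ca_pred iota s) : eval_at a = p (ClusterElt h).
Proof. by rewrite -eval_at_val. Qed.

Lemma point_eval : point iota M t eval_at.
Proof.
split=> [c|a b /algP ha /algP hb|a b /algP ha /algP hb].
- rewrite -[iota c]/(val (ca_const iota s c)) eval_at_val.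
  have -> : ca_const iota s c = c *: 1 by apply: val_inj; exact/esym/mulr1.
  by rewrite linearZ rmorph1; exact: mulr1.
- by rewrite (eval_atE ha) (eval_atE hb) -rmorphD; exact: (eval_at_val (ClusterElt ha + ClusterElt hb)).
- by rewrite (eval_atE ha) (eval_atE hb) -rmorphM; exact: (eval_at_val (ClusterElt ha * ClusterElt hb)).
Qed.

(** The locus asks for some vanishing variable, [deep] for a mutable one; they agree because frozen
    variables are units. *)
Lemma deep_eval : deep_locus iota s p <-> deep M t eval_at.
Proof.
split=> h.
  move=> ls /mutables_map[ks ->]; apply: contrapT => no; apply: h; exists ks => // i.
  have e : eval_at (vx (mus t (map emb ks)) i) = p (ca_var iota s ks i).
    by rewrite -ca_varE eval_at_val.
  rewrite -e; apply/eqP => i0; apply: no; exists i => //.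
  apply: contraTT isT => iM.
  have := pt_frozen (proj1 (point_mus eval_at gs (all_mutables m ks)) point_eval) (mus_gseed _ gs) iM.
  by rewrite i0 eqxx.
move=> [ks _ hks]; have [i _] := h (map emb ks) (all_mutables m ks).
by rewrite -ca_varE eval_at_val => e; have := hks i; rewrite e eqxx.
Qed.

Lemma deep_stabilized : no_mystery iota M t -> deep_locus iota s p -> stabilizer_locus iota s p.
Proof.
move=> G /deep_eval /(G _ point_eval)[c [g [T [i ci] S h]]].
exists (ca_automorphism T S).
  split; last by move=> u; rewrite /= -(eval_at_val u) -(eval_at_val (ca_aut T S u)); apply: h; apply/algP; case: u.
  by split; [exact: ca_automorphism_bij|exact: ca_automorphism_scales].
move=> e; have := congr1 val (e (ca_var iota s [::] i)).
rewrite /= -[variables s i]/(vx t i) (scal_var S) -[RHS]mul1r.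
move/(mulIf (gseed_neq0 i gs)) => /eqP.
by rewrite -(rmorph1 iota) (inj_eq (fmorph_inj _)) (negbTE ci).
Qed.

(** On a cluster torus no variable of the seed vanishes at the point, so an automorphism fixing the
    point scales each of them by 1; by the Laurent phenomenon it is then the identity. *)
Lemma stabilizer_deep : stabilizer_locus iota s p -> deep_locus iota s p.
Proof.
move=> [g [[_ scl] pg] nid] [ks _ hks]; apply: nid => u.
have fixv i : g (ca_var iota s ks i) = ca_var iota s ks i.
  have [c [c0 e]] := scl ks i; have := pg (ca_var iota s ks i).
  rewrite /= e linearZ -[RHS]mul1r => /(mulIf (hks i)) ->.
  by rewrite scale1r.
(* Every element of A is a quotient of two elements fixed by g. *)
have fixl a : laurent iota (mus t (map emb ks)) a ->
    exists d e : A, [/\ val d != 0, g d = d, g e = e & a * val d = val e].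
  elim=> {a} [c|ls i h _|i _ _|a b _ [d [e [d0 gd ge ha]]] _ [d' [e' [d'0 gd' ge' hb]]]
             |a b _ [d [e [d0 gd ge ha]]] _ [d' [e' [d'0 gd' ge' hb]]]].
  - exists 1, (c *: 1); split; rewrite ?rmorph1 ?linearZ ?rmorph1 ?oner_neq0 //.
  - rewrite (all_set0 h).
    exists 1, (ca_var iota s ks i).
    by split; rewrite ?rmorph1 ?oner_neq0 ?fixv // mulr1 ca_varE.
  - exists (ca_var iota s ks i), 1; have x0 := gseed_neq0 i (mus_gseed (map emb ks) gs).
    by split; rewrite ?rmorph1 ?fixv // ca_varE ?mulVf.
  - exists (d * d'), (e * d' + e' * d); split.
    + by rewrite rmorphM mulf_neq0.
    + by rewrite rmorphM /= gd gd'.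
    + by rewrite rmorphD !rmorphM /= gd gd' ge ge'.
    + by move: ha hb; rewrite /= => <- <-; ring.
  - exists (d * d'), (e * e'); split.
    + by rewrite rmorphM mulf_neq0.
    + by rewrite rmorphM /= gd gd'.
    + by rewrite rmorphM /= ge ge'.
    + by move: ha hb; rewrite /= => <- <-; ring.
have [|d [e [d0 gd ge h]]] := fixl (val u).
  apply: (@inA_laurent _ _ _ _ M finset.set0); first exact: mus_gseed gs.
  by apply/inA_mus; [exact: gs|exact: all_mutables|apply/algP; case: u].
have ud : u * d = e by apply: val_inj; exact: h.
have {}h : g u * d = u * d by rewrite -{1}gd -rmorphM ud; exact: ge.
by apply: val_inj; apply: (mulIf d0); exact: (congr1 val h).
Qed.

End ClusterPoints.

Lemma no_mysterious_points (C : numFieldType) (K : fieldType) (iota : {rmorphism C -> K})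
    n m (s : seed K n m) : is_seed iota s -> no_mystery iota (mutables n m) (sd_of s) ->
  mysterious_points iota s = set0 /\ deep_locus iota s = stabilizer_locus iota s.
Proof.
move=> ss G; have e : deep_locus iota s = stabilizer_locus iota s.
  apply/seteqP; split=> p; first exact: deep_stabilized.
  exact: stabilizer_deep.
by split=> //; rewrite /mysterious_points e setDv.
Qed.

(** * From tame quivers to cluster algebras of type Q_(k,l) *)

Lemma tame_embedding (C : numFieldType) (W : eqType) (b : W -> W -> int) (Ms : seq W)
    (K : fieldType) (iota : {rmorphism C -> K}) n N (t : sd K N)
    (h : 'I_n -> W) (e : 'I_n -> 'I_N) :
  tame C b Ms -> gseed iota t -> injective h -> injective e -> Ms =i codom h ->
  (forall i j, vB t (e i) (e j) = b (h i) (h j)) ->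
  no_mystery iota [set e i | i : 'I_n] t.
Proof.
move=> T gt ih ie hM hb; case: n h e ih ie hM hb => [|n] h e ih ie hM hb.
  (* Without mutable vertices there is no default value for [f] below, but a deep point would need a
     vanishing mutable variable. *)
  by move=> phi _ /(_ [::] isT)[i /imsetP[[]]].
pose f w := e (odflt ord0 [pick i | h i == w]).
have fh i : f (h i) = e i.
  by rewrite /f; case: pickP => [j /eqP/ih -> //|/(_ i)]; rewrite eqxx.
have -> : [set e i | i : 'I_n.+1] = [set v in map f Ms].
  apply/setP => v; rewrite !inE; apply/imsetP/mapP => [[i _ ->]|[w]].
    by exists (h i); rewrite ?fh // hM codom_f.
  by rewrite hM => /codomP[i ->]; rewrite fh; exists i.
apply: (proj2 (T K iota N t f gt _ _)) => i j; rewrite !hM => /codomP[i' ->] /codomP[j' ->].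
  by rewrite !fh => /ie ->.
by rewrite !fh.
Qed.

Lemma exchange_mutate_seq (K : fieldType) n m (s : seed K n m) ks i j :
  exchange_matrix (mutate_seq s ks) (lshift m i) j =
  quiver_mut_seq (principal_part (exchange_matrix s)) ks i j.
Proof.
have -> : quiver_mut_seq (principal_part (exchange_matrix s)) ks =
    principal_part (exchange_matrix (mutate_seq s ks)); last by rewrite mxE.
elim: ks s => //= k ks IH s; rewrite -IH; congr (quiver_mut_seq _ ks).
by apply/matrixP => a b; rewrite !mxE (inj_eq (@lshift_inj n m)).
Qed.

Definition qvertex k l (u : 'I_(k + l) + 'I_k) : nat + nat :=
  match u with inl i => inl (val i) | inr i => inr (val i) end.

Lemma Qkl_no_mysterious_points (C : numFieldType) (K : fieldType) (iota : {rmorphism C -> K})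
    n m (s : seed K n m) : is_seed iota s -> Qkl_type s ->
  mysterious_points iota s = set0 /\ deep_locus iota s = stabilizer_locus iota s.
Proof.
move=> ss [k [l [ks [f [[f' fK f'K] hf]]]]]; apply: no_mysterious_points => //.
have gs := sd_of_gseed ss.
apply/(no_mystery_mus gs (all_mutables m ks)).
apply: (@tame_embedding _ _ _ _ _ _ n _ _ (fun i => qvertex (f i)) (@lshift n m)
  (@tame_qarrow C k l)).
- exact: mus_gseed.
- have inj_qv : injective (@qvertex k l) by case=> a [] b // [] /val_inj ->.
  by apply: inj_comp => //; exact: (can_inj fK).
- exact: lshift_inj.
- move=> u; rewrite mem_qvertices; apply/idP/codomP => [|[i ->]]; last first.
    by case: (f i) => a /=.
  case: u => a h; first by exists (f' (inl (Ordinal h))); rewrite f'K.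
  by exists (f' (inr (Ordinal h))); rewrite f'K.
- move=> i j; have [_ ->] := models_mus ks (models_sd_of s).
  rewrite exchange_mutate_seq hf /arrow_matrix.
  by case: (f i) => a; case: (f j) => b.
Qed.
(** * Simply laced Dynkin quivers *)

Section Trees.
Variable par : nat -> nat.
Hypothesis par_lt : forall i, (0 < i)%N -> (par i < i)%N.

(* The vertices are numbered so that the parent of i > 0 is par i < i; [o i]
   tells whether the edge between them is directed from [par i] to [i]. *)
Definition tree_matrix (o : nat -> bool) (i j : nat) : int :=
  if (0 < j)%N && (i == par j) then (-1) ^+ ~~ o j
  else if (0 < i)%N && (j == par i) then (-1) ^+ o i else 0.

Definition flip_at (v : nat) (o : nat -> bool) (j : nat) : bool :=
  if (j == v) || (par j == v) then ~~ o j else o j.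

(* [e] tells whether [v] is a sink or a source. *)
Inductive reorients (n : nat) (o o' : nat -> bool) : Prop :=
| reorients_refl : (forall j, (0 < j < n)%N -> o j = o' j) -> reorients n o o'
| reorients_step v e : (v < n)%N ->
    (forall j, (0 < j < n)%N -> (j = v -> o j = e) /\ (par j = v -> o j = ~~ e)) ->
    reorients n (flip_at v o) o' -> reorients n o o'.

(** The last vertex is a leaf, hence always a sink or a source, and can be flipped freely. It is
    flipped before a flip at its parent whenever its edge would obstruct that flip, and once more at
    the end if necessary. *)
Lemma reorients_leaf n o o' o1 o2 : (0 < n)%N -> reorients n o o' ->
  (forall j, (0 < j < n)%N -> o1 j = o j) -> (forall j, (0 < j < n)%N -> o2 j = o' j) ->
  reorients n.+1 o1 o2.
Proof.
move=> n0 r; elim: r o1 => {o o'} [o o' e|o o' v e vn adm _ IH] o1 h1 h2.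
  have [en|en] := eqVneq (o1 n) (o2 n).
    apply: reorients_refl => j /andP[j0]; rewrite ltnS leq_eqVlt => /orP[/eqP -> //|jn].
    by rewrite h1 ?h2 ?j0 // e // j0.
  apply: (@reorients_step _ _ _ n (o1 n)) => //.
    by move=> j /andP[j0 jn]; split=> [-> //|]; have := par_lt j0; lia.
  apply: reorients_refl => j /andP[j0 jn]; rewrite /flip_at.
  have -> : (par j == n) = false by have := par_lt j0; lia.
  have [->|jn'] := eqVneq j n; first by move: en; case: (o1 n); case: (o2 n).
  by rewrite h1 ?h2 ?e //; lia.
have main o3 : (forall j, (0 < j < n)%N -> o3 j = o j) ->
    (par n = v -> o3 n = ~~ e) -> reorients n.+1 o3 o2.
  move=> h3 hn; apply: (@reorients_step _ _ _ v e); first by lia.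
    move=> j /andP[j0]; rewrite ltnS leq_eqVlt => /orP[/eqP ->|jn].
      by split=> //; lia.
    by rewrite h3 ?j0 //; apply: adm; rewrite j0.
  by apply: IH => // j jn; rewrite /flip_at h3.
have [en|en] := boolP ((par n == v) ==> (o1 n == ~~ e)).
  by apply: main => // /eqP pn; move: en; rewrite pn => /eqP.
have {en}[pn on] : par n = v /\ o1 n = e.
  by move: en; rewrite negb_imply => /andP[/eqP -> /eqP en]; split=> //; case: (o1 n) (e) en => -[].
apply: (@reorients_step _ _ _ n (o1 n)) => //.
  by move=> j /andP[j0 jn]; split=> [-> //|]; have := par_lt j0; lia.
apply: main => [j /andP[j0 jn]|_]; last by rewrite /flip_at eqxx on.
rewrite /flip_at -h1 ?j0 //.
have -> : (par j == n) = false by have := par_lt j0; lia.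
by have -> : (j == n) = false by lia.
Qed.

Lemma reorients_all n o o' : reorients n o o'.
Proof.
elim: n o o' => [|[|n] IH] o o'; first by apply: reorients_refl; lia.
  by apply: reorients_refl; lia.
exact: reorients_leaf (IH o o') _ _.
Qed.

(** No path of length two passes through a sink or a source, so the correction terms of the mutation
    vanish. *)
Lemma bmut_sink_source (b : nat -> nat -> int) n v (e : bool) :
  (forall i, (i < n)%N -> 0 <= (-1) ^+ e * b v i) ->
  (forall i, (i < n)%N -> 0 <= (-1) ^+ (~~ e) * b i v) ->
  forall i j, (i < n)%N -> (j < n)%N ->
  bmut v b i j = if (i == v) || (j == v) then - b i j else b i j.
Proof.
move=> h h' i j hi hj; rewrite /bmut; case: ifP => // _; move: (h j hj) (h' i hi).
case: e {h h'} => /=; rewrite ?expr0 ?expr1 ?mul1r ?mulN1r ?oppr_ge0 => h1 h2.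
  by rewrite (zpos_0 h1) (@zpos_0 (- b i v)%R) ?oppr_le0 // mulr0 mul0r subr0 addr0.
by rewrite (zpos_0 h2) (@zpos_0 (- b v j)%R) ?oppr_le0 // mulr0 mul0r subr0 addr0.
Qed.

Lemma bmuts_eq (b b' : nat -> nat -> int) n ks : all (gtn n) ks ->
  (forall i j, (i < n)%N -> (j < n)%N -> b i j = b' i j) ->
  forall i j, (i < n)%N -> (j < n)%N -> bmuts b ks i j = bmuts b' ks i j.
Proof.
elim: ks b b' => [|k ks IH] b b' //= /andP[kn h] e; apply: IH => // i j hi hj.
by rewrite /bmut !e.
Qed.

Lemma reorients_bmuts n o o' : reorients n o o' ->
  exists2 ks, all (gtn n) ks & forall i j, (i < n)%N -> (j < n)%N ->
    bmuts (tree_matrix o) ks i j = tree_matrix o' i j.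
Proof.
elim=> {o o'} [o o' e|o o' v e vn adm _ [ks h hks]].
  exists [::] => // i j hi hj; rewrite /= /tree_matrix.
  have [/andP[j0 _]|_] := boolP ((0 < j)%N && (i == par j)); first by rewrite e ?j0.
  by have [/andP[i0 _]|//] := boolP ((0 < i)%N && (j == par i)); rewrite e ?i0.
exists (v :: ks); first by apply/andP.
move=> i j hi hj; rewrite -hks //=; apply: (bmuts_eq h) => // {hi hj}{}i {}j hi hj.
rewrite (@bmut_sink_source _ n v e) //.
- rewrite /tree_matrix /flip_at.
  have [/andP[j0 /eqP ->]|_] := boolP ((0 < j)%N && (i == par j)).
    by rewrite orbC; case: ifP => // _; rewrite negbK; case: (o j).
  have [/andP[i0 /eqP ->]|_] := boolP ((0 < i)%N && (j == par i)).
    by case: ifP => // _; case: (o i).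
  by rewrite oppr0 if_same.
- move=> k hk; rewrite /tree_matrix.
  have [/andP[k0 /eqP pk]|_] := boolP ((0 < k)%N && (v == par k)).
    by have [_ -> //] := adm k ltac:(lia); case: (e).
  have [/andP[v0 /eqP pk]|_] := boolP ((0 < v)%N && (k == par v)).
    by have [-> // _] := adm v ltac:(lia); case: (e).
  by rewrite mulr0.
- move=> k hk; rewrite /tree_matrix.
  have [/andP[v0 /eqP pk]|_] := boolP ((0 < v)%N && (k == par v)).
    by have [-> // _] := adm v ltac:(lia); case: (e).
  have [/andP[k0 /eqP pk]|_] := boolP ((0 < k)%N && (v == par k)).
    by have [_ -> //] := adm k ltac:(lia); case: (e).
  by rewrite mulr0.
Qed.

End Trees.

Definition dynkin_parent (d : dynkin) (j : nat) : nat :=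
  match d with
  | DynkinA n => j.-1
  | DynkinD n => if j == n.-1 then (n - 3)%N else j.-1
  | DynkinE n => if j == n.-1 then 2%N else j.-1
  end.

Lemma dynkin_parent_lt d : dynkin_valid d ->
  forall i, (0 < i)%N -> (dynkin_parent d i < i)%N.
Proof. by case: d => n /= hn i hi; try case: eqP; lia. Qed.

Lemma dynkin_half_edgeE d i j : dynkin_valid d -> (i < dynkin_rank d)%N -> (j < dynkin_rank d)%N ->
  dynkin_half_edge d i j = (0 < j)%N && (i == dynkin_parent d j).
Proof.
case: d => n; rewrite /= /branched_edge => hn hi hj; first by lia.
  by have [->|h] := eqVneq j n.-1; lia.
by have [->|h] := eqVneq j n.-1; lia.
Qed.

Lemma orientation_tree d (arrow : rel 'I_(dynkin_rank d)) :
  dynkin_valid d -> orientation_of (@dynkin_edge d) arrow ->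
  exists o, forall i j, arrow_matrix arrow i j = tree_matrix (dynkin_parent d) o i j.
Proof.
move=> vd ori; set par := dynkin_parent d.
exists (fun j => [exists u : 'I_(dynkin_rank d), exists v : 'I_(dynkin_rank d),
  [&& val u == par j, val v == j & arrow u v]]) => i j.
have oE (u v : 'I_(dynkin_rank d)) : u = par v :> nat ->
    [exists u : 'I_(dynkin_rank d), exists v' : 'I_(dynkin_rank d),
      [&& val u == par v, val v' == v & arrow u v']] = arrow u v.
  move=> uv; apply/existsP/idP => [[u' /existsP[v' /and3P[/eqP hu /eqP hv]]]|h].
    have -> : u' = u by apply: val_inj; rewrite /= hu.
    by have -> : v' = v by apply: val_inj.
  by exists u; apply/existsP; exists v; rewrite /= uv !eqxx.
have := ori i j; rewrite /dynkin_edge !dynkin_half_edgeE // /tree_matrix -/par /arrow_matrix.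
have [/andP[j0 /eqP ij]|_] := boolP ((0 < j)%N && (i == par j :> nat)).
  by rewrite (oE i j ij); case: (arrow i j); case: (arrow j i) => -[].
have [/andP[i0 /eqP ji]|_] := boolP ((0 < i)%N && (j == par i :> nat)).
  by rewrite (oE j i ji); case: (arrow i j); case: (arrow j i) => -[].
by case: (arrow i j); case: (arrow j i) => -[].
Qed.

(** * Mutation of Dynkin trees into Q_(k,l) *)

Definition mutates_to_Q (r : nat) (b : nat -> nat -> int) := exists k l ks (h : nat -> nat + nat),
  [/\ (k + l + k = r)%N, all (gtn r) ks, {in gtn r &, injective h},
      forall i, (i < r)%N -> h i \in qvertices k l
    & forall i j, (i < r)%N -> (j < r)%N ->
        bmuts b ks i j = arrow_matrix (qarrow k) (h i) (h j)].

Lemma mutates_to_Q_check r b k l ks (q : seq (nat + nat)) :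
  (k + l + k = r)%N -> all (gtn r) ks -> size q = r -> uniq q ->
  all (fun u => u \in qvertices k l) q ->
  all (fun i => all (fun j => bmuts b ks i j ==
     arrow_matrix (qarrow k) (nth (inl 0%N) q i) (nth (inl 0%N) q j)) (iota 0 r)) (iota 0 r) ->
  mutates_to_Q r b.
Proof.
move=> e hks sq uq hq hb; exists k, l, ks, (nth (inl 0%N) q); split=> //.
- by move=> i j hi hj /eqP; rewrite nth_uniq ?sq // => /eqP.
- by move=> i hi; apply: (allP hq); rewrite mem_nth ?sq.
- move=> i j hi hj; apply/eqP; have /allP := hb; move=> /(_ i).
  by rewrite mem_iota => /(_ hi)/allP/(_ j); rewrite mem_iota; apply.
Qed.

(* Mutating Q_(2,n-4) at b_1 gives a tree of type D_n with branch vertex b_1. *)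
Lemma type_D_mutates_to_Q n :
  mutates_to_Q n.+4 (tree_matrix (dynkin_parent (DynkinD n.+4)) xpred0).
Proof.
set T := tree_matrix _ _.
have TE i j : T i j = ((i == j.+1) && (i != n.+3) || (i == n.+3) && (j == n.+1))%N%:Z
                    - ((j == i.+1) && (j != n.+3) || (j == n.+3) && (i == n.+1))%N%:Z.
  rewrite /T /tree_matrix /dynkin_parent; have -> : (n.+4 - 3 = n.+1)%N by lia.
  rewrite /= expr0 expr1.
  by case: (eqVneq i n.+3) => ?; case: (eqVneq j n.+3) => ?; do !case: ifP => ?; lia.
pose leaf i := (i == n.+2) || (i == n.+3).
have T1 i : T i n.+1 = (leaf i)%:Z - (i == n)%:Z by rewrite TE /leaf; lia.
have T2 j : T n.+1 j = (j == n)%:Z - (leaf j)%:Z by rewrite TE /leaf; lia.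
have TB i j : bmut n.+1 T i j = if (i == n.+1) || (j == n.+1) then - T i j
    else T i j + (leaf i && (j == n))%:Z - ((i == n) && leaf j)%:Z.
  rewrite /bmut; case: ifP => // _; rewrite T1 T2.
  have ln v : ~~ (leaf v && (v == n)) by rewrite /leaf; lia.
  by move: (ln i) (ln j); case: (leaf i) (i == n) (leaf j) (j == n) => -[] [] [].
exists 2%N, n, [:: n.+1], (fun i => if i == n.+1 then inr 0%N else if i == n.+2 then inl 0%N
  else if i == n.+3 then inr 1%N else inl (n.+1 - i)%N); split=> //=.
- by lia.
- by lia.
- move=> i j; rewrite !inE /= => hi hj.
  by do !case: eqP => ? //; first [case=> *; lia|move=> _; lia].
- by move=> i hi; do !case: eqP => ? //; rewrite mem_qvertices /=; lia.
- move=> i j hi hj; rewrite TB TE /leaf /arrow_matrix.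
  by do !case: eqP => /= ?; lia.
Qed.

Lemma tree_mutates_to_Q d : dynkin_valid d ->
  exists o, mutates_to_Q (dynkin_rank d) (tree_matrix (dynkin_parent d) o).
Proof.
case: d => n /= hn.
- exists xpredT, 0%N, n, [::], inl; split=> //; first by lia.
  + by move=> i j _ _ [].
  + by move=> i hi; rewrite mem_qvertices.
  + by move=> i j hi hj; rewrite /= /tree_matrix /arrow_matrix /=; do !case: ifP; lia.
- case: n hn => [|[|[|[|n]]]] // _; exists xpred0; exact: type_D_mutates_to_Q.
(* The mutations take place at the branch vertex 2 and its path neighbours 1 and 3. For ranks 7 and
   8 the edge to the last vertex, the short arm, is directed towards the branch vertex. *)
- have : n \in [:: 6; 7; 8]%N by rewrite !inE; lia.
  rewrite !inE => /or3P[] /eqP ->.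
  + exists xpredT; apply: (@mutates_to_Q_check _ _ 3 0 [:: 2; 3; 1]%N
      [:: inr 0; inl 1; inr 2; inl 2; inl 0; inr 1]%N) => //; by vm_compute.
  + exists (fun j => j != 6)%N; apply: (@mutates_to_Q_check _ _ 3 1 [:: 2; 1; 3]%N
      [:: inr 2; inr 0; inl 0; inr 1; inl 2; inl 3; inl 1]%N) => //; by vm_compute.
  + exists (fun j => j != 7)%N; apply: (@mutates_to_Q_check _ _ 3 2 [:: 2; 1; 3]%N
      [:: inr 2; inr 0; inl 0; inr 1; inl 2; inl 3; inl 4; inl 1]%N) => //; by vm_compute.
Qed.

Lemma bmuts_inj (W W' : eqType) (e : W -> W') b b' ks : injective e ->
  (forall i j, b i j = b' (e i) (e j)) ->
  forall i j, bmuts b ks i j = bmuts b' (map e ks) (e i) (e j).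
Proof.
move=> ie; elim: ks b b' => [|k ks IH] b b' h i j //=; apply: IH => {}i {}j.
by rewrite /bmut !h !(inj_eq ie).
Qed.

Lemma quiver_mut_seq_cat n (B : 'M[int]_n) ks ks' i j :
  quiver_mut_seq B (ks ++ ks') i j = bmuts (fun i j => quiver_mut_seq B ks i j) ks' i j.
Proof.
rewrite /quiver_mut_seq foldl_cat; elim: ks' (foldl _ _ ks) => {ks} //= k ks IH B'.
by rewrite IH; congr (bmuts _ ks _ _); apply/funext => u; apply/funext => v; rewrite mxE.
Qed.

Lemma Qkl_type_intro (K : fieldType) n m (s : seed K n m) ks k l (h : 'I_n -> nat + nat) :
  (k + l + k = n)%N -> injective h -> (forall i, h i \in qvertices k l) ->
  (forall i j, quiver_mut_seq (principal_part (exchange_matrix s)) ks i j =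
     arrow_matrix (qarrow k) (h i) (h j)) -> Qkl_type s.
Proof.
move=> hn ih hq hb.
have /choice[F hF] : forall i, exists u : 'I_(k + l) + 'I_k, qvertex u = h i.
  move=> i; have := hq i; rewrite mem_qvertices.
  case: (h i) => a ha; first by exists (inl (Ordinal ha)).
  by exists (inr (Ordinal ha)).
exists k, l, ks, F; split.
  apply: inj_card_bij => [i j /(congr1 (@qvertex k l))|]; first by rewrite !hF => /ih.
  by rewrite card_sum !card_ord hn.
by move=> i j; rewrite hb -!hF; case: (F i) => a; case: (F j) => b.
Qed.

(** Three mutation sequences are composed: to the given orientation, then to the orientation suited
    to the type, then to Q_(k,l). *)
Lemma simply_laced_Qkl_type (K : fieldType) n m (s : seed K n m) :
  simply_laced_finite_type s -> Qkl_type s.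
Proof.
move=> [d [arrow [vd ori [ks [f [bf hf]]]]]].
have [o ho] := orientation_tree vd ori.
have [o' [k [l [ks2 [h [hr hks2 ih hq hb]]]]]] := tree_mutates_to_Q vd.
have [ks1 hks1 hb1] := reorients_bmuts (reorients_all (dynkin_parent_lt vd) (dynkin_rank d) o o').
have [f' fK f'K] := bf.
pose e i : nat := f i.
have ie : injective e by move=> i j /val_inj; exact: (can_inj fK).
have [ks' hks'] : exists ks', map e ks' = ks1 ++ ks2.
  have : all (gtn (dynkin_rank d)) (ks1 ++ ks2) by rewrite all_cat hks1.
  elim: (ks1 ++ ks2) => [|v vs IH] /=; first by exists [::].
  by case/andP=> hv /IH[vs' <-]; exists (f' (Ordinal hv) :: vs'); rewrite /= /e f'K.
apply: (@Qkl_type_intro _ _ _ _ (ks ++ ks') k l (fun i => h (e i))).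
- by rewrite hr -[RHS]card_ord (bij_eq_card bf) card_ord.
- by move=> i j /ih; rewrite !inE !ltn_ord => /(_ isT isT) /ie.
- by move=> i; apply: hq; exact: ltn_ord.
move=> i j; rewrite quiver_mut_seq_cat.
rewrite (@bmuts_inj _ _ e _ (tree_matrix (dynkin_parent d) o)) // => [|u v]; last first.
  by rewrite hf -ho.
rewrite hks' /bmuts foldl_cat -/(bmuts _ ks1) -/(bmuts _ ks2).
by rewrite (@bmuts_eq _ (tree_matrix (dynkin_parent d) o') _ _ hks2 hb1) ?ltn_ord // hb ?ltn_ord.
Qed.
(** * Scott's seeds *)

Section Triangular.
Variables (C : numFieldType) (K : fieldType) (iota : {rmorphism C -> K}).

Lemma sfg_sub N (P Q : pred 'I_N) (x y : 'I_N -> K) a :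
  (forall i, P i -> Q i /\ x i = y i) -> subfield_gen iota P x a -> subfield_gen iota Q y a.
Proof.
move=> h; elim=> {a} [c|i /h[Qi ->]|a b _ ha _ hb|a b _ ha _ hb|a _ ha].
- exact: sfg_const.
- exact: sfg_var.
- exact: sfg_add.
- exact: sfg_mul.
- exact: sfg_inv.
Qed.

(** The substitution x_i := (x_i - b_i)/a_i inverts the change of coordinates, because a_i and b_i
    only involve the variables in [P], which stay fixed. *)
Lemma freely_generates_affine N (P : pred 'I_N) (x w : 'I_N -> K) :
  freely_generates iota x -> (forall i, P i -> w i = x i) ->
  (forall i, ~~ P i -> exists a b, [/\ a != 0, subfield_gen iota P x a,
     subfield_gen iota P x b & w i = a * x i + b]) ->
  freely_generates iota w.
Proof.
move=> fx hP hN.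
have /choice[ab hab] i : exists ab : K * K, [/\ ab.1 != 0, subfield_gen iota P x ab.1,
    subfield_gen iota P x ab.2 & w i = if P i then x i else ab.1 * x i + ab.2].
  have [Pi|/hN[a [b [a0 ha hb e]]]] := boolP (P i); last by exists (a, b).
  exists (1, 0); split; rewrite ?oner_neq0 ?hP //; first exact: sfg_1.
  exact: sfg_0.
have [D [sg S]] := @specialization_exists _ _ _ iota iota _ _
  (fun i => if P i then x i else (x i - (ab i).2) / (ab i).1) fx.
have fixP a : subfield_gen iota P x a -> D a /\ sg a = a.
  elim=> {a} [c|i Pi|a b _ [Da sa] _ [Db sb]|a b _ [Da sa] _ [Db sb]|a _ [Da sa]].
  - exact: (spec_const S).
  - by have := spec_var S i; rewrite Pi.
  - by have := spec_add S Da Db; rewrite sa sb.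
  - by have := spec_mul S Da Db; rewrite sa sb.
  - have [->|a0] := eqVneq a 0; first by rewrite invr0; exact: (spec0 S).
    by have := spec_inv S Da; rewrite sa; apply.
apply: (freely_generates_subst fx S) => i; have [a0 ha hb e] := hab i; rewrite ?e.
  case: ifP => Pi; first by have := spec_var S i; rewrite Pi.
  have [Da sa] := fixP _ ha; have [Db sb] := fixP _ hb; have [Di si] := spec_var S i.
  have [D1 s1] := spec_mul S Da Di; have [D2 s2] := spec_add S D1 Db; split=> //.
  by rewrite s2 s1 sa sb si Pi mulrC divfK // subrK.
have sub a : subfield_gen iota P x a -> subfield_gen iota predT w a.
  by apply: sfg_sub => j /hP.
have xw : x i = if P i then w i else (w i - (ab i).2) / (ab i).1.
  by case Pi: (P i); rewrite e Pi // addrK mulrC mulKf.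
rewrite xw; case: ifP => _; first exact: sfg_var.
apply: sfg_mul; last by apply: sfg_inv; exact: sub.
apply: sfg_add; first exact: sfg_var.
rewrite -mulN1r -(rmorphN1 iota); apply: sfg_mul; last exact: sub.
exact: sfg_const.
Qed.

(** Coordinates are replaced level by level from the top: [y t] keeps the old ones below level t,
    and the coefficients at level t involve only those. *)
Lemma freely_generates_triangular N (d : 'I_N -> nat) (x w : 'I_N -> K) :
  freely_generates iota x ->
  (forall i, exists a b, [/\ a != 0, subfield_gen iota (fun j => d j < d i)%N x a,
     subfield_gen iota (fun j => d j < d i)%N x b & w i = a * x i + b]) ->
  freely_generates iota w.
Proof.
move=> fx hw; pose y t i := if (d i < t)%N then x i else w i.
suff step t s : freely_generates iota (y (s + t)%N) -> freely_generates iota (y t).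
  have -> : w = y 0%N by [].
  apply: (step 0%N (\max_i d i).+1).
  suff -> : y ((\max_i d i).+1 + 0)%N = x by [].
  by apply/funext => i; rewrite /y addn0 ltnS leq_bigmax.
elim: s => // s IH fs; apply: IH; apply: (freely_generates_affine (P := fun i => d i != s + t)%N) fs _ _.
  by move=> i hi; rewrite /y (_ : d i < s.+1 + t = (d i < s + t))%N //; lia.
move=> i; rewrite negbK => /eqP hi; have [a [b [a0 ha hb e]]] := hw i.
have sub u : subfield_gen iota (fun j => d j < d i)%N x u ->
    subfield_gen iota (fun j => d j != s + t)%N (y (s.+1 + t)%N) u.
  apply: sfg_sub => j; rewrite hi => hj; split; first by rewrite ltn_eqF.
  by rewrite /y addSn ltnS ltnW.
exists a, b; split=> //; try exact: sub.
by rewrite /y hi ltnn addSn ltnSn.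
Qed.

Lemma freely_generates_reindex N M (x : 'I_N -> K) (tau : 'I_M -> 'I_N) :
  bijective tau -> freely_generates iota x -> freely_generates iota (x \o tau).
Proof.
move=> bt; have eMN : M = N by have := bij_eq_card bt; rewrite !card_ord.
case: N / eMN tau bt x => tau [tau' tK tK'] x fx.
have [D [sg S]] := @specialization_exists _ _ _ iota iota _ _ (x \o tau') fx.
apply: (freely_generates_subst fx S) => i.
  by have := spec_var S (tau i); rewrite /= tK.
by rewrite -[x i]/(x i) -{1}(tK' i); exact: (@sfg_var _ _ iota _ predT (x \o tau) (tau' i)).
Qed.

End Triangular.

Lemma divn_modn_lt i c d : (i < c * d)%N -> (i %/ d < c)%N /\ (i %% d < d)%N.
Proof. by case: d => [|d]; rewrite ?muln0 // ltn_divLR ?ltn_pmod. Qed.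

(** * Rectangular minors of the generic matrix *)

Section PlueckerCoordinates.
Variables (C : numFieldType) (k p : nat).
Let K : fieldType := grass_field C k p.

Definition generic_entry (r j : nat) : K :=
  match insub r, insub j with
  | Some r', Some j' => FracField.tofrac 'X_(mxvec_index (r' : 'I_k) (j' : 'I_p))
  | _, _ => 0
  end.

Definition generic_column (r j : nat) : K :=
  if (j < k)%N then (r == j)%:R else generic_entry r (j - k).

Definition rectangle_column (a b c : nat) : nat :=
  if (c < k - a.+1)%N then c else (c + b.+1)%N.

(** Both lists are strictly increasing and have the same members. *)
Lemma enum_rectangle_set a b : (a < k)%N -> (b < p)%N ->
  map val (enum (rectangle_set k p (a, b))) = map (rectangle_column a b) (iota 0 k).
Proof.
move=> ak bp; apply: (irr_sorted_eq ltn_trans ltnn).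
- rewrite /enum_mem -enumT.
  have -> : [seq val i | i <- enum 'I_(k + p) & i \in rectangle_set k p (a, b)] =
    [seq c <- map val (enum 'I_(k + p)) |
      (c < k - a.+1) || (k - a.+1 + b.+1 <= c < k + b.+1)]%N.
    by rewrite filter_map; congr map; apply: eq_filter => c; rewrite inE.
  by apply: sorted_filter; [exact: ltn_trans|rewrite val_enum_ord iota_ltn_sorted].
- apply: (homo_sorted (e := ltn)) (iota_ltn_sorted 0 k) => i j; rewrite /rectangle_column.
  by case: ifP; case: ifP; lia.
- move=> v; apply/mapP/mapP => [[c]|[c]].
    rewrite mem_enum inE /= => hc ->; have [h|h] := ltnP c (k - a.+1).
      exists (c : nat); last by rewrite /rectangle_column h.
      by rewrite mem_iota; lia.
    exists (c - b.+1)%N; first by rewrite mem_iota; lia.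
    by rewrite /rectangle_column; case: ifP; lia.
  rewrite mem_iota add0n /= => ck ->.
  have h : (rectangle_column a b c < k + p)%N by rewrite /rectangle_column; case: ifP; lia.
  exists (Ordinal h) => //; rewrite mem_enum inE /= /rectangle_column.
  by case: ifP; lia.
Qed.

Lemma pluecker_rectangle a b : (a < k)%N -> (b < p)%N ->
  pluecker C (rectangle_set k p (a, b)) =
  \det (\matrix_(r < k, c < k) generic_column r (rectangle_column a b c)).
Proof.
move=> ak bp; congr (\det _); apply/matrixP => r c; rewrite !mxE.
have es := enum_rectangle_set ak bp; set s := enum _ in es *.
have sz : size s = k by rewrite -(size_map val) es size_map size_iota.
have kp : (0 < k + p)%N by lia.
rewrite (nth_map (Ordinal kp)) ?sz //; set j := nth _ s c.
have ej : j = rectangle_column a b c :> nat.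
  rewrite -[LHS]/(val j) -(nth_map (Ordinal kp) 0%N) ?sz // es.
  by rewrite (nth_map 0%N) ?size_iota // nth_iota.
rewrite -ej mxE /generic_column /generic_entry; case: splitP => i ->.
  by rewrite mxE.
by rewrite addKn !valK mxE.
Qed.

Hypotheses (k0 : (0 < k)%N) (p0 : (0 < p)%N).
Local Notation n := ((k - 1) * (p - 1))%N.
Local Notation m := (k + p - 1)%N.

Lemma rectangle_lt (v : 'I_(n + m)) : let ab := rectangle_of v in (ab.1 < k)%N /\ (ab.2 < p)%N.
Proof.
rewrite /rectangle_of; case: splitP => [u _|w _] /=; last by have := ltn_ord w; case: ifP => /=; lia.
by have := divn_modn_lt (ltn_ord u); lia.
Qed.

Lemma rectangle_inj : injective (@rectangle_of k p).
Proof.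
have hu (u : 'I_n) := divn_modn_lt (ltn_ord u).
move=> v v'; rewrite /rectangle_of.
case: (split_ordP v) => u ->; case: (split_ordP v') => u' -> /=.
- by case=> e1 e2; congr lshift; apply: val_inj; rewrite /= (divn_eq u (p - 1)) e1 e2 -divn_eq.
- by have := hu u; case: ifP => _ h [] e1 e2; lia.
- by have := hu u'; case: ifP => _ h [] e1 e2; lia.
- move=> e; congr rshift; apply: val_inj; have := ltn_ord u; have := ltn_ord u'.
  by move: e; case: ifP; case: ifP => h1 h2 [] e1 e2 /=; lia.
Qed.

Lemma leading_lt (v : 'I_(n + m)) : (k - (rectangle_of v).1.+1 < k)%N.
Proof. by have [] := rectangle_lt v; lia. Qed.

Lemma width_lt (v : 'I_(n + m)) : ((rectangle_of v).2 < p)%N.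
Proof. by have [] := rectangle_lt v. Qed.

(* The leading variable of a rectangular minor is its entry in the upper right
   corner. *)
Definition leading (v : 'I_(n + m)) : 'I_(k * p) :=
  mxvec_index (Ordinal (leading_lt v)) (Ordinal (width_lt v)).

(** Injectivity suffices, because (k - 1)(p - 1) + (k + p - 1) = kp. *)
Lemma leading_bij : bijective leading.
Proof.
apply: inj_card_bij => [v v' /cast_ord_inj/enum_rank_inj[] e1 e2|].
  have [h1 h2] := rectangle_lt v; have [h1' h2'] := rectangle_lt v'.
  apply: rectangle_inj; move: e1 e2 h1 h1'.
  by case: (rectangle_of v) (rectangle_of v') => a b [a' b'] /= e1 -> h1 h1'; congr pair; lia.
by rewrite !card_ord; nia.
Qed.

Definition variable (v : 'I_(n + m)) : K := FracField.tofrac 'X_(leading v).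

Lemma variable_entry v :
  variable v = generic_entry (k - (rectangle_of v).1.+1) (rectangle_of v).2.
Proof.
rewrite /generic_entry -[(k - _)%N]/(val (Ordinal (leading_lt v))).
by rewrite -[(rectangle_of v).2]/(val (Ordinal (width_lt v))) !valK.
Qed.

Lemma variable_free : freely_generates (grass_const C k p) variable.
Proof. exact: freely_generates_reindex leading_bij (@freely_generates_frac C (k * p)). Qed.

(** Orders the leading entries by columns from left to right, and from bottom to top within a
    column. *)
Definition height (v : 'I_(n + m)) : nat := ((rectangle_of v).2 * k + (rectangle_of v).1)%N.

Lemma lower_entry v r j : (r < k)%N -> (j < (rectangle_of v).2)%N ||
    (j == (rectangle_of v).2) && (k - r.+1 < (rectangle_of v).1)%N ->
  subfield_gen (grass_const C k p) (fun v' => height v' < height v)%N variable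
    (generic_entry r j).
Proof.
move=> rk h; have [h1 h2] := rectangle_lt v; have jp : (j < p)%N by lia.
have [g gK Kg] := leading_bij.
have := Kg (mxvec_index (Ordinal rk) (Ordinal jp)); set u := g _ => hu.
have [e1 e2] : (k - (rectangle_of u).1.+1 = r)%N /\ (rectangle_of u).2 = j.
  by move/cast_ord_inj/enum_rank_inj: hu => -[].
have -> : generic_entry r j = variable u by rewrite variable_entry e1 e2.
apply: sfg_var; rewrite /height e2; have [h1' _] := rectangle_lt u.
by move: h; case: (rectangle_of v) h1 h2 => a b /= h1 h2; nia.
Qed.

End PlueckerCoordinates.

Lemma det2 (R : comNzRingType) (F : nat -> nat -> R) :
  \det (\matrix_(r < 2, c < 2) F r c) = F 0%N 0%N * F 1%N 1%N - F 0%N 1%N * F 1%N 0%N.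
Proof.
rewrite (expand_det_row _ ord0) !big_ord_recl big_ord0 /cofactor !det_mx11 !mxE /=.
rewrite /bump /=.
ring.
Qed.

Lemma det3 (R : comNzRingType) (F : nat -> nat -> R) :
  \det (\matrix_(r < 3, c < 3) F r c) =
    F 0%N 2%N * (F 1%N 0%N * F 2%N 1%N - F 1%N 1%N * F 2%N 0%N)
    - F 1%N 2%N * (F 0%N 0%N * F 2%N 1%N - F 0%N 1%N * F 2%N 0%N)
    + F 2%N 2%N * (F 0%N 0%N * F 1%N 1%N - F 0%N 1%N * F 1%N 0%N).
Proof.
rewrite (expand_det_row _ ord0) !big_ord_recl big_ord0 /cofactor.
have e i j : \det (row' i (col' j (\matrix_(r < 3, c < 3) F r c))) =
    F (bump i 0) (bump j 0) * F (bump i 1) (bump j 1)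
    - F (bump i 0) (bump j 1) * F (bump i 1) (bump j 0).
  rewrite -(det2 (fun r c => F (bump i r) (bump j c))); congr (\det _).
  by apply/matrixP => r c; rewrite !mxE.
by rewrite !e !mxE /= /bump /=; ring.
Qed.

Section ScottSeed.
Variables (C : numFieldType) (k p : nat).
Hypotheses (k0 : (0 < k)%N) (p0 : (0 < p)%N).
Local Notation entry := (@generic_entry C k p).
Local Notation column := (@generic_column C k p).

Lemma generic_entry_neq0 r j : (r < k)%N -> (j < p)%N -> entry r j != 0.
Proof.
move=> rk jp; rewrite /generic_entry -[r]/(val (Ordinal rk)) -[j]/(val (Ordinal jp)) !valK.
exact: fg_neq0 _ (@freely_generates_frac C (k * p)).
Qed.

(** With its two diagonal entries set to 1 and all other variables to 0, the minor becomes 1. *)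
Lemma generic_minor_neq0 r r' j j' : (r < k)%N -> (r' < k)%N -> (j < p)%N -> (j' < p)%N ->
  r != r' -> j != j' -> entry r j * entry r' j' - entry r j' * entry r' j != 0.
Proof.
move=> rk rk' jp jp' rr jj; rewrite /generic_entry -[r]/(val (Ordinal rk)).
rewrite -[j]/(val (Ordinal jp)) -[r']/(val (Ordinal rk')) -[j']/(val (Ordinal jp')) !valK.
have [D [sg S]] := @specialization_exists _ _ _ (frac_const C (k * p)) (frac_const C (k * p)) _ _
  (fun q => ((q == mxvec_index (Ordinal rk) (Ordinal jp)) ||
             (q == mxvec_index (Ordinal rk') (Ordinal jp')))%:R)
  (@freely_generates_frac C (k * p)).
have eqE i i' (l l' : 'I_p) : (mxvec_index i l == mxvec_index i' l' :> 'I_(k * p)) =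
    (i == i') && (l == l').
  by rewrite (inj_eq (@cast_ord_inj _ _ _)) (inj_eq enum_rank_inj).
have hv := spec_var S.
have [D1 s1] := hv (mxvec_index (Ordinal rk) (Ordinal jp)).
have [D2 s2] := hv (mxvec_index (Ordinal rk') (Ordinal jp')).
have [D3 s3] := hv (mxvec_index (Ordinal rk) (Ordinal jp')).
have [D4 s4] := hv (mxvec_index (Ordinal rk') (Ordinal jp)).
have [D5 s5] := spec_mul S D1 D2; have [D6 s6] := spec_mul S D3 D4.
have [D7 s7] := spec_mul S (proj1 (specN1 S)) D6; have [_ s8] := spec_add S D5 D7.
apply: contra_neq (oner_neq0 (grass_field C k p)) => e.
move: s8; rewrite s7 s5 s6 s1 s2 s3 s4 (proj2 (specN1 S)) mulN1r e (proj2 (spec0 S)) !eqE -!val_eqE /=.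
by rewrite !eqxx (negbTE rr) ![_ == r]eq_sym (negbTE rr) ![_ == j]eq_sym (negbTE jj) /= mul0r mulr0 addr0 mulr1.
Qed.

Lemma generic_column_lt r j : (j < k)%N -> column r j = (r == j)%:R.
Proof. by rewrite /generic_column => ->. Qed.

Lemma generic_column_ge r j : column r (k + j) = entry r j.
Proof. by rewrite /generic_column ltnNge leq_addr addKn. Qed.

Lemma lower_column (v : 'I_((k - 1) * (p - 1) + (k + p - 1))) r j : (r < k)%N ->
  (j < k + (rectangle_of v).2)%N ||
  (j == k + (rectangle_of v).2)%N && (k - r.+1 < (rectangle_of v).1)%N ->
  subfield_gen (grass_const C k p) (fun v' => height v' < height v)%N (@variable C k p k0 p0)
    (column r j).
Proof.
move=> rk h; rewrite /generic_column; case: ifP => jk; last by apply: lower_entry => //; lia.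
by rewrite -(rmorph_nat (grass_const C k p)); exact: sfg_const.
Qed.

Lemma scott_skew : skew_symmetric (principal_part (exchange_matrix (scott_seed C k p))).
Proof. by apply/matrixP => u v; rewrite !mxE opprB. Qed.

End ScottSeed.

Lemma sfg_opp (C K : fieldType) (iota : {rmorphism C -> K}) N (P : pred 'I_N) x a :
  subfield_gen iota P x a -> subfield_gen iota P x (- a).
Proof.
by rewrite -mulN1r -(rmorphN1 iota) => ha; apply: sfg_mul => //; exact: sfg_const.
Qed.

Lemma scott_free2 (C : numFieldType) p : (0 < p)%N ->
  freely_generates (grass_const C 2 p) (variables (scott_seed C 2 p)).
Proof.
move=> p0; have k0 : (0 < 2)%N by [].
apply: (freely_generates_triangular (d := @height 2 p) (variable_free C k0 p0)) => v.
have [] := rectangle_lt k0 p0 v; have := variable_entry C k0 p0 v; have := @lower_column C _ _ k0 p0 v.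
rewrite ffunE; case: (rectangle_of v) => a b /= low -> h1 h2.
rewrite pluecker_rectangle //; set G := @generic_column C 2 p in low *.
rewrite (det2 (fun r c => G r (rectangle_column 2 a b c))).
have Glt r j : (j < 2)%N -> G r j = (r == j)%:R by exact: generic_column_lt.
have Gge r j : G r j.+2 = generic_entry C 2 p r j by exact: generic_column_ge.
case: a h1 low => [|[|a]] // _ low; rewrite /rectangle_column /= ?add0n ?add1n.
(* For a rectangle with one row the identity column reduces the minor to its leading entry. *)
- exists 1, 0; rewrite !(Glt _ 0%N) // Gge mulr0 subr0 mul1r addr0 oner_neq0.
  by split=> //; [exact: sfg_1|exact: sfg_0].
- exists (- G 1%N b.+1), (G 0%N b.+1 * G 1%N b.+2); split.
  (* For b = 0 the column b + 1 still belongs to the identity block. *)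
  + rewrite oppr_eq0; case: b h2 {low} => [|b] h2; first by rewrite Glt ?oner_neq0.
    by rewrite Gge generic_entry_neq0 // ltnW.
  + by apply: sfg_opp; apply: low => //; lia.
  + by apply: sfg_mul; apply: low => //; lia.
  + by rewrite -Gge; ring.
Qed.

Lemma scott_free3 (C : numFieldType) p : (0 < p)%N ->
  freely_generates (grass_const C 3 p) (variables (scott_seed C 3 p)).
Proof.
move=> p0; have k0 : (0 < 3)%N by [].
apply: (freely_generates_triangular (d := @height 3 p) (variable_free C k0 p0)) => v.
have [] := rectangle_lt k0 p0 v; have := variable_entry C k0 p0 v; have := @lower_column C _ _ k0 p0 v.
rewrite ffunE; case: (rectangle_of v) => a b /= low -> h1 h2.
rewrite pluecker_rectangle //; set G := @generic_column C 3 p in low *.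
rewrite (det3 (fun r c => G r (rectangle_column 3 a b c))).
have Glt r j : (j < 3)%N -> G r j = (r == j)%:R by exact: generic_column_lt.
have Gge r j : G r j.+3 = generic_entry C 3 p r j by exact: generic_column_ge.
case: a h1 low => [|[|[|a]]] // _ low; rewrite /rectangle_column /= ?add0n ?add1n ?add2n.
- exists 1, 0; split; rewrite ?oner_neq0 //; [exact: sfg_1|exact: sfg_0|].
  by rewrite !(Glt _ 0%N) ?(Glt _ 1%N) // -Gge /=; ring.
- exists (- G 2%N b.+2), (G 2%N b.+3 * G 1%N b.+2); split.
  + rewrite oppr_eq0; case: b h2 {low} => [|b] h2; first by rewrite Glt ?oner_neq0.
    by rewrite Gge generic_entry_neq0 // ltnW.
  + by apply: sfg_opp; apply: low => //; lia.
  + by apply: sfg_mul; apply: low => //; lia.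
  + by rewrite !(Glt _ 0%N) // -Gge /=; ring.
- exists (G 1%N b.+1 * G 2%N b.+2 - G 1%N b.+2 * G 2%N b.+1),
    (G 2%N b.+3 * (G 0%N b.+1 * G 1%N b.+2 - G 0%N b.+2 * G 1%N b.+1)
     - G 1%N b.+3 * (G 0%N b.+1 * G 2%N b.+2 - G 0%N b.+2 * G 2%N b.+1)).
  have l r j : (r < 3)%N -> (j < 3 + b)%N || (j == 3 + b)%N && (3 - r.+1 < 2)%N ->
    subfield_gen (grass_const C 3 p) (fun v' => height v' < height v)%N (variable C k0 p0) (G r j).
    exact: low.
  split.
  (* Of the two columns of this cofactor, both, one or none belong to the identity block when b is
     0, 1 or larger. *)
  + case: b h2 {low l} => [|[|b]] h2.
    * by rewrite !Glt // /= mulr0 subr0 mulr1 oner_neq0.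
    * by rewrite !(Glt _ 2%N) // /= !Gge mulr1 mul0r sub0r oppr_eq0 generic_entry_neq0 // ltnW.
    * by rewrite !Gge; apply: generic_minor_neq0 => //; lia.
  + by apply: sfg_add; [|apply: sfg_opp]; apply: sfg_mul; apply: l => //; lia.
  + apply: sfg_add; [|apply: sfg_opp]; apply: sfg_mul; try (by apply: l => //; lia).
      by apply: sfg_add; [|apply: sfg_opp]; apply: sfg_mul; apply: l => //; lia.
    by apply: sfg_add; [|apply: sfg_opp]; apply: sfg_mul; apply: l => //; lia.
  + by rewrite -Gge; ring.
Qed.

(** For k = 2 the mutable rectangles have one row and form a linear quiver. For k = 3 the rectangles
    with one row are the b_i and those with two rows the t_i, indexed by their width. *)
Lemma scott_Qkl_type (C : numFieldType) k p : (k = 2 \/ k = 3)%N -> (0 < p)%N ->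
  Qkl_type (scott_seed C k p).
Proof.
case=> -> p0.
- apply: (@Qkl_type_intro _ _ _ _ [::] 0 (p - 1) (fun i => inl (val i))).
  + by lia.
  + by move=> i j [] /val_inj.
  + by move=> i; rewrite mem_qvertices /=; have := ltn_ord i; lia.
  + move=> i j; rewrite !mxE /rectangle_of !(unsplitK (inl _)) /arrow_matrix /rectangle_arrow /=.
    have e (u : 'I_((2 - 1) * (p - 1))) : (u %/ (p - 1) = 0)%N /\ (u %% (p - 1) = u)%N.
      have hu : (u < p - 1)%N by have := ltn_ord u; lia.
      by rewrite divn_small ?modn_small.
    by rewrite !(proj1 (e _)) !(proj2 (e _)); lia.
- apply: (@Qkl_type_intro _ _ _ _ [::] (p - 1) 0
    (fun i => (if (i %/ (p - 1) == 0)%N then inr else inl) (i %% (p - 1))%N)).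
  + by lia.
  + move=> i j e; apply: val_inj; rewrite /= (divn_eq i (p - 1)) (divn_eq j (p - 1)).
    have [hi _] := divn_modn_lt (ltn_ord i); have [hj _] := divn_modn_lt (ltn_ord j).
    move: (i %/ _)%N (j %/ _)%N (i %% _)%N (j %% _)%N hi hj e => a a' b b' hi hj.
    case: eqP => h1; case: eqP => h2 // [] ->; first by rewrite h1 h2.
    by have -> : a = a' by lia.
  + move=> i; rewrite mem_qvertices; have := divn_modn_lt (ltn_ord i).
    by case: ifP => _; lia.
  + move=> i j; rewrite !mxE /rectangle_of !(unsplitK (inl _)) /arrow_matrix /rectangle_arrow /=.
    have := divn_modn_lt (ltn_ord i); have := divn_modn_lt (ltn_ord j).
    move: (i %/ _)%N (j %/ _)%N (i %% _)%N (j %% _)%N => a a' b b' hj hi.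
    by have [->|h1] := eqVneq a 0%N; have [->|h2] := eqVneq a' 0%N => /=; lia.
Qed.

Lemma scott_is_seed (C : numFieldType) k p : (k = 2 \/ k = 3)%N -> (0 < p)%N ->
  is_seed (grass_const C k p) (scott_seed C k p).
Proof.
move=> hk p0; split; last exact: scott_skew.
by case: hk => ->; [exact: scott_free2|exact: scott_free3].
Qed.

Theorem theorem1p2 (R : realType) :
  [/\ (forall (K : fieldType) (iota : {rmorphism R[i] -> K}) (n m : nat)
         (s : seed K n m),
         is_seed iota s -> Qkl_type s ->
         mysterious_points iota s = set0 /\
         deep_locus iota s = stabilizer_locus iota s),
      (forall (K : fieldType) (iota : {rmorphism R[i] -> K}) (n m : nat)
         (s : seed K n m),
         is_seed iota s -> simply_laced_finite_type s ->
         [/\ Qkl_type s,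
             mysterious_points iota s = set0
           & deep_locus iota s = stabilizer_locus iota s])
    & (forall k N : nat, (k = 2 \/ k = 3)%N -> (k < N)%N ->
         let s := scott_seed R[i] k (N - k) in
         let iota := grass_const R[i] k (N - k) in
         [/\ is_seed iota s,
             Qkl_type s,
             mysterious_points iota s = set0
           & deep_locus iota s = stabilizer_locus iota s])].
Proof.
split.
- by move=> K iota n m s; exact: Qkl_no_mysterious_points.
- move=> K iota n m s ss /simply_laced_Qkl_type hs.
  by have [] := Qkl_no_mysterious_points ss hs.
- move=> k N hk kN s iota; have p0 : (0 < N - k)%N by rewrite subn_gt0.
  have ss : is_seed iota s by exact: scott_is_seed.
  have hs : Qkl_type s by exact: scott_Qkl_type.
  by have [] := Qkl_no_mysterious_points ss hs.
Qed.
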